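(* Let $\epsilon\in (0,1)$. Let $G=(V,E)$ be a directed graph with $n$ vertices, $m$ edges, edge weights in $\{0\}\cup [1,W]$, and a source $s\in V$. Suppose we are given a sequence of $\Delta$ incremental updates to $G$ (edge insertions or edge weight decreases), and let $G^0,\ldots,G^\Delta$ denote the subsequent versions of $G$ ($G^0$ the initial graph, $G^j$ the graph after the first $j$ updates). Then in $O(m \log(n)\log(nW) \log^2(\Delta) / \epsilon + \Delta)$ deterministic time one can compute a data structure supporting queries $(v,j)$, with $v\in V$ and $0\le j\le \Delta$, that return a $(1+\epsilon)$-approximate estimate of $\mathrm{dist}_{G^j}(s,v)$, i.e., a value $\tilde d$ with $\mathrm{dist}_{G^j}(s,v)\le \tilde d\le (1+\epsilon)\mathrm{dist}_{G^j}(s,v)$. The query time is $O(\log(\log(nW)\log(\Delta)/\epsilon))$.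
   Context: $\mathrm{dist}_{H}(s,v)$ denotes the minimum weight of an $s\to v$ path in the directed graph $H$. Here $m$ refers to the number of edges of the graph (the final graph $G^\Delta$). *)

(* Defs.v *)
(* MathComp and MathComp-Analysis. *)
From HB Require Import structures.
From mathcomp Require Import all_boot all_order all_algebra.
From mathcomp Require Import all_classical all_reals all_analysis.

Set Implicit Arguments.
Unset Strict Implicit.
Unset Printing Implicit Defensive.

Import Order.TTheory GRing.Theory Num.Theory.
Local Open Scope classical_set_scope.
Local Open Scope ring_scope.

(** * Weighted digraphs and incremental updates *)

(* [G x y = Some w] when xy is an edge of weight w, [None] when it is not an
   edge. *)
Definition wgraph (R : realType) (n : nat) := 'I_n -> 'I_n -> option R.

Definition wedge (R : realType) (n : nat) := ('I_n * 'I_n * R)%type.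

Section Graphs.
Context {R : realType} {n : nat}.
Implicit Types (G : wgraph R n) (e : wedge R n) (us : seq (wedge R n)).

Definition adj G : rel 'I_n := fun x y => G x y != None.

Definition nb_edges G : nat := #|[set p : 'I_n * 'I_n | adj G p.1 p.2]|%SET.

Definition weights_in (W : R) G : Prop :=
  forall x y w, G x y = Some w -> w = 0 \/ 1 <= w <= W.

(* The weight of the walk that starts at x and then visits p. *)
Fixpoint walk_weight G (x : 'I_n) (p : seq 'I_n) : R :=
  if p is y :: p' then odflt 0 (G x y) + walk_weight G y p' else 0.

(* As weights are nonnegative, the infimum is attained by a simple path as soon
   as there is a walk from s to v; otherwise it is +oo. *)
Definition wdist G (s v : 'I_n) : \bar R :=
  ereal_inf [set (walk_weight G s p)%:E |
             p in [set p : seq 'I_n | path (adj G) s p /\ last s p = v]].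

(* [(u, v, w)] inserts the edge uv with weight w if it is absent, and otherwise
   changes its weight to w. *)
Definition apply_update G e : wgraph R n :=
  fun x y => if (x == e.1.1) && (y == e.1.2) then Some e.2 else G x y.

(* Insertion of an absent edge, or decrease of the weight of a present one. *)
Definition incremental G e : Prop :=
  if G e.1.1 e.1.2 is Some w then e.2 < w else True.

Fixpoint incremental_seq (W : R) G us : Prop :=
  if us is e :: us' then
    [/\ e.2 = 0 \/ 1 <= e.2 <= W, incremental G e
      & incremental_seq W (apply_update G e) us']
  else True.

Definition version G us (j : nat) : wgraph R n :=
  foldl apply_update G (take j us).

Definition edge_list G (es : seq (wedge R n)) : Prop :=
  uniq es /\ forall x y w, ((x, y, w) \in es) = (G x y == Some w).

End Graphs.

(* Logarithms in asymptotic bounds are read as being at least 1. *)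
Definition lg {R : realType} (x : R) : R := Num.max 1 (ln x).

(** * The machine

    A random access machine with two kinds of cells: words, which hold natural
    numbers below a bound [B], and real cells, which can be added, subtracted,
    multiplied, divided and compared exactly, but not rounded or converted to
    words.  It has scalar registers and unboundedly long arrays of both kinds,
    named by numerals that are fixed in the program. *)

Inductive iexp :=
| ICst of nat
| IReg of nat
| IGet of nat & iexp
| IAdd of iexp & iexp
| ISub of iexp & iexp
| IMul of iexp & iexp
| IDiv of iexp & iexp.

Inductive rexp :=
| RCst of nat
| RReg of nat
| RGet of nat & iexp
| RAdd of rexp & rexp
| RSub of rexp & rexp
| RMul of rexp & rexp
| RDiv of rexp & rexp.

Inductive bexp :=
| BILe of iexp & iexp
| BRLe of rexp & rexp
| BNot of bexp
| BAnd of bexp & bexp.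

Inductive cmd :=
| Skip
| ISet of nat & iexp
| RSet of nat & rexp
| IPut of nat & iexp & iexp
| RPut of nat & iexp & rexp
| Seq of cmd & cmd
| If of bexp & cmd & cmd
| While of bexp & cmd.

Record state (R : realType) := State {
  ireg : nat -> nat;
  rreg : nat -> R;
  iarr : nat -> nat -> nat;
  rarr : nat -> nat -> R }.

Definition upd {T : Type} (f : nat -> T) (i : nat) (x : T) : nat -> T :=
  fun j => if j == i then x else f j.

Section Semantics.
Context {R : realType}.
Variable B : nat.
Implicit Types (st : state R) (t : nat).

Definition set_ireg st x k :=
  State (upd (ireg st) x k) (rreg st) (iarr st) (rarr st).
Definition set_rreg st x r :=
  State (ireg st) (upd (rreg st) x r) (iarr st) (rarr st).
Definition set_iarr st a i k :=
  State (ireg st) (rreg st)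
    (upd (iarr st) a (upd (iarr st a) i k)) (rarr st).
Definition set_rarr st a i r :=
  State (ireg st) (rreg st) (iarr st)
    (upd (rarr st) a (upd (rarr st a) i r)).

Definition word (k : nat) : option nat := if (k < B)%N then Some k else None.

Definition bind2 {X Y Z} (f : X -> Y -> option Z) x y : option Z :=
  obind (fun a => obind (f a) y) x.

(* Evaluation is undefined if an intermediate result does not fit in a word, or
   upon a division by zero; subtraction of words is truncated at 0. *)
Fixpoint ieval st (e : iexp) : option nat :=
  match e with
  | ICst k => word k
  | IReg x => word (ireg st x)
  | IGet a i => obind (fun k => word (iarr st a k)) (ieval st i)
  | IAdd e1 e2 => bind2 (fun k l => word (k + l)) (ieval st e1) (ieval st e2)
  | ISub e1 e2 => bind2 (fun k l => word (k - l)) (ieval st e1) (ieval st e2)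
  | IMul e1 e2 => bind2 (fun k l => word (k * l)) (ieval st e1) (ieval st e2)
  | IDiv e1 e2 =>
      bind2 (fun k l => if l == 0%N then None else word (k %/ l))
        (ieval st e1) (ieval st e2)
  end.

Fixpoint reval st (e : rexp) : option R :=
  match e with
  | RCst k => Some k%:R
  | RReg x => Some (rreg st x)
  | RGet a i => omap (rarr st a) (ieval st i)
  | RAdd e1 e2 => bind2 (fun x y => Some (x + y)) (reval st e1) (reval st e2)
  | RSub e1 e2 => bind2 (fun x y => Some (x - y)) (reval st e1) (reval st e2)
  | RMul e1 e2 => bind2 (fun x y => Some (x * y)) (reval st e1) (reval st e2)
  | RDiv e1 e2 =>
      bind2 (fun x y => if y == 0 then None else Some (x / y))
        (reval st e1) (reval st e2)
  end.

Fixpoint beval st (b : bexp) : option bool :=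
  match b with
  | BILe e1 e2 => bind2 (fun k l => Some (k <= l)%N) (ieval st e1) (ieval st e2)
  | BRLe e1 e2 => bind2 (fun x y => Some (x <= y)) (reval st e1) (reval st e2)
  | BNot b1 => omap negb (beval st b1)
  | BAnd b1 b2 =>
      bind2 (fun p q => Some (p && q)) (beval st b1) (beval st b2)
  end.

(* [exec c st t st']: started in st, c terminates in st' within exactly t steps.
   Each assignment and each test takes one step: the expressions of a program
   have bounded size, so this is the number of elementary operations up to a
   factor that depends on the program only.  There is no derivation if c
   diverges or evaluates an undefined expression. *)
Inductive exec : cmd -> state R -> nat -> state R -> Prop :=
| exec_skip st : exec Skip st 1 st
| exec_iset st x e k :
    ieval st e = Some k -> exec (ISet x e) st 1 (set_ireg st x k)
| exec_rset st x e r :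
    reval st e = Some r -> exec (RSet x e) st 1 (set_rreg st x r)
| exec_iput st a e1 e2 i k :
    ieval st e1 = Some i -> ieval st e2 = Some k ->
    exec (IPut a e1 e2) st 1 (set_iarr st a i k)
| exec_rput st a e1 e2 i r :
    ieval st e1 = Some i -> reval st e2 = Some r ->
    exec (RPut a e1 e2) st 1 (set_rarr st a i r)
| exec_seq st st1 st2 t1 t2 c1 c2 :
    exec c1 st t1 st1 -> exec c2 st1 t2 st2 ->
    exec (Seq c1 c2) st (t1 + t2) st2
| exec_if st st1 t p b c1 c2 :
    beval st b = Some p -> exec (if p then c1 else c2) st t st1 ->
    exec (If b c1 c2) st t.+1 st1
| exec_while_false st b c :
    beval st b = Some false -> exec (While b c) st 1 st
| exec_while_true st st1 st2 t1 t2 b c :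
    beval st b = Some true -> exec c st t1 st1 ->
    exec (While b c) st1 t2 st2 ->
    exec (While b c) st (t1 + t2).+1 st2.

Lemma exec_deterministic c st t1 st1 t2 st2 :
  exec c st t1 st1 -> exec c st t2 st2 -> t1 = t2 /\ st1 = st2.
Proof.
move=> H; elim: H t2 st2 => {c st t1 st1};
  intros;
  match goal with E : exec _ _ ?t _ |- _ = ?t /\ _ => inversion E; subst end;
  repeat match goal with
  | E : ?x = Some _, F : ?x = Some _ |- _ =>
      rewrite E in F; first [discriminate F | injection F as ?; subst]
  | IH : forall t s, exec ?c ?st t s -> _, E : exec ?c ?st _ _ |- _ =>
      case: (IH _ _ E) => ? ?; subst; clear IH
  end; by [].
Qed.

End Semantics.

(** * Input, queries and output *)

Section Interface.
Context {R : realType}.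

(* The initial edges may be listed in any order.  All the cells that are not
   mentioned, including those beyond the ends of the lists, hold 0. *)
Definition input (n : nat) (W eps : R) (s : 'I_n) (es us : seq (wedge R n)) :
    state R :=
  State (nth 0%N [:: n; size es; size us; nat_of_ord s])
        (nth 0 [:: eps; W])
        (fun a => nth 0%N (nth [::]
           [:: [seq nat_of_ord e.1.1 | e <- es]; [seq nat_of_ord e.1.2 | e <- es];
               [seq nat_of_ord e.1.1 | e <- us]; [seq nat_of_ord e.1.2 | e <- us]]
           a))
        (fun a => nth 0 (nth [::]
           [:: [seq e.2 | e <- es]; [seq e.2 | e <- us]] a)).

Definition ask (st : state R) (v j : nat) : state R :=
  set_ireg (set_ireg st 0 v) 1 j.

(* Integer register 0 tells whether the returned value is finite. *)
Definition answer (st : state R) : \bar R :=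
  if ireg st 0 == 0%N then +oo%E else (rreg st 0)%:E.

(* The states of the data structure after any finite sequence of valid queries,
   each of which may modify the memory. *)
Inductive after_queries (B : nat) (qry : cmd) (n Delta : nat) (st0 : state R) :
    state R -> Prop :=
| after_queries0 : after_queries B qry n Delta st0 st0
| after_queriesS st st' t v j :
    after_queries B qry n Delta st0 st -> (v < n)%N -> (j <= Delta)%N ->
    exec B qry (ask st v j) t st' ->
    after_queries B qry n Delta st0 st'.

End Interface.

(* Main.v *)
(* The estimates are computed by divide and conquer over time.  Once a vertex v has
   the same estimate at both ends of a time interval, that estimate is valid, up to
   the accumulated error, in the whole interval, since distances only decrease; v is
   frozen there.  At the middle of the interval, Dijkstra's algorithm is run on the
   other, alive, vertices only, with the estimates of the frozen ones as boundary
   values, and the results are rounded up so that the estimates at the ends of each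
   half are equal or differ by a factor of at least q = 1 + eps / (2 (2 L + 1)), where
   L ~ log Delta is the number of levels.  A level multiplies the error by q^2, and
   (1 + x)^k <= 1 + 2 k x gives the total error 1 + eps.  On each level the
   estimate of v drops by a factor q at most log_q (nW) times, so v is alive in that many
   intervals, each of which costs O(deg v log n).  All intervals of a level are
   treated from left to right, while the edge weights are updated; to keep
   the number of these updates small, an update is ignored beforehand unless it decreases
   the recorded weight of its edge by a factor of more than q.  In the end, the at most
   log_q (nW) drops of each vertex are stored for binary search.

   Infinity is represented by the real number 2 W (m + 1), which exceeds every
   finite estimate. *)

(* The bound has no term in [n], so nothing may run over all vertices: the tables rely on the
   initial zeros, the first list of alive vertices is collected while the edges arrive, and only
   vertices with an in-edge are ever alive, so that costs per vertex can be charged to edges. Since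
   the machine cannot round reals, estimates are not moved to powers of [q]; a middle estimate is
   instead placed relative to those at the two ends. Keeping a factor [q] away from both of them is
   what costs [q ^ 2] per level. Ignored updates cost one factor only, because every level reads the
   same recorded weights: the induction starts with error [q] and ends with [q ^ (2 L + 1)].
   Estimates are 0 or at least 1, like the weights, so that a geometric decrease is bounded although
   it may end in 0. To have both ends of the first interval for free, two artificial times are
   added: one before the initial graph, where every estimate except that of the source is infinite,
   and one after the last version, where 0 is a trivial lower bound. *)
Require Import Defs.
From HB Require Import structures.
From mathcomp Require Import all_boot all_order all_algebra.
From mathcomp Require Import all_classical all_reals all_analysis.
From mathcomp Require Import zify ring lra.

Set Implicit Arguments.
Unset Strict Implicit.
Unset Printing Implicit Defensive.

Import Order.TTheory GRing.Theory Num.Theory.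
Local Open Scope ring_scope.

(** * Program logic *)

Section Logic.
Context {R : realType} (B : nat).
Implicit Types (st : state R) (c : cmd) (t T : nat).

Definition wsafe st :=
  (forall x, (ireg st x < B)%N) /\ (forall a i, (iarr st a i < B)%N).

Fixpoint iden st (e : iexp) : nat :=
  match e with
  | ICst k => k
  | IReg x => ireg st x
  | IGet a i => iarr st a (iden st i)
  | IAdd e1 e2 => (iden st e1 + iden st e2)%N
  | ISub e1 e2 => (iden st e1 - iden st e2)%N
  | IMul e1 e2 => (iden st e1 * iden st e2)%N
  | IDiv e1 e2 => (iden st e1 %/ iden st e2)%N
  end.

Fixpoint iok st (e : iexp) : Prop :=
  match e with
  | ICst k => (k < B)%N
  | IReg x => True
  | IGet a i => iok st i
  | IAdd e1 e2 => [/\ iok st e1, iok st e2 & (iden st e1 + iden st e2 < B)%N]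
  | ISub e1 e2 => iok st e1 /\ iok st e2
  | IMul e1 e2 => [/\ iok st e1, iok st e2 & (iden st e1 * iden st e2 < B)%N]
  | IDiv e1 e2 => [/\ iok st e1, iok st e2 & iden st e2 != 0%N]
  end.

Fixpoint rden st (e : rexp) : R :=
  match e with
  | RCst k => k%:R
  | RReg x => rreg st x
  | RGet a i => rarr st a (iden st i)
  | RAdd e1 e2 => rden st e1 + rden st e2
  | RSub e1 e2 => rden st e1 - rden st e2
  | RMul e1 e2 => rden st e1 * rden st e2
  | RDiv e1 e2 => rden st e1 / rden st e2
  end.

Fixpoint rok st (e : rexp) : Prop :=
  match e with
  | RCst _ | RReg _ => True
  | RGet a i => iok st i
  | RAdd e1 e2 | RSub e1 e2 | RMul e1 e2 => rok st e1 /\ rok st e2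
  | RDiv e1 e2 => [/\ rok st e1, rok st e2 & rden st e2 != 0]
  end.

Fixpoint bden st (b : bexp) : bool :=
  match b with
  | BILe e1 e2 => (iden st e1 <= iden st e2)%N
  | BRLe e1 e2 => rden st e1 <= rden st e2
  | BNot b1 => ~~ bden st b1
  | BAnd b1 b2 => bden st b1 && bden st b2
  end.

Fixpoint bok st (b : bexp) : Prop :=
  match b with
  | BILe e1 e2 => iok st e1 /\ iok st e2
  | BRLe e1 e2 => rok st e1 /\ rok st e2
  | BNot b1 => bok st b1
  | BAnd b1 b2 => bok st b1 /\ bok st b2
  end.

Lemma wordP k : (k < B)%N -> word B k = Some k.
Proof. by rewrite /word => ->. Qed.

Lemma word_lt k l : word B k = Some l -> (l < B)%N.
Proof. by rewrite /word; case: ifP => // h [<-]. Qed.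

Lemma ieval_lt st e k : ieval B st e = Some k -> (k < B)%N.
Proof.
by case: e => [?|?|? i|e1 e2|e1 e2|e1 e2|e1 e2] /=; try exact: word_lt;
  [case: (ieval B st i) => //= ?; exact: word_lt|..];
  rewrite /bind2; case: (ieval B st e1) => //= ?; case: (ieval B st e2) => //= ?;
  try exact: word_lt; case: ifP => // _; exact: word_lt.
Qed.

Lemma ieval_iden st e : wsafe st -> iok st e ->
  ieval B st e = Some (iden st e) /\ (iden st e < B)%N.
Proof.
move=> [w1 w2]; suff h : iok st e -> ieval B st e = Some (iden st e).
  by move=> ok; split; [exact: h|exact: ieval_lt (h ok)].
elim: e => [?|?|? i IH|e1 I1 e2 I2|e1 I1 e2 I2|e1 I1 e2 I2|e1 I1 e2 I2] /=.
- exact: wordP.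
- by move=> _; rewrite wordP.
- by move=> /IH -> /=; rewrite wordP.
- by case=> /I1 -> /I2 -> ?; rewrite /bind2 /= wordP.
- case=> ok1 ok2; rewrite I1 // I2 // /bind2 /= wordP //.
  exact: leq_ltn_trans (leq_subr _ _) (ieval_lt (I1 ok1)).
- by case=> /I1 -> /I2 -> ?; rewrite /bind2 /= wordP.
- case=> ok1 ok2 /negbTE nz; rewrite I1 // I2 // /bind2 /= nz wordP //.
  exact: leq_ltn_trans (leq_div _ _) (ieval_lt (I1 ok1)).
Qed.

Lemma reval_rden st e : wsafe st -> rok st e -> reval B st e = Some (rden st e).
Proof.
move=> w; elim: e => //= [a i ok|e1 I1 e2 I2|e1 I1 e2 I2|e1 I1 e2 I2|e1 I1 e2 I2].
- by rewrite (ieval_iden w ok).1.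
- by case=> /I1 -> /I2 ->.
- by case=> /I1 -> /I2 ->.
- by case=> /I1 -> /I2 ->.
- by case=> /I1 -> /I2 -> /negbTE nz; rewrite /bind2 /= nz.
Qed.

Lemma beval_bden st b : wsafe st -> bok st b -> beval B st b = Some (bden st b).
Proof.
move=> w; elim: b => [e1 e2|e1 e2|b1 I1|b1 I1 b2 I2] /=.
- by case=> /(ieval_iden w)[-> _] /(ieval_iden w)[-> _].
- by case=> /(reval_rden w) -> /(reval_rden w) ->.
- by move=> /I1 ->.
- by case=> /I1 -> /I2 ->.
Qed.

Lemma upd_lt (f : nat -> nat) i k j :
  (forall j, f j < B)%N -> (k < B)%N -> (upd f i k j < B)%N.
Proof. by rewrite /upd; case: eqP. Qed.

Lemma exec_wsafe c st t st' : exec B c st t st' -> wsafe st -> wsafe st'.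
Proof.
elim=> {c st t st'} //.
- move=> st x e k /ieval_lt h [w1 w2]; split=> //= y; exact: upd_lt.
- move=> st a e1 e2 i k _ /ieval_lt h [w1 w2]; split=> //= b j.
  by rewrite /upd; case: eqP => // _; case: eqP.
- by move=> *; eauto.
- by move=> *; eauto.
Qed.

Fixpoint writes (f : cmd -> seq nat) c : seq nat :=
  match c with
  | Seq c1 c2 | If _ c1 c2 => writes f c1 ++ writes f c2
  | While _ c1 => writes f c1
  | _ => f c
  end.
Definition wir := writes (fun c => if c is ISet x _ then [:: x] else [::]).
Definition wrr := writes (fun c => if c is RSet x _ then [:: x] else [::]).
Definition wia := writes (fun c => if c is IPut a _ _ then [:: a] else [::]).
Definition wra := writes (fun c => if c is RPut a _ _ then [:: a] else [::]).

(** The written cells are read off the syntax of [c], so that side conditions such as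
    [x \notin wir c] are settled by computation. *)
Record frame c st st' : Prop := Frame {
  frI : forall x, x \notin wir c -> ireg st' x = ireg st x;
  frR : forall x, x \notin wrr c -> rreg st' x = rreg st x;
  frIA : forall a, a \notin wia c -> iarr st' a = iarr st a;
  frRA : forall a, a \notin wra c -> rarr st' a = rarr st a }.

Lemma upd_same (T : Type) (f : nat -> T) i x : upd f i x i = x.
Proof. by rewrite /upd eqxx. Qed.

Lemma upd_other (T : Type) (f : nat -> T) i x j : j != i -> upd f i x j = f j.
Proof. by rewrite /upd => /negbTE ->. Qed.

Lemma frame_refl c st : frame c st st.
Proof. by split. Qed.

Lemma frame_trans c st1 st2 st3 : frame c st1 st2 -> frame c st2 st3 -> frame c st1 st3.
Proof.
move=> [a1 a2 a3 a4] [b1 b2 b3 b4]; split=> x h; first by rewrite b1 // a1.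
- by rewrite b2 // a2.
- by rewrite b3 // a3.
- by rewrite b4 // a4.
Qed.

Lemma frame_sub c c' st st' :
  {subset wir c <= wir c'} -> {subset wrr c <= wrr c'} ->
  {subset wia c <= wia c'} -> {subset wra c <= wra c'} ->
  frame c st st' -> frame c' st st'.
Proof.
move=> s1 s2 s3 s4 [a1 a2 a3 a4]; split=> x h; [apply: a1|apply: a2|apply: a3|apply: a4];
 by apply: contra h; auto.
Qed.

Lemma exec_frame c st t st' : exec B c st t st' -> frame c st st'.
Proof.
elim=> {c st t st'}; try by split.
- by move=> st x e k _; split=> //= y; rewrite inE; exact: upd_other.
- by move=> st x e k _; split=> //= y; rewrite inE; exact: upd_other.
- by move=> st a e1 e2 i k _ _; split=> //= y; rewrite inE; exact: upd_other.
- by move=> st a e1 e2 i k _ _; split=> //= y; rewrite inE; exact: upd_other.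
- move=> st st1 st2 t1 t2 c1 c2 _ f1 _ f2; apply: (@frame_trans _ _ st1).
    by apply: frame_sub f1 => x; rewrite /= mem_cat => ->.
  by apply: frame_sub f2 => x; rewrite /= mem_cat => ->; rewrite orbT.
- move=> st st1 t p b c1 c2 _ _ f1.
  by apply: frame_sub f1 => x; rewrite /= mem_cat; case: p => ->; rewrite ?orbT.
- move=> st st1 st2 t1 t2 b c _ _ f1 _ f2; apply: (@frame_trans _ _ st1) => //.
  exact: frame_sub f1.
Qed.

(* Total correctness within [T] steps; that all words are below [B] is part of
   the judgement, so that reading a cell never has to be justified. *)
Definition run c st T (Q : state R -> Prop) : Prop :=
  wsafe st -> exists t st',
    [/\ exec B c st t st', (t <= T)%N, wsafe st' & Q st'].

Lemma run_le c st T T' (Q Q' : state R -> Prop) :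
  run c st T Q -> (T <= T')%N -> (forall st', Q st' -> Q' st') -> run c st T' Q'.
Proof.
move=> h le q w; have [t [st' [e l w' q']]] := h w.
by exists t, st'; split=> //; [exact: leq_trans le|exact: q].
Qed.

Lemma run_frame c st T Q :
  run c st T Q -> run c st T (fun st' => frame c st st' /\ Q st').
Proof.
move=> h w; have [t [st' [e l w' q']]] := h w.
by exists t, st'; split=> //; split=> //; exact: exec_frame e.
Qed.

Lemma run_then c st T (Q Q' : state R -> Prop) :
  run c st T Q -> (forall st', frame c st st' /\ Q st' -> Q' st') -> run c st T Q'.
Proof. by move=> /run_frame h; exact: run_le h (leqnn _). Qed.

Lemma run_time c st T T' Q : run c st T Q -> (T <= T')%N -> run c st T' Q.
Proof. by move=> h le; exact: run_le h le _. Qed.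

Lemma run_skip st (Q : state R -> Prop) : Q st -> run Skip st 1 Q.
Proof. by move=> q w; exists 1%N, st; split=> //; constructor. Qed.

Lemma run_iset st x e (Q : state R -> Prop) :
  iok st e -> Q (set_ireg st x (iden st e)) -> run (ISet x e) st 1 Q.
Proof.
move=> ok q w; have [ev lt] := ieval_iden w ok.
have ex := exec_iset x ev; exists 1%N; eexists; split; [exact: ex|by []| |by []].
exact: exec_wsafe ex w.
Qed.

Lemma run_rset st x e (Q : state R -> Prop) :
  rok st e -> Q (set_rreg st x (rden st e)) -> run (RSet x e) st 1 Q.
Proof.
move=> ok q w; have ev := reval_rden w ok.
have ex := exec_rset x ev; exists 1%N; eexists; split; [exact: ex|by []| |by []].
exact: exec_wsafe ex w.
Qed.

Lemma run_iput st a e1 e2 (Q : state R -> Prop) :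
  iok st e1 -> iok st e2 ->
  Q (set_iarr st a (iden st e1) (iden st e2)) -> run (IPut a e1 e2) st 1 Q.
Proof.
move=> ok1 ok2 q w; have [ev1 _] := ieval_iden w ok1; have [ev2 _] := ieval_iden w ok2.
have ex := exec_iput a ev1 ev2; exists 1%N; eexists; split; [exact: ex|by []| |by []].
exact: exec_wsafe ex w.
Qed.

Lemma run_rput st a e1 e2 (Q : state R -> Prop) :
  iok st e1 -> rok st e2 ->
  Q (set_rarr st a (iden st e1) (rden st e2)) -> run (RPut a e1 e2) st 1 Q.
Proof.
move=> ok1 ok2 q w; have [ev1 _] := ieval_iden w ok1; have ev2 := reval_rden w ok2.
have ex := exec_rput a ev1 ev2; exists 1%N; eexists; split; [exact: ex|by []| |by []].
exact: exec_wsafe ex w.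
Qed.

Lemma run_seq c1 c2 st T1 T2 Q :
  run c1 st T1 (fun st1 => run c2 st1 T2 Q) -> run (Seq c1 c2) st (T1 + T2) Q.
Proof.
move=> h w; have [t1 [st1 [e1 l1 w1 h1]]] := h w.
have [t2 [st2 [e2 l2 w2 q]]] := h1 w1.
exists (t1 + t2)%N, st2; split=> //; [exact: exec_seq e1 e2|exact: leq_add].
Qed.

Lemma run_if b c1 c2 st T1 T2 Q :
  bok st b -> (bden st b -> run c1 st T1 Q) -> (~~ bden st b -> run c2 st T2 Q) ->
  run (If b c1 c2) st (maxn T1 T2).+1 Q.
Proof.
move=> ok h1 h2 w; have ev := beval_bden w ok.
have [t [st' [e l w' q]]] : exists t st',
  [/\ exec B (if bden st b then c1 else c2) st t st', (t <= maxn T1 T2)%N, wsafe st' & Q st'].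
  case: (bden st b) h1 h2 => h1 h2.
    have [t [st' [e l w' q]]] := h1 isT w; exists t, st'; split=> //.
    by rewrite leq_max l.
  have [t [st' [e l w' q]]] := h2 isT w; exists t, st'; split=> //.
  by rewrite leq_max l orbT.
by exists t.+1, st'; split=> //; exact: exec_if ev e.
Qed.

(* The natural number in the invariant [I] is the credit left for the loop. *)
Lemma run_while b c (I : nat -> state R -> Prop) (Q : state R -> Prop) st0 k0 :
  (forall k st, frame (While b c) st0 st -> I k st -> bok st b /\
     if bden st b then
       exists2 T, (T < k)%N & run c st T (fun st' => exists2 k', (T + k' < k)%N & I k' st')
     else Q st) ->
  I k0 st0 -> run (While b c) st0 k0.+1 Q.
Proof.
move=> step; suff h k st : frame (While b c) st0 st -> I k st -> run (While b c) st k.+1 Q.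
  by move=> i0; apply: h => //; exact: frame_refl.
elim/ltn_ind: k st => k IH st fr ik w.
have [ok] := step _ _ fr ik; have ev := beval_bden w ok.
case: (bden st b) ev => ev.
  case=> T ltT h; have [t1 [st1 [e1 l1 w1 [k' lk ik']]]] := h w.
  have ltk : (k' < k)%N by lia.
  have fr1 : frame (While b c) st0 st1.
    apply: frame_trans fr _; exact: frame_sub (exec_frame e1).
  have [t2 [st2 [e2 l2 w2 q]]] := IH _ ltk st1 fr1 ik' w1.
  exists (t1 + t2).+1, st2; split=> //; last by lia.
  exact: exec_while_true ev e1 e2.
by move=> q; exists 1%N, st; split=> //; exact: exec_while_false.
Qed.

Definition For i h c :=
  Seq (ISet i (ICst 0))
    (While (BNot (BILe (IReg h) (IReg i)))
       (Seq c (ISet i (IAdd (IReg i) (ICst 1))))).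

(** The credit may depend on the state, which is needed when the rounds incur their costs in an
    order that is not known beforehand, as in the settling of vertices. Two units per round pay for
    the increment and the test, the final 2 for the initialization and the last test. *)
Lemma run_for_credit i h c st0 N k0 (I : nat -> nat -> state R -> Prop) (Q : state R -> Prop) :
  (1 < B)%N -> i \notin wir c -> h \notin wir c -> h != i -> ireg st0 h = N ->
  I 0%N k0 (set_ireg st0 i 0) ->
  (forall j k st, frame (For i h c) st0 st -> ireg st i = j -> ireg st h = N ->
     (j < N)%N -> I j k st ->
     exists2 T, (T + 2 <= k)%N &
       run c st T (fun st' => exists2 k', (T + 2 + k' <= k)%N & I j.+1 k' (set_ireg st' i j.+1))) ->
  (forall k st, frame (For i h c) st0 st -> I N k st -> Q st) ->
  run (For i h c) st0 (k0 + 2) Q.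
Proof.
move=> B1 ni nh hi hN i0 step fin.
move=> w; have NB : (N < B)%N by rewrite -hN; exact: w.1.
move: w; have -> : (k0 + 2 = 1 + k0.+1)%N by lia.
apply: run_seq; apply: run_iset => /=; first by lia.
set st00 := set_ireg _ _ _.
have fr0 : frame (For i h c) st0 st00.
  by split=> //= x; rewrite inE negb_or => /andP[? _]; rewrite upd_other.
apply: (@run_while _ _ (fun k st => [/\ ireg st h = N, (ireg st i <= N)%N & I (ireg st i) k st])).
- move=> k st fr [eh le ij]; split=> //=.
  have fr' : frame (For i h c) st0 st.
    by apply: frame_trans fr0 (frame_sub _ _ _ _ fr) => x /= xc;
       rewrite ?inE /= ?mem_cat ?inE in xc *; rewrite ?xc ?orbT.
  rewrite eh -ltnNge; case: ltnP => [lt|ge]; last first.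
    by apply: (fin k) => //; have -> : N = ireg st i by apply/eqP; rewrite eqn_leq ge le.
  have [T leT r] := step _ _ _ fr' erefl eh lt ij.
  exists (T + 1)%N; first by lia.
  apply: run_seq; move: r => /run_frame /run_le; apply=> // st1 [fr1 [k' lek ij']].
  have e1 : ireg st1 i = ireg st i by apply: (frI fr1).
  apply: run_iset => /=.
    by split=> //; rewrite e1; lia.
  exists k'; first by lia.
  rewrite e1 addn1 /= {1}/upd (negbTE hi) (frI fr1) // eh /upd eqxx; split=> //.
- by rewrite /= /upd (negbTE hi) eqxx.
Qed.

Lemma run_for i h c st0 N (f : nat -> nat) (I : nat -> state R -> Prop) (Q : state R -> Prop) :
  (1 < B)%N -> i \notin wir c -> h \notin wir c -> h != i -> ireg st0 h = N ->
  I 0%N (set_ireg st0 i 0) ->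
  (forall j st, frame (For i h c) st0 st -> ireg st i = j -> ireg st h = N ->
     (j < N)%N -> I j st -> run c st (f j) (fun st' => I j.+1 (set_ireg st' i j.+1))) ->
  (forall st, frame (For i h c) st0 st -> I N st -> Q st) ->
  run (For i h c) st0 (\sum_(j < N) (f j + 2) + 2) Q.
Proof.
move=> B1 ni nh hi hN i0 step fin.
pose F j := (\sum_(j <= l < N) (f l + 2))%N.
rewrite -(big_mkord xpredT (fun j => f j + 2)%N) -/(F 0%N).
apply: (@run_for_credit _ _ _ _ N (F 0%N) (fun j k st => k = F j /\ I j st)) => //.
- move=> j k st fr ei eh lt [-> ij]; exists (f j).
    by rewrite /F big_ltn //; lia.
  move: (step j st fr ei eh lt ij) => /run_le; apply=> // st' ij'.
  by exists (F j.+1) => //; rewrite {2}/F big_ltn // -/(F j.+1); lia.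
- by move=> k st fr [_]; exact: fin.
Qed.

Lemma run_for_const i h c st0 N T (I : nat -> state R -> Prop) (Q : state R -> Prop) :
  (1 < B)%N -> i \notin wir c -> h \notin wir c -> h != i -> ireg st0 h = N ->
  I 0%N (set_ireg st0 i 0) ->
  (forall j st, frame (For i h c) st0 st -> ireg st i = j -> ireg st h = N ->
     (j < N)%N -> I j st -> run c st T (fun st' => I j.+1 (set_ireg st' i j.+1))) ->
  (forall st, frame (For i h c) st0 st -> I N st -> Q st) ->
  run (For i h c) st0 (N * (T + 2) + 2) Q.
Proof.
move=> B1 ni nh hi hN i0 step fin.
have := run_for (f := fun=> T) B1 ni nh hi hN i0 step fin.
by rewrite sum_nat_const card_ord.
Qed.

(** Makes the bound [B] on the current cells available as a hypothesis: a size held in a register is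
    then known to be a word. *)
Lemma run_wsafe c st T Q : (wsafe st -> run c st T Q) -> run c st T Q.
Proof. by move=> h w; exact: h. Qed.

End Logic.
(** * The program *)

Declare Scope iexp_scope.
Delimit Scope iexp_scope with I.
Notation "a + b" := (IAdd a b) : iexp_scope.
Notation "a - b" := (ISub a b) : iexp_scope.
Notation "a * b" := (IMul a b) : iexp_scope.
Notation "a / b" := (IDiv a b) : iexp_scope.
Notation c_ := ICst.
Notation r_ := IReg.
Notation "a ;; b" := (Seq a b) (at level 90, right associativity).

Notation xD := 2%N (only parsing).
Notation xS := 3%N (only parsing).
Notation xN := 4%N (only parsing).
Notation xEs := 5%N (only parsing).
Notation xH := 6%N (only parsing).
Notation xM := 7%N (only parsing).
Notation xKc := 8%N (only parsing).
Notation xHc := 9%N (only parsing).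
Notation xG := 10%N (only parsing).
Notation xHalf := 11%N (only parsing).
Notation xA := 12%N (only parsing).
Notation xMid := 13%N (only parsing).
Notation xB := 14%N (only parsing).
Notation xP := 15%N (only parsing).
Notation xK := 16%N (only parsing).
Notation xJ := 17%N (only parsing).
Notation xR := 18%N (only parsing).
Notation xV := 19%N (only parsing).
Notation xU := 20%N (only parsing).
Notation xNode := 21%N (only parsing).
Notation xO := 22%N (only parsing).
Notation xK1 := 23%N (only parsing).
Notation xK2 := 24%N (only parsing).
Notation xDeg := 25%N (only parsing).
Notation xE := 26%N (only parsing).
Notation xT := 27%N (only parsing).
Notation xI := 28%N (only parsing).
Notation xLo := 29%N (only parsing).
Notation xHi := 30%N (only parsing).
Notation xMd := 31%N (only parsing).
Notation xC := 32%N (only parsing).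

Notation yEps := 0%N (only parsing).
Notation yW := 1%N (only parsing).
Notation yQ := 2%N (only parsing).
Notation yInf := 3%N (only parsing).
Notation yBig := 4%N (only parsing).
Notation yX := 5%N (only parsing).
Notation yY := 6%N (only parsing).
Notation yZ := 7%N (only parsing).

(* A table indexed by (t, v) is stored row by row, in rows of length n (of length H
   for aFT and bFV); as memory is initially 0, it costs nothing to set up.
   aMat: whether uv is a known edge; aOut, aOd, aIn, aId: out- and in-neighbours and
   their numbers; aET, aEH: tails and heads of the known edges; aKE, aKT, bKW: edge,
   time and weight of the kept events; bLast, bWt: weight of the last kept event of
   an edge, among all of them and up to the current time; bD: estimate at time t for
   v; aAL, aCN: row t lists the vertices whose estimates differ at the two ends of
   the interval that starts at t; bCur: estimates at the start of the current
   interval; bKey, aPos, aTV, bTK: keys, positions and tournament tree of Dijkstra's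
   algorithm; aFT, bFV, aFC: the times of the drops of the estimate of v, the
   estimates after them, and their number. *)
Notation aMat := 4%N (only parsing).
Notation aOut := 5%N (only parsing).
Notation aOd := 6%N (only parsing).
Notation aIn := 7%N (only parsing).
Notation aId := 8%N (only parsing).
Notation aET := 9%N (only parsing).
Notation aEH := 10%N (only parsing).
Notation aKE := 11%N (only parsing).
Notation aKT := 12%N (only parsing).
Notation aAL := 13%N (only parsing).
Notation aCN := 14%N (only parsing).
Notation aPos := 15%N (only parsing).
Notation aTV := 16%N (only parsing).
Notation aFT := 17%N (only parsing).
Notation aFC := 18%N (only parsing).

Notation bLast := 2%N (only parsing).
Notation bKW := 3%N (only parsing).
Notation bWt := 4%N (only parsing).
Notation bCur := 5%N (only parsing).
Notation bKey := 6%N (only parsing).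
Notation bTK := 7%N (only parsing).
Notation bD := 8%N (only parsing).
Notation bFV := 9%N (only parsing).

Definition incr (x : nat) := ISet x (r_ x + c_ 1)%I.

(** Version j sits at time j + 1, and time [H] comes after all versions, so [H] is the least power
    of 2 that is at least the number of updates plus 2. The register [yX] ends as 2 L + 1, the
    exponent of [q] in the final error. *)
Definition setup : cmd :=
  ISet xN (r_ 0%N) ;; ISet xEs (r_ 1%N) ;;
  ISet xH (c_ 1) ;; RSet yX (RCst 1) ;;
  While (BILe (r_ xH) (r_ xD + c_ 1)%I)
    (ISet xH (r_ xH * c_ 2)%I ;; RSet yX (RAdd (RReg yX) (RCst 2))) ;;
  RSet yQ (RAdd (RCst 1) (RDiv (RReg yEps) (RMul (RCst 2) (RReg yX)))) ;;
  RSet yInf (RMul (RCst 2) (RReg yW)).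

Definition keep : cmd :=
  RPut bLast (r_ xE) (RReg yX) ;;
  IPut aKE (r_ xKc) (r_ xE) ;; IPut aKT (r_ xKc) (r_ xT) ;;
  RPut bKW (r_ xKc) (RReg yX) ;; incr xKc.

(** The first in-edge of a vertex other than the source puts it on row 0 of [aAL], the list of the
    vertices alive in the whole time span. Infinity grows by 2 W with every new edge, as the number
    of edges is known only at the end. *)
Definition event (aT aH aW : nat) : cmd :=
  ISet xU (IGet aT (r_ xI)) ;; ISet xV (IGet aH (r_ xI)) ;;
  RSet yX (RGet aW (r_ xI)) ;; ISet xE (r_ xU * r_ xN + r_ xV)%I ;;
  If (BILe (IGet aMat (r_ xE)) (c_ 0))
    (IPut aMat (r_ xE) (c_ 1) ;;
     IPut aOut (r_ xU * r_ xN + IGet aOd (r_ xU))%I (r_ xV) ;;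
     IPut aOd (r_ xU) (IGet aOd (r_ xU) + c_ 1)%I ;;
     If (BAnd (BILe (IGet aId (r_ xV)) (c_ 0))
              (BNot (BAnd (BILe (r_ xV) (r_ xS)) (BILe (r_ xS) (r_ xV)))))
       (IPut aAL (r_ xHc) (r_ xV) ;; incr xHc) Skip ;;
     IPut aIn (r_ xV * r_ xN + IGet aId (r_ xV))%I (r_ xU) ;;
     IPut aId (r_ xV) (IGet aId (r_ xV) + c_ 1)%I ;;
     IPut aET (r_ xM) (r_ xU) ;; IPut aEH (r_ xM) (r_ xV) ;; incr xM ;;
     RSet yInf (RAdd (RReg yInf) (RMul (RCst 2) (RReg yW))) ;;
     keep)
    (If (BRLe (RGet bLast (r_ xE)) (RMul (RReg yQ) (RReg yX))) Skip keep).

Definition events : cmd :=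
  ISet xT (c_ 1) ;; For xI xEs (event 0 1 0) ;;
  For xI xD (ISet xT (r_ xI + c_ 2)%I ;; event 2 3 1).

(** Row [H] is not written: for the listed vertices, the zeros of the memory are the estimates
    wanted there. [yBig] exceeds infinity, so that in the tournament a settled leaf comes after an
    unreached one. *)
Definition init_dist : cmd :=
  RSet yBig (RAdd (RReg yInf) (RCst 1)) ;;
  For xK xM
    (RPut bD (IGet aET (r_ xK)) (RReg yInf) ;;
     RPut bD (IGet aEH (r_ xK)) (RReg yInf)) ;;
  RPut bD (r_ xS) (RCst 0) ;; IPut aCN (c_ 0) (r_ xHc) ;; ISet xG (r_ xH).

Definition pull : cmd :=
  If (BRLe (RGet bTK (c_ 2 * r_ xNode)%I) (RGet bTK (c_ 2 * r_ xNode + c_ 1)%I))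
    (IPut aTV (r_ xNode) (IGet aTV (c_ 2 * r_ xNode)%I) ;;
     RPut bTK (r_ xNode) (RGet bTK (c_ 2 * r_ xNode)%I))
    (IPut aTV (r_ xNode) (IGet aTV (c_ 2 * r_ xNode + c_ 1)%I) ;;
     RPut bTK (r_ xNode) (RGet bTK (c_ 2 * r_ xNode + c_ 1)%I)).

Definition sift : cmd :=
  While (BILe (c_ 2) (r_ xNode)) (ISet xNode (r_ xNode / c_ 2)%I ;; pull).

(* While a group is processed, bCur is infinite on it and bKey is 0 off it, so that
   neither [pull_edge] nor [relax] has to test membership. *)
Definition mark_group : cmd :=
  For xK xR
    (ISet xV (IGet aAL (r_ xO + r_ xK)%I) ;; IPut aPos (r_ xV) (r_ xK) ;;
     RPut bCur (r_ xV) (RReg yInf)).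

Definition pull_edge : cmd :=
  ISet xU (IGet aIn (r_ xV * r_ xN + r_ xJ)%I) ;;
  RSet yY (RAdd (RGet bCur (r_ xU)) (RGet bWt (r_ xU * r_ xN + r_ xV)%I)) ;;
  If (BRLe (RReg yX) (RReg yY)) Skip (RSet yX (RReg yY)).

Definition init_keys : cmd :=
  For xK xR
    (ISet xV (IGet aAL (r_ xO + r_ xK)%I) ;; RSet yX (RReg yInf) ;;
     ISet xDeg (IGet aId (r_ xV)) ;; For xJ xDeg pull_edge ;;
     RPut bKey (r_ xV) (RReg yX) ;;
     RPut bTK (r_ xR + r_ xK)%I (RReg yX) ;; IPut aTV (r_ xR + r_ xK)%I (r_ xV)).

Definition build : cmd :=
  ISet xNode (r_ xR - c_ 1)%I ;;
  While (BILe (c_ 1) (r_ xNode)) (pull ;; ISet xNode (r_ xNode - c_ 1)%I).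

Definition relax : cmd :=
  ISet xU (IGet aOut (r_ xV * r_ xN + r_ xJ)%I) ;;
  RSet yY (RAdd (RReg yX) (RGet bWt (r_ xV * r_ xN + r_ xU)%I)) ;;
  If (BRLe (RGet bKey (r_ xU)) (RReg yY)) Skip
    (RPut bKey (r_ xU) (RReg yY) ;;
     ISet xNode (r_ xR + IGet aPos (r_ xU))%I ;;
     RPut bTK (r_ xNode) (RReg yY) ;; sift).

Definition settle : cmd :=
  ISet xV (IGet aTV (c_ 1)) ;; RSet yX (RGet bKey (r_ xV)) ;;
  ISet xNode (r_ xR + IGet aPos (r_ xV))%I ;;
  RPut bTK (r_ xNode) (RReg yBig) ;; sift ;;
  ISet xDeg (IGet aOd (r_ xV)) ;; For xJ xDeg relax.

Definition dijkstra : cmd :=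
  ISet xO (r_ xA * r_ xN)%I ;; ISet xR (IGet aCN (r_ xA)) ;;
  mark_group ;; init_keys ;; build ;; For xK xR settle.

(** Besides rounding, this restores what the next interval expects: keys 0, and in [bCur] the
    estimates at its left end, which differ from the old ones on the group only. The list of the
    left half overwrites that of the whole interval. *)
Definition snap1 : cmd :=
  ISet xV (IGet aAL (r_ xO + r_ xK)%I) ;;
  RSet yX (RGet bKey (r_ xV)) ;; RPut bKey (r_ xV) (RCst 0) ;;
  RSet yY (RGet bD (r_ xB * r_ xN + r_ xV)%I) ;; RPut bCur (r_ xV) (RReg yY) ;;
  RSet yZ (RGet bD (r_ xA * r_ xN + r_ xV)%I) ;;
  If (BRLe (RReg yX) (RReg yY)) (RSet yX (RReg yY)) Skip ;;
  If (BRLe (RReg yZ) (RMul (RMul (RReg yQ) (RReg yQ)) (RReg yX)))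
    (RSet yX (RReg yZ)) (RSet yX (RMul (RReg yQ) (RReg yX))) ;;
  RPut bD (r_ xMid * r_ xN + r_ xV)%I (RReg yX) ;;
  If (BRLe (RReg yZ) (RReg yX)) Skip
    (IPut aAL (r_ xO + r_ xK1)%I (r_ xV) ;; incr xK1) ;;
  If (BRLe (RReg yX) (RReg yY)) Skip
    (IPut aAL (r_ xMid * r_ xN + r_ xK2)%I (r_ xV) ;; incr xK2).

Definition snap : cmd :=
  ISet xK1 (c_ 0) ;; ISet xK2 (c_ 0) ;; For xK xR snap1 ;;
  IPut aCN (r_ xA) (r_ xK1) ;; IPut aCN (r_ xMid) (r_ xK2).

Definition advance : cmd :=
  While (BAnd (BNot (BILe (r_ xKc) (r_ xP))) (BILe (IGet aKT (r_ xP)) (r_ xMid)))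
    (RPut bWt (IGet aKE (r_ xP)) (RGet bKW (r_ xP)) ;; incr xP).

(** Edges that are not present yet weigh [yInf], so that the adjacency lists of the final graph
    serve for all versions. *)
Definition reset : cmd :=
  For xK xM
    (ISet xU (IGet aET (r_ xK)) ;;
     RPut bWt (r_ xU * r_ xN + IGet aEH (r_ xK))%I (RReg yInf) ;;
     RPut bCur (r_ xU) (RGet bD (r_ xU))).

Definition interval : cmd :=
  ISet xB (r_ xA + r_ xG)%I ;; ISet xMid (r_ xA + r_ xHalf)%I ;;
  advance ;; dijkstra ;; snap ;; ISet xA (r_ xB).

Definition level : cmd :=
  ISet xHalf (r_ xG / c_ 2)%I ;; ISet xP (c_ 0) ;; reset ;; ISet xA (c_ 0) ;;
  While (BNot (BILe (r_ xH) (r_ xA))) interval ;;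
  ISet xG (r_ xHalf).

Definition record1 : cmd :=
  ISet xV (IGet aAL (r_ xO + r_ xK)%I) ;; ISet xC (IGet aFC (r_ xV)) ;;
  IPut aFT (r_ xV * r_ xH + r_ xC)%I (r_ xA + c_ 1)%I ;;
  RPut bFV (r_ xV * r_ xH + r_ xC)%I
    (RGet bD ((r_ xA + c_ 1) * r_ xN + r_ xV)%I) ;;
  IPut aFC (r_ xV) (r_ xC + c_ 1)%I.

Definition record_all : cmd :=
  For xA xH
    (ISet xO (r_ xA * r_ xN)%I ;; ISet xR (IGet aCN (r_ xA)) ;;
     For xK xR record1).

Definition preprocess : cmd :=
  setup ;; events ;; init_dist ;;
  While (BILe (c_ 2) (r_ xG)) level ;; record_all.

Definition search : cmd :=
  While (BNot (BILe (r_ xHi) (r_ xLo)))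
    (ISet xMd ((r_ xLo + r_ xHi) / c_ 2)%I ;;
     If (BILe (IGet aFT (r_ xV * r_ xH + r_ xMd)%I) (r_ xT))
       (ISet xLo (r_ xMd + c_ 1)%I) (ISet xHi (r_ xMd))).

(** Version j is looked up at time j + 1. If no drop is recorded up to that time, the estimate is
    still the infinite one of time 0; the source, which never drops, is therefore treated apart. *)
Definition query : cmd :=
  ISet xV (r_ 0%N) ;; ISet xT (r_ 1%N + c_ 1)%I ;;
  If (BAnd (BILe (r_ xV) (r_ xS)) (BILe (r_ xS) (r_ xV)))
    (ISet 0 (c_ 1) ;; RSet 0 (RCst 0))
    (ISet xLo (c_ 0) ;; ISet xHi (IGet aFC (r_ xV)) ;; search ;;
     If (BILe (r_ xLo) (c_ 0)) (ISet 0 (c_ 0))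
       (RSet 0 (RGet bFV (r_ xV * r_ xH + (r_ xLo - c_ 1))%I) ;;
        If (BRLe (RReg yInf) (RReg 0)) (ISet 0 (c_ 0)) (ISet 0 (c_ 1)))).

Ltac xs :=
  match goal with
  | |- run _ (Seq _ _) _ _ _ => eapply run_seq; cbv beta
  | |- run _ Skip _ _ _ => eapply run_skip; cbv beta
  | |- run _ (ISet _ _) _ _ _ => eapply run_iset; cbv beta
  | |- run _ (RSet _ _) _ _ _ => eapply run_rset; cbv beta
  | |- run _ (IPut _ _ _) _ _ _ => eapply run_iput; cbv beta
  | |- run _ (RPut _ _ _) _ _ _ => eapply run_rput; cbv beta
  | |- run _ (If _ _ _) _ _ _ => eapply run_if; cbv beta
  | |- run _ (incr _) _ _ _ => rewrite /incr
  end.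

Ltac slim := repeat match goal with
  | h : ?T |- _ => lazymatch T with
    | is_true (leq _ _) => fail
    | is_true (andb _ _) => fail
    | is_true (negb (@eq_op _ _ _)) => fail
    | @eq nat _ _ => fail
    | @eq bool _ _ => fail
    | _ \/ _ => fail
    | _ => clear h
    end
  end.
Ltac nlia := slim; lia.
(** * The tournament tree *)

Section Tree.
Context {R : realType} (B : nat).
Implicit Types (K : nat -> R) (V : nat -> nat) (st : state R).

Definition sifted K V i :=
  [/\ K i <= K (2 * i)%N, K i <= K (2 * i + 1)%N
    & K i = K (2 * i)%N /\ V i = V (2 * i)%N \/
      K i = K (2 * i + 1)%N /\ V i = V (2 * i + 1)%N].

(** Node i has the children 2 i and 2 i + 1, and the leaves are r, ..., 2 r - 1. The number r of
    leaves need not be a power of 2; for r = 1 the root is the only leaf. *)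
Definition tree r K V := forall i, (1 <= i < r)%N -> sifted K V i.

Lemma tree_root_le r K V i : tree r K V -> (1 <= i < 2 * r)%N -> K 1%N <= K i.
Proof.
move=> T; elim/ltn_ind: i => i IH hi.
have [->//|i1] := eqVneq i 1%N.
have h2 : (1 <= i %/ 2 < r)%N by lia.
have [a b _] := T _ h2.
apply: le_trans (IH (i %/ 2)%N _ _) _; try lia.
have [e|e] : i = (2 * (i %/ 2))%N \/ i = (2 * (i %/ 2) + 1)%N by lia.
- by rewrite {2}e.
- by rewrite {2}e.
Qed.

(** Each step descends to the child with the same key and vertex, which decreases 2 r - i. *)
Lemma tree_leaf r K V i : tree r K V -> (1 <= i < 2 * r)%N ->
  exists k, [/\ (k < r)%N, K i = K (r + k)%N & V i = V (r + k)%N].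
Proof.
move=> T; move: {2}(2 * r - i)%N (leqnn (2 * r - i)%N) => d.
elim: d i => [|d IH] i hd hi; first by lia.
have [ri|ir] := leqP r i.
  by exists (i - r)%N; rewrite subnKC //; split=> //; lia.
have [_ _ [[-> ->]|[-> ->]]] := T i ltac:(lia); apply: IH; lia.
Qed.

Lemma sifted_eq K V K' V' i :
  K' i = K i -> V' i = V i -> K' (2 * i)%N = K (2 * i)%N -> V' (2 * i)%N = V (2 * i)%N ->
  K' (2 * i + 1)%N = K (2 * i + 1)%N -> V' (2 * i + 1)%N = V (2 * i + 1)%N ->
  sifted K V i -> sifted K' V' i.
Proof. by rewrite /sifted => -> -> -> -> -> ->. Qed.

Lemma pull_run st i : ireg st xNode = i -> (1 <= i)%N -> (2 * i + 1 < B)%N ->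
  run B pull st 3 (fun st' =>
    sifted (rarr st' bTK) (iarr st' aTV) i /\
    forall j, j != i -> rarr st' bTK j = rarr st bTK j /\ iarr st' aTV j = iarr st aTV j).
Proof.
move=> ei i1 hB; rewrite /pull; eapply run_le; [xs | |by move=> ?; exact].
- by rewrite /= ei; repeat split; lia.
- rewrite /= ei => le; xs; xs; rewrite /= ?ei; try by repeat split; lia.
  xs; rewrite /= ?ei; try by repeat split; lia.
  rewrite /upd /sifted /= !eqxx.
  have /negbTE -> : (2 * i)%N != i by lia.
  have /negbTE -> : (2 * i + 1)%N != i by lia.
  by split; [split=> //; left|move=> j /negbTE ->].
- rewrite /= ei -ltNge => /ltW le; xs; xs; rewrite /= ?ei; try by repeat split; lia.
  xs; rewrite /= ?ei; try by repeat split; lia.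
  rewrite /upd /sifted /= !eqxx.
  have /negbTE -> : (2 * i)%N != i by lia.
  have /negbTE -> : (2 * i + 1)%N != i by lia.
  by split; [split=> //; right|move=> j /negbTE ->].
- by [].
Qed.

(* Every node except the proper ancestors of x is in order. *)
Definition tree_but r x K V :=
  forall i, (1 <= i < r)%N -> (forall e, (0 < e)%N -> i != (x %/ 2 ^ e)%N) -> sifted K V i.

(** A leaf is compared at its parent only, and the parent is one of the excepted ancestors. *)
Lemma tree_but_leaf r k K V x y :
  (k < r)%N -> tree r K V -> tree_but r (r + k) (upd K (r + k) x) (upd V (r + k) y).
Proof.
move=> kr T i ir ne.
have h1 := ne 1%N isT; rewrite expn1 in h1.
apply: (@sifted_eq K V); last exact: T.
all: by rewrite upd_other //; lia.
Qed.

(** After the pull at the parent of the current node, only proper ancestors of that parent can be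
    out of order. [k] bounds the depth of [x]; a round takes 5 steps, namely the test, the halving
    and 3 for [pull]. *)
Lemma sift_run st r x k : ireg st xNode = x -> (1 <= x < 2 * r)%N -> (x < 2 ^ k.+1)%N ->
  (2 * r < B)%N -> tree_but r x (rarr st bTK) (iarr st aTV) ->
  run B sift st (5 * k).+1 (fun st' =>
    tree r (rarr st' bTK) (iarr st' aTV) /\
    forall j, (r <= j)%N -> rarr st' bTK j = rarr st bTK j /\ iarr st' aTV j = iarr st aTV j).
Proof.
move=> ex hx hk hB tb.
apply: (@run_while _ _ _ _ (fun c st' => exists y l, [/\ ireg st' xNode = y,
   (1 <= y < 2 * r)%N, (y < 2 ^ l.+1)%N, c = (5 * l)%N &
   tree_but r y (rarr st' bTK) (iarr st' aTV) /\
   forall j, (r <= j)%N -> rarr st' bTK j = rarr st bTK j /\ iarr st' aTV j = iarr st aTV j])).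
- move=> c st' fr [y [l [ey hy yl -> [tb' lf]]]]; split.
    by rewrite /=; repeat split; lia.
  rewrite /= ey; case: ltnP => h2; last first.
    split=> // i ir; apply: tb' => // e e0.
    (* The root has no proper ancestor: 1 divided by 2, 4, ... is 0, which is not a node. *)
    have -> : y = 1%N by lia.
    rewrite divn_small; first by lia.
    by have := ltn_expl e (isT : 1 < 2)%N; lia.
  have l0 : (0 < l)%N by case: l yl => //; rewrite expn1; lia.
  exists 4%N; first by lia.
  apply: (@run_seq _ _ _ _ _ 1 3); xs; first by rewrite /=; repeat split=> //; lia.
  apply: run_le (run_frame (pull_run (i := (y %/ 2)%N) _ _ _)) _ _; rewrite /= ?upd_same ?ey //; try lia.
  move=> st2 [fr2 [s2 o2]]; exists (5 * l.-1)%N; first by lia.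
  exists (y %/ 2)%N, l.-1; split=> //; try lia.
  - by rewrite (frI fr2) //= upd_same ey.
  - by rewrite prednK // ltn_divLR // mulnC -expnS.
  - split=> [i ir ne|j jr].
      have [->//|iy] := eqVneq i (y %/ 2)%N.
      have ne1 e : (0 < e)%N -> i != (y %/ 2 ^ e)%N.
        case: e => // -[_|e _]; first by rewrite expn1.
        by rewrite expnS divnMA; exact: ne.
      have := ne 1%N isT; rewrite expn1 => ne2.
      apply: (sifted_eq _ _ _ _ _ _ (tb' i ir ne1));
        [exact: (o2 i iy).1|exact: (o2 i iy).2|..].
      + by apply: (o2 _ _).1; lia.
      + by apply: (o2 _ _).2; lia.
      + by apply: (o2 _ _).1; lia.
      + by apply: (o2 _ _).2; lia.
    have jy : j != (y %/ 2)%N by lia.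
    by have [-> ->] := o2 j jy; exact: lf.
- by exists x, k; split.
Qed.

Lemma build_run st r : ireg st xR = r -> (2 * r + 1 < B)%N ->
  run B build st (6 * r + 2) (fun st' =>
    tree r (rarr st' bTK) (iarr st' aTV) /\
    forall j, (r <= j)%N -> rarr st' bTK j = rarr st bTK j /\ iarr st' aTV j = iarr st aTV j).
Proof.
move=> er hB; rewrite /build.
have -> : (6 * r + 2 = 1 + (6 * r).+1)%N by lia.
xs; xs; first by rewrite /=; split=> //; lia.
rewrite /= er.
apply: (@run_while _ _ _ _ (fun c st' => exists y, [/\ ireg st' xNode = y,
   (y <= r - 1)%N, (6 * y <= c)%N &
   (forall i, (y < i < r)%N -> sifted (rarr st' bTK) (iarr st' aTV) i) /\
   forall j, (r <= j)%N -> rarr st' bTK j = rarr st bTK j /\ iarr st' aTV j = iarr st aTV j])).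
- move=> c st' fr [y [ey hy hc [tb' lf]]]; split.
    by rewrite /=; repeat split; lia.
  rewrite /= ey; case: ltnP => h2; last by split=> // i ir; apply: tb'; lia.
  exists 4%N; first by lia.
  apply: (@run_seq _ _ _ _ _ 3 1); apply: run_le (run_frame (pull_run ey _ _)) _ _; try lia.
  move=> st2 [fr2 [s2 o2]]; xs; first by rewrite /=; split=> //; lia.
  rewrite /= (frI fr2) // ey.
  exists (6 * (y - 1))%N; first by lia.
  exists (y - 1)%N; rewrite ?/= ?upd_same; split=> //; first by lia.
  split=> [i ir|j jr].
    have [->//|iy] := eqVneq i y.
    have yi : (y < i < r)%N by lia.
    apply: (sifted_eq _ _ _ _ _ _ (tb' i yi)); try by have [] := o2 i iy.
    + by apply: (o2 _ _).1; lia.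
    + by apply: (o2 _ _).2; lia.
    + by apply: (o2 _ _).1; lia.
    + by apply: (o2 _ _).2; lia.
  have jy : j != y by lia.
  by have [-> ->] := o2 j jy; exact: lf.
- exists (r - 1)%N; rewrite /= upd_same; split=> //; first by lia.
  by split=> // i; lia.
Qed.
End Tree.
Arguments upd {T} f i x j /.

(** * Dijkstra's algorithm on the alive vertices of an interval *)

Section Arrays.
Context {R : realType} (n : nat).

Lemma ix_eq (u v u' v' : nat) : (v < n)%N -> (v' < n)%N ->
  (u * n + v == u' * n + v')%N = (u == u') && (v == v').
Proof.
move=> hv hv'; apply/eqP/andP => [e|[/eqP -> /eqP -> //]].
have n0 : (0 < n)%N by nlia.
have eu : u = u'.
  by have := congr1 (divn^~ n) e; rewrite /= !divnMDl // !divn_small // !addn0.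
by move: e; rewrite eu => /addnI ->.
Qed.

Record graph_mem (outs ins : 'I_n -> seq 'I_n) (st : state R) : Prop := GraphMem {
  gm_n : ireg st xN = n;
  gm_od : forall u : 'I_n, iarr st aOd u = size (outs u);
  gm_out : forall (u : 'I_n) j, (j < size (outs u))%N ->
    iarr st aOut (u * n + j)%N = nth u (outs u) j;
  gm_id : forall u : 'I_n, iarr st aId u = size (ins u);
  gm_in : forall (u : 'I_n) j, (j < size (ins u))%N ->
    iarr st aIn (u * n + j)%N = nth u (ins u) j }.

Lemma graph_mem_frame c outs ins st st' : frame c st st' ->
  (xN \notin wir c) && all (fun a => a \notin wia c) [:: aOd; aOut; aId; aIn] ->
  graph_mem outs ins st -> graph_mem outs ins st'.
Proof.
move=> fr /andP[h /and5P[h1 h2 h3 h4 _]] [e1 e2 e3 e4 e5]; split.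
- by rewrite (frI fr).
- by move=> u; rewrite (frIA fr).
- by move=> u j lt; rewrite (frIA fr) // e3.
- by move=> u; rewrite (frIA fr).
- by move=> u j lt; rewrite (frIA fr) // e5.
Qed.

Lemma uniq_size_ord (vs : seq 'I_n) : uniq vs -> (size vs <= n)%N.
Proof. by move=> /card_uniqP <-; rewrite -[X in (_ <= X)%N]card_ord max_card. Qed.

Lemma sum_seq_const (I : Type) (r : seq I) c : (\sum_(i <- r) c = size r * c)%N.
Proof. by rewrite big_const_seq count_predT iter_addn_0 mulnC. Qed.

End Arrays.

Section Dijkstra.
Context {R : realType} (B n H lgn : nat) (outs ins : 'I_n -> seq 'I_n).
Context (wt : 'I_n -> 'I_n -> R) (curf : 'I_n -> R) (inf : R).
Context (vs : seq 'I_n) (o : nat) (v0 : 'I_n).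
Implicit Types (st : state R) (u v x : 'I_n).

Context (hB : (4 * (H + 1) * (n + 1) * (n + 1) < B)%N) (ho : (o <= H * n)%N).
Context (hlg : (n <= 2 ^ lgn)%N).
Context (io : forall u v, (v \in outs u) = (u \in ins v)).
Context (uout : forall u, uniq (outs u)) (uin : forall u, uniq (ins u)).
Context (wt0 : forall u v, v \in outs u -> 0 <= wt u v).
Context (inf0 : 0 < inf) (uvs : uniq vs).

Notation r := (size vs).

Lemma r_le : (r <= n)%N. Proof. exact: uniq_size_ord. Qed.

Lemma B_bound k : (k <= 4 * (H * n) + 4 * (n * n) + 4 * n + 4)%N -> (k < B)%N.
Proof using hB. clear -hB; nia. Qed.

Definition group_mem st :=
  [/\ ireg st xO = o, ireg st xR = r &
     forall k, (k < r)%N -> iarr st aAL (o + k)%N = nth v0 vs k].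

Lemma group_mem_frame c st st' : frame c st st' ->
  [&& xO \notin wir c, xR \notin wir c & aAL \notin wia c] ->
  group_mem st -> group_mem st'.
Proof.
move=> fr /and3P[h1 h2 h3] [e1 e2 e3]; split; rewrite ?(frI fr) //.
by move=> k kr; rewrite (frIA fr) // e3.
Qed.

Lemma mem_takeS j x : (j < r)%N ->
  (x \in take j.+1 vs) = (x == nth v0 vs j) || (x \in take j vs).
Proof. by move=> lt; rewrite (take_nth v0) // mem_rcons inE. Qed.

Lemma mark_run st : group_mem st -> rreg st yInf = inf ->
  run B mark_group st (r * 5 + 2) (fun st' =>
    (forall v, v \in vs -> iarr st' aPos v = index v vs) /\
    (forall v, rarr st' bCur v = if v \in vs then inf else rarr st bCur v)).
Proof.
move=> gm ei; have rn := r_le.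
apply: (@run_for_const _ _ _ _ _ _ _ 3 (fun j st' =>
   (forall v, v \in take j vs -> iarr st' aPos v = index v vs) /\
   (forall v, rarr st' bCur v = if v \in take j vs then inf else rarr st bCur v))) => //.
- by have := @B_bound 1; nlia.
- by have [] := gm.
- by rewrite take0; split.
- move=> j st1 fr ej er lt [ip ic].
  have [eo _ eal] := group_mem_frame fr isT gm.
  apply: (@run_time _ _ _ _ 3); last by [].
  apply: (@run_seq _ _ _ _ _ 1 2); xs.
    by rewrite /= ej eo; split=> //; apply: B_bound; nlia.
  rewrite /= ej eo eal //.
  apply: (@run_seq _ _ _ _ _ 1 1); xs => //; xs => //.
  rewrite /= ej (frR fr) // ei; set w := nth v0 vs j; split=> v.
    rewrite mem_takeS // /= val_eqE -/w.
    case: eqP => [-> _|_ /= h]; last by exact: ip.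
    by rewrite /w index_uniq.
  by rewrite mem_takeS // /= val_eqE -/w; case: eqP => //= _; exact: ic.
- by move=> st1 _ []; rewrite take_size.
Qed.

Definition cur' v := if v \in vs then inf else curf v.

(** The key before the tournament starts: the cheapest entry from a frozen vertex, capped by [inf].
    In-neighbours in the group are read at [inf], so they cannot improve it. *)
Definition key0 v y :=
  [/\ y <= inf, forall u, u \in ins v -> y <= cur' u + wt u v &
      y = inf \/ exists2 u, u \in ins v & y = cur' u + wt u v].

Definition wt_mem st := forall u v, v \in outs u -> rarr st bWt (u * n + v)%N = wt u v.
Definition cur_mem (f : 'I_n -> R) st :=
  forall v u, u \in ins v -> rarr st bCur u = f u.

Lemma pull_edges_run st v : graph_mem outs ins st -> wt_mem st -> cur_mem cur' st ->
  ireg st xV = v -> ireg st xDeg = size (ins v) -> rreg st yX = inf ->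
  run B (For xJ xDeg pull_edge) st (size (ins v) * 6 + 2) (fun st' => key0 v (rreg st' yX)).
Proof.
move=> gm wm cm ev ed ei; have hn := ltn_ord v.
apply: (@run_for_const _ _ _ _ _ _ _ 4 (fun j st' =>
   [/\ rreg st' yX <= inf, forall u, u \in take j (ins v) -> rreg st' yX <= cur' u + wt u v &
      rreg st' yX = inf \/ exists2 u, u \in ins v & rreg st' yX = cur' u + wt u v])) => //.
- by have := @B_bound 1; nlia.
- by rewrite take0 /= ei; split=> //; left.
- move=> j st1 fr ej er lt [i1 i2 i3].
  have gm1 := graph_mem_frame fr isT gm.
  have ev1 : ireg st1 xV = v by rewrite (frI fr).
  have jn := uniq_size_ord (uin v).
  have mn : (v * n + n <= n * n)%N by nia.
  apply: (@run_time _ _ _ _ 4); last by [].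
  apply: (@run_seq _ _ _ _ _ 1 3); xs.
    by rewrite /= (gm_n gm1) ev1 ej; repeat split=> //; apply: B_bound; nlia.
  rewrite /= (gm_n gm1) ev1 ej (gm_in gm1) //; set u := nth v (ins v) j.
  have uv : u \in ins v by exact: mem_nth.
  have un : (u * n + v < n * n)%N by have := ltn_ord u; nia.
  apply: (@run_seq _ _ _ _ _ 1 2); xs.
    by rewrite /= (gm_n gm1) ev1; repeat split=> //; apply: B_bound; nlia.
  rewrite /= (gm_n gm1) ev1 (frRA fr) // (cm v) // (frRA fr) // wm ?io //.
  apply: (@run_time _ _ _ _ 2); last by [].
  apply: (@run_if _ _ _ _ _ _ 1 1) => //=.
  + move=> le; xs; rewrite /=; split=> // x.
    by rewrite (take_nth v) // mem_rcons inE => /predU1P[->//|]; exact: i2.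
  + rewrite -ltNge => lt1; xs => //; rewrite /=; split.
    * by apply/ltW/(lt_le_trans lt1).
    * move=> x; rewrite (take_nth v) // mem_rcons inE => /predU1P[->//|hx].
      by apply/ltW/(lt_le_trans lt1)/i2.
    * by right; exists u.
- by move=> st1 _ [i1 i2 i3]; split=> // u uv; apply: i2; rewrite take_size.
Qed.

Definition init_cost v := (size (ins v) * 6 + 8)%N.

Lemma init_keys_run st : graph_mem outs ins st -> wt_mem st -> cur_mem cur' st ->
  group_mem st -> rreg st yInf = inf ->
  run B init_keys st (\sum_(j < r) (init_cost (nth v0 vs j) + 2) + 2) (fun st' =>
    exists kf, [/\ forall v, rarr st' bKey v = if v \in vs then kf v else rarr st bKey v,
      forall v, v \in vs -> key0 v (kf v) &
      forall k, (k < r)%N -> rarr st' bTK (r + k)%N = kf (nth v0 vs k) /\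
                            iarr st' aTV (r + k)%N = nth v0 vs k]).
Proof.
move=> gm wm cm grm ei; have rn := r_le.
apply: (@run_for _ _ _ _ _ _ _ (fun j => init_cost (nth v0 vs j)) (fun j st' =>
    exists kf : 'I_n -> R, [/\ forall v, rarr st' bKey v = if v \in take j vs then kf v else rarr st bKey v,
      forall v, v \in take j vs -> key0 v (kf v) &
      forall k, (k < j)%N -> rarr st' bTK (r + k)%N = kf (nth v0 vs k) /\
                            iarr st' aTV (r + k)%N = nth v0 vs k])) => //.
- by have := @B_bound 1; nlia.
- by have [] := grm.
- by rewrite take0; exists (fun=> 0); split.
- move=> j st1 fr ej er lt [kf [i1 i2 i3]].
  have gm1 := graph_mem_frame fr isT gm.
  have [eo _ eal] := group_mem_frame fr isT grm.
  set v := nth v0 vs j.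
  have -> : init_cost v = (1 + (1 + (1 + ((size (ins v) * 6 + 2) + (1 + (1 + 1))))))%N.
    by rewrite /init_cost; nlia.
  xs; xs; first by rewrite /= ej eo; split=> //; apply: B_bound; nlia.
  rewrite /= ej eo eal // -/v.
  xs; xs => //; rewrite /= (frR fr) // ei.
  xs; xs => //; rewrite /= (gm_id gm1).
  xs; apply: run_then (pull_edges_run (v := v) _ _ _ _ _ _) _.
  + by case: gm1 => *; split.
  + by move=> u w uw; rewrite /= (frRA fr) // wm.
  + by move=> u w uw; rewrite /= (frRA fr) // (cm _ _ uw).
  + by [].
  + by [].
  + by [].
  move=> st2 [fr2 k2].
  have f1 : ireg st2 xV = v by rewrite (frI fr2) //=.
  have f2 : ireg st2 xR = r by rewrite (frI fr2) //= !upd_other.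
  have f3 : ireg st2 xK = j by rewrite (frI fr2) //= !upd_other.
  xs; xs => //; rewrite /= f1.
  have okk : (r + j < B)%N by apply: B_bound; nlia.
  xs; xs => //; first by rewrite /= f2 f3.
  xs => //; first by rewrite /= f2 f3.
  rewrite /= f1 f2 f3.
  have e3 a : a \notin [::] -> rarr st2 a = rarr st1 a.
    by move=> _; rewrite (frRA fr2).
  have e4 a : a \notin [::] -> iarr st2 a = iarr st1 a.
    by move=> _; rewrite (frIA fr2).
  exists (fun u => if u == v then rreg st2 yX else kf u); split.
  + move=> u; rewrite mem_takeS // -/v /= val_eqE.
    by case: eqP => //= _; rewrite e3 // i1.
  + move=> u; rewrite mem_takeS // -/v; case: eqP => [-> _|_ /=]; [exact: k2|exact: i2].
  + move=> k; rewrite ltnS leq_eqVlt => /predU1P[->|kj].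
      by rewrite -/v /= !eqxx.
    have kj1 : (r + k == r + j)%N = false by rewrite eqn_add2l; nlia.
    rewrite /= !kj1.
    rewrite e3 // e4 //; have [-> ->] := i3 k kj; split=> //.
    case: eqP => // /eqP; rewrite nth_uniq // ?(ltn_trans kj) //.
    by move=> /eqP kj'; move: kj; rewrite kj' ltnn.
- move=> st1 fr [kf [i1 i2 i3]]; exists kf; split=> //.
  + by move=> v; rewrite i1 take_size.
  + by move=> v hv; apply: i2; rewrite take_size.
Qed.

Context (P : 'I_n -> R -> Prop) (big : R).
Context (inf_big : inf < big).
Context (cur0 : forall u, 0 <= curf u).
Context (P_inf : forall v, P v inf).
Context (P_cur : forall u v, u \in ins v -> u \notin vs -> P u (curf u)).
Context (P_edge : forall u v (x : R), v \in outs u -> P u x -> P v (x + wt u v)).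
Implicit Types (kf : 'I_n -> R) (F : seq 'I_n).

(** [P] is any property of values at vertices that relaxing an edge propagates. It will say that a
    walk of the current version certifies the value; its abstract form keeps versions out of this
    section. *)
Definition key_ok kf :=
  [/\ forall x, x \in vs -> 0 <= kf x <= inf,
      forall x u, x \in vs -> u \in ins x -> u \notin vs -> kf x <= curf u + wt u x &
      forall x, x \in vs -> P x (kf x)].

Lemma key0_ok kf : (forall v, v \in vs -> key0 v (kf v)) -> key_ok kf.
Proof.
move=> k0; split=> [x xv|x u xv ux uv|x xv]; have [k1 k2 k3] := k0 x xv.
- rewrite k1 andbT; case: k3 => [->|[u ux ->]]; first exact: ltW.
  apply: addr_ge0; last by rewrite wt0 // io.
  by rewrite /cur'; case: ifP => // _; exact: ltW.
- by have := k2 u ux; rewrite /cur' (negbTE uv).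
(* If [u] is in the group, the key is [inf + wt u x]; being capped by [inf] it equals [inf], where
   [P] is known. *)
- case: k3 => [->//|[u ux e]]; rewrite e /cur'; case: ifP => [uv|/negbT uv].
    suff -> : inf + wt u x = inf by [].
    apply/le_anti; rewrite lerDl wt0 ?io // andbT.
    by move: k1; rewrite e /cur' uv.
  by apply: P_edge; [rewrite io|exact: P_cur ux uv].
Qed.

Definition leaf_mem F kf st := forall k, (k < r)%N ->
  let v := nth v0 vs k in
  rarr st bTK (r + k)%N = (if v \in F then big else kf v) /\
  iarr st aTV (r + k)%N = v.

Definition pq_mem F kf st :=
  [/\ forall v, rarr st bKey v = if v \in vs then kf v else 0,
      tree r (rarr st bTK) (iarr st aTV) & leaf_mem F kf st].

Definition pos_mem st := forall v, v \in vs -> iarr st aPos v = index v vs.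

Definition settled F kf :=
  [/\ uniq F, {subset F <= vs}, key_ok kf &
     forall f x, f \in F -> x \in vs -> x \notin F -> kf f <= kf x].

Definition relaxed F kf :=
  forall f x, f \in F -> x \in vs -> x \in outs f -> kf x <= kf f + wt f x.

Definition static st := [/\ graph_mem outs ins st, wt_mem st, pos_mem st,
  ireg st xR = r & rreg st yBig = big].

Lemma static_frame c st st' : frame c st st' ->
  [&& xN \notin wir c, xR \notin wir c, yBig \notin wrr c, bWt \notin wra c &
     all (fun a => a \notin wia c) [:: aOd; aOut; aId; aIn; aPos]] ->
  static st -> static st'.
Proof.
move=> fr /and5P[h1 h2 h3 h4 h5] [e1 e2 e3 e4 e5].
case/and5P: (h5) => h6 h7 h8 h9 /andP[h10 _]; split.
- by apply: graph_mem_frame fr _ e1; rewrite h1 /= h6 h7 h8 h9.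
- by move=> u v uv; rewrite (frRA fr) // e2.
- by move=> v vv; rewrite (frIA fr) // e3.
- by rewrite (frI fr).
- by rewrite (frR fr).
Qed.

Definition relax_cost := (5 * lgn + 7)%N.

(* Relaxing an edge never improves a settled vertex, nor one outside of the
   group: the keys of the latter are 0. *)
Lemma relax_run st v j F kf : static st -> ireg st xV = v -> ireg st xJ = j ->
  (j < size (outs v))%N -> rreg st yX = kf v -> v \in F ->
  pq_mem F kf st -> settled F kf -> (forall f, f \in F -> kf f <= kf v) ->
  run B relax st relax_cost (fun st' => exists kf',
    [/\ pq_mem F kf' st', settled F kf' , forall f, f \in F -> kf' f = kf f,
        forall x, kf' x <= kf x &
        nth v (outs v) j \in vs -> kf' (nth v (outs v) j) <= kf v + wt v (nth v (outs v) j)]).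
Proof.
move=> [gm wm pm er eb] ev ej lt eX vF [pk pt pl] [uF sF [ok1 ok2 ok3] oF] mF.
have rn := r_le; have hn := ltn_ord v; have jn := uniq_size_ord (uout v).
have mn : (v * n + n <= n * n)%N by nia.
set y := nth v (outs v) j; have yv : y \in outs v by exact: mem_nth.
have yn := ltn_ord y.
apply: (@run_time _ _ _ _ (1 + (1 + (maxn 1 (1 + (1 + (1 + (5 * lgn).+1)))).+1))%N); last by rewrite /relax_cost; nlia.
rewrite /relax; xs; xs.
  by rewrite /= (gm_n gm) ev ej; repeat split=> //; apply: B_bound; nlia.
rewrite /= (gm_n gm) ev ej (gm_out gm) // -/y.
xs; xs.
  by rewrite /= (gm_n gm) ev; repeat split=> //; apply: B_bound; nlia.
rewrite /= (gm_n gm) ev eX wm //.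
have z0 : 0 <= wt v y by exact: wt0.
xs => //=; rewrite pk.
- move=> le; xs; exists kf; split=> // yvs; by move: le; rewrite yvs.
rewrite -ltNge => lt1; have kv0 : 0 <= kf v by case/andP: (ok1 _ (sF _ vF)).
have yvs : y \in vs.
  by move: lt1; case: ifP => // _; rewrite ltNge addr_ge0.
rewrite yvs in lt1.
have yF : y \notin F.
  by apply/negP => /mF h; move: lt1; rewrite ltNge (le_trans h) // lerDl.
set z := kf v + wt v y in lt1 *.
pose kf' x := if x == y then z else kf x.
have iy : (index y vs < r)%N by rewrite index_mem.
xs; xs => //=; xs; xs; first by rewrite /= er pm //; repeat split=> //; apply: B_bound; nlia.
rewrite /= er pm //.
xs; xs => //=.
apply: run_then (sift_run (r := r) (x := (r + index y vs)%N) (k := lgn) _ _ _ _ _) _.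
- by [].
- by nlia.
- by rewrite expnS; nlia.
- by apply: B_bound; nlia.
(* Only the key of the leaf changes; its vertex is overwritten by itself to fit [tree_but_leaf]. *)
- rewrite /= -[iarr st 16](_ : upd (iarr st 16) (r + index y vs) (y : nat) = iarr st 16) //.
    exact: tree_but_leaf.
  apply/funext => k /=; case: eqP => // ->.
  by have [_ ->] := pl _ iy; rewrite nth_index.
move=> st2 [fr2 [t2 l2]].
exists kf'; split.
- split=> //.
    move=> x; rewrite (frRA fr2) //= val_eqE pk /kf'; case: eqP => // ->.
    by rewrite yvs.
  move=> k kr /=; have [-> ->] := l2 (r + k)%N (leq_addr _ _).
  have [h1 h2] := pl k kr; rewrite /= h1 h2; split=> //.
  rewrite eqn_add2l /kf'.
  have -> : (k == index y vs) = (nth v0 vs k == y).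
    by rewrite -{2}(nth_index v0 yvs) nth_uniq.
  by case: eqP => // ->; rewrite (negbTE yF).
- split=> //.
    split.
    + move=> x xv; rewrite /kf'; case: eqP => [_|_]; last exact: ok1.
      rewrite addr_ge0 //=; apply: ltW; apply: lt_le_trans lt1 _.
      by case/andP: (ok1 _ yvs).
    + move=> x u xv ux uv; rewrite /kf'; case: eqP => [e|_]; last exact: ok2.
      by rewrite e; apply: ltW; apply: lt_le_trans lt1 _; rewrite ok2 // -e.
    + move=> x xv; rewrite /kf'; case: eqP => [->|_]; last exact: ok3.
      by apply: P_edge => //; exact/ok3/sF.
  move=> f x fF xv xF; rewrite /kf'; case: eqP => [e|_]; first by rewrite -e fF in yF.
  case: eqP => [_|_]; last exact: oF.
  by apply: le_trans (mF _ fF) _; rewrite lerDl.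
- by move=> f fF; rewrite /kf'; case: eqP => // e; rewrite -e fF in yF.
- by move=> x; rewrite /kf'; case: eqP => // ->; exact: ltW.
- by move=> _; rewrite /kf' eqxx.
Qed.

Definition settle_cost v := (5 * lgn + 8 + size (outs v) * (5 * lgn + 9))%N.

(** The vertex is chosen before the run, since its out-degree fixes the number of steps; it is the
    one at the root of the tree. *)
Lemma settle_run st F kf : static st -> (size F < r)%N ->
  pq_mem F kf st -> settled F kf -> relaxed F kf ->
  exists v, [/\ v \in vs, v \notin F &
  run B settle st (settle_cost v) (fun st' => exists kf',
    [/\ pq_mem (v :: F) kf' st', settled (v :: F) kf' & relaxed (v :: F) kf'])].
Proof.
move=> stc ltF [pk pt pl] [uF sF [ok1 ok2 ok3] oF] rF.
have r0 : (0 < r)%N by nlia.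
have rn := r_le; have [gm wm pm er eb] := stc.
have root : (1 <= 1 < 2 * r)%N by nlia.
have [k0 [k0r ek ev]] := tree_leaf pt root.
have [l1 l2] := pl k0 k0r; set v := nth v0 vs k0 in l1 l2.
have vvs : v \in vs by exact: mem_nth.
have kmin x : x \in vs -> rarr st bTK 1%N <= (if x \in F then big else kf x).
  move=> xv; have xi : (index x vs < r)%N by rewrite index_mem.
  have := (pl _ xi).1; rewrite nth_index // => <-.
  by apply: tree_root_le pt _; nlia.
(* Some vertex of the group is still unsettled, with key at most [inf], so a settled leaf, of key
   [big > inf], cannot have won the tournament. *)
have vF : v \notin F.
  apply/negP => vF; have [w wv wF] : exists2 w, w \in vs & w \notin F.
    apply: contrapT => h; have : {subset vs <= F}.
      by move=> x xv; apply: contrapT => xF; apply: h; exists x => //; exact/negP.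
    by move=> /(uniq_leq_size uvs); rewrite leqNgt ltF.
  have := kmin w wv; rewrite (negbTE wF) ek l1 vF => h.
  by have /andP[_ h2] := ok1 w wv; move: (le_lt_trans (le_trans h h2) inf_big); rewrite ltxx.
exists v; split=> //.
have kv x : x \in vs -> x \notin F -> kf v <= kf x.
  by move=> xv xF; have := kmin x xv; rewrite (negbTE xF) ek l1 (negbTE vF).
have hn := ltn_ord v.
have iv : index v vs = k0 by rewrite /v index_uniq.
rewrite /settle.
have -> : settle_cost v = (1 + (1 + (1 + (1 + ((5 * lgn).+1 + (1 + (size (outs v) * (relax_cost + 2) + 2)))))))%N.
  by rewrite /settle_cost /relax_cost; nia.
xs; xs; first by rewrite /=; apply: B_bound; nlia.
rewrite /= ev l2.
xs; xs => //; rewrite /= pk vvs.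
xs; xs; first by rewrite /= er pm // iv; repeat split=> //; apply: B_bound; nlia.
rewrite /= er pm // iv.
xs; xs => //; rewrite /= eb.
xs.
apply: run_then (sift_run (r := r) (x := (r + k0)%N) (k := lgn) _ _ _ _ _) _.
- by [].
- by nlia.
- by rewrite expnS; nlia.
- by apply: B_bound; nlia.
- rewrite /= -[iarr st 16](_ : upd (iarr st 16) (r + k0) (v : nat) = iarr st 16) //.
    exact: tree_but_leaf.
  by apply/funext => k /=; case: eqP => // ->; rewrite l2.
move=> st2 [fr2 [t2 lf2]].
have gd : iarr st2 aOd v = size (outs v) by rewrite (frIA fr2) // (gm_od gm).
have gv : ireg st2 xV = v by rewrite (frI fr2).
xs; xs => //; rewrite /= gv gd.
pose F' := v :: F.
set st3 := set_ireg _ _ _.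
have stc3 : static st3.
  have stc2 : static st2.
    by apply: static_frame fr2 isT _; case: stc => -[*] *; split=> //; split.
  by case: stc2 => -[*] *; split=> //; split.
have pq3 : pq_mem F' kf st3.
  split=> //.
    by move=> x; rewrite /st3 /= (frRA fr2) //= pk.
  move=> k kr /=; have [-> ->] := lf2 (r + k)%N (leq_addr _ _).
  have [h1 h2] := pl k kr; rewrite /= h1 h2; split=> //.
  rewrite eqn_add2l inE /v nth_uniq //; by case: eqP.
have set3 : settled F' kf.
  split=> //=.
  - by rewrite vF.
  - by move=> x; rewrite inE => /predU1P[->//|]; exact: sF.
  - move=> f x; rewrite !inE negb_or => /predU1P[->|fF] xv /andP[_ xF]; [exact: kv|exact: oF].
have mF f : f \in F' -> kf f <= kf v.
  by rewrite inE => /predU1P[->//|fF]; exact: oF.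
apply: (@run_for_const _ _ _ _ _ _ _ relax_cost (fun j st' => exists kf',
  [/\ pq_mem F' kf' st', settled F' kf', forall f, f \in F' -> kf' f = kf f,
      forall x, kf' x <= kf x &
      forall y, y \in take j (outs v) -> y \in vs -> kf' y <= kf v + wt v y])) => //.
- by apply: B_bound; nlia.
- by rewrite take0; exists kf; split.
- move=> j st4 fr4 ej ed lt [kf4 [pq4 set4 e4 le4 d4]].
  have stc4 : static st4 by exact: static_frame fr4 isT stc3.
  have gv4 : ireg st4 xV = v by rewrite (frI fr4).
  have gx4 : rreg st4 yX = kf v by rewrite (frR fr4) //= (frR fr2).
  have vF' : v \in F' by rewrite inE eqxx.
  have kv4 : kf4 v = kf v by exact: e4.
  have mF4 f : f \in F' -> kf4 f <= kf4 v.
    by move=> fF; rewrite e4 // kv4 mF.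
  rewrite -kv4 in gx4.
  apply: run_le (relax_run stc4 gv4 ej lt gx4 vF' pq4 set4 mF4) (leqnn _) _.
  move=> st5 [kf5 [pq5 set5 e5 le5 d5]].
  exists kf5; split=> //.
  + by move=> f fF; rewrite e5 // e4.
  + by move=> x; apply: le_trans (le5 x) (le4 x).
  + move=> y; rewrite (take_nth v) // mem_rcons inE => /predU1P[->|yj] yvs.
      by rewrite -kv4; exact: d5.
    by apply: le_trans (le5 y) (d4 _ yj yvs).
- move=> st4 fr4 [kf4 [pq4 set4 e4 le4 d4]]; exists kf4; split=> //.
  move=> f x; rewrite inE => /predU1P[->|fF] xv fx.
    by rewrite [kf4 v]e4 ?inE ?eqxx // d4 // take_size.
  rewrite [kf4 f]e4 ?inE ?fF ?orbT //.
  by apply: le_trans (le4 x) (rF _ _ fF xv fx).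
Qed.

Definition dij_cost v := (settle_cost v + init_cost v + 30)%N.

Lemma settle_all_run st kf : static st -> pq_mem [::] kf st -> key_ok kf ->
  run B (For xK xR settle) st (\sum_(v <- vs) (settle_cost v + 2) + 2) (fun st' => exists kf',
    [/\ forall v, rarr st' bKey v = if v \in vs then kf' v else 0,
        key_ok kf' & relaxed vs kf']).
Proof.
move=> stc pq ok; have rn := r_le.
(* The order of settling is unknown, so the credit left is the total cost of the vertices that are
   not settled yet. *)
pose pot F := (\sum_(v | (v \in vs) && (v \notin F)) (settle_cost v + 2))%N.
rewrite (_ : (\sum_(v <- vs) _)%N = pot [::]); last first.
  by rewrite big_uniq //; apply: eq_bigl => v; rewrite andbT.
apply: (@run_for_credit _ _ _ _ _ _ r _ (fun j k st' => exists F kf',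
  [/\ pq_mem F kf' st', settled F kf', relaxed F kf', size F = j & k = pot F])) => //.
- by apply: B_bound; nlia.
- by case: stc.
- exists [::], kf; split=> //.
- move=> j k st1 fr ej er lt [F [kf1 [pq1 set1 rel1 sz ->]]].
  have stc1 := static_frame fr isT stc.
  rewrite -sz in lt; have [v [vv vF rn1]] := settle_run stc1 lt pq1 set1 rel1.
  have potE : pot F = (settle_cost v + 2 + pot (v :: F))%N.
    rewrite /pot (bigD1 v) /= ?vv //; congr (_ + _)%N; apply: eq_bigl => x.
    by rewrite inE negb_or andbAC andbA.
  exists (settle_cost v); first by nlia.
  apply: run_le rn1 (leqnn _) _ => st2 [kf2 [pq2 set2 rel2]].
  exists (pot (v :: F)); first by nlia.
  by exists (v :: F), kf2; split=> //=; rewrite sz.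
- move=> k st1 fr [F [kf1 [[pk _ _] [uF sF ok1 _] rel1 sz _]]].
  have FE : F =i vs by have [] := uniq_min_size uF sF; rewrite ?sz.
  by exists kf1; split=> // f x fv; apply: rel1; rewrite FE.
Qed.

Lemma dijkstra_run st a : graph_mem outs ins st -> wt_mem st -> cur_mem curf st ->
  ireg st xA = a -> (a * n)%N = o -> (a <= H)%N -> iarr st aCN a = r ->
  (forall k, (k < r)%N -> iarr st aAL (o + k)%N = nth v0 vs k) ->
  rreg st yInf = inf -> rreg st yBig = big -> (forall v, rarr st bKey v = 0) ->
  run B dijkstra st (\sum_(v <- vs) dij_cost v + 10) (fun st' => exists kf,
    [/\ forall v, rarr st' bKey v = if v \in vs then kf v else 0,
        key_ok kf, relaxed vs kf, ireg st' xO = o /\ ireg st' xR = r &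
        forall u v, u \in ins v -> u \notin vs -> rarr st' bCur u = curf u]).
Proof.
move=> gm wm cm ea eo aH ecn eal ei eb ek; have rn := r_le.
have -> : (\sum_(v <- vs) dij_cost v + 10 = 1 + (1 + ((r * 5 + 2) +
    ((\sum_(j < r) (init_cost (nth v0 vs j) + 2) + 2) + ((6 * r + 2) +
     (\sum_(v <- vs) (settle_cost v + 2) + 2 + r * 15))))))%N.
  rewrite -(big_mkord xpredT (fun j => init_cost (nth v0 vs j) + 2)%N).
  rewrite -(big_nth v0 xpredT (fun v => init_cost v + 2)%N).
  rewrite /dij_cost !big_split /= !sum_seq_const; nlia.
rewrite /dijkstra.
have aon : (a * n + n <= H * n + n)%N by nia.
xs; xs; first by rewrite /= (gm_n gm) ea; repeat split=> //; apply: B_bound; nlia.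
rewrite /= (gm_n gm) ea eo.
xs; xs => //; rewrite /= ea ecn.
set st1 := set_ireg _ _ _.
have grm1 : group_mem st1 by [].
have gm1 : graph_mem outs ins st1 by case: gm => *; split.
xs; apply: run_then (mark_run grm1 _) _ => // st2 [fr2 [p2 c2]].
have grm2 := group_mem_frame fr2 isT grm1.
have gm2 := graph_mem_frame fr2 isT gm1.
have wm2 : wt_mem st2 by move=> u v uv; rewrite (frRA fr2) //= wm.
have cm2 : cur_mem cur' st2.
  by move=> v u uv; rewrite c2 /cur'; case: ifP => //= _; exact: cm uv.
xs; apply: run_then (init_keys_run gm2 wm2 cm2 grm2 _) _.
  by rewrite (frR fr2).
move=> st3 [fr3 [kf [k3 i3 t3]]].
xs; apply: run_then (build_run (r := r) _ _) _.
- by rewrite (frI fr3) // (frI fr2).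
- by apply: B_bound; nlia.
move=> st4 [fr4 [t4 l4]].
have gm4 := graph_mem_frame fr4 isT (graph_mem_frame fr3 isT gm2).
have stc4 : static st4.
  split=> //.
  - by move=> u v uv; rewrite (frRA fr4) // (frRA fr3) // wm2.
  - by move=> v vv; rewrite (frIA fr4) // (frIA fr3) // p2.
  - by rewrite (frI fr4) // (frI fr3) // (frI fr2).
  - by rewrite (frR fr4) // (frR fr3) // (frR fr2).
have pq4 : pq_mem [::] kf st4.
  split=> //.
  - move=> v; rewrite (frRA fr4) // k3; case: ifP => // _.
    by rewrite (frRA fr2) //= ek.
  - move=> k kr /=; have [-> ->] := l4 (r + k)%N (leq_addr _ _).
    exact: t3.
apply: run_le (run_frame (settle_all_run stc4 pq4 (key0_ok i3))) (leq_addr _ _) _.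
move=> st5 [fr5 [kf' [k5 ok5 r5]]]; exists kf'; split=> //.
- by rewrite !(frI fr5) // !(frI fr4) // !(frI fr3) // !(frI fr2).
- move=> u v uv uvs'; rewrite (frRA fr5) // (frRA fr4) // (frRA fr3) // c2 (negbTE uvs') /=.
  exact: cm uv.
Qed.

End Dijkstra.
(** * Walks and estimates *)

Section Walks.
Context {R : realType} (n : nat).
Implicit Types (G : wgraph R n) (s u v x y : 'I_n) (p : seq 'I_n).

Definition dominates G' G :=
  forall x y w, G x y = Some w -> exists2 w', G' x y = Some w' & w' <= w.

Lemma dominates_refl G : dominates G G.
Proof. by move=> x y w; exists w. Qed.

Lemma dominates_trans G1 G2 G3 : dominates G1 G2 -> dominates G2 G3 -> dominates G1 G3.
Proof.
by move=> d1 d2 x y w /d2[w' /d1[w'' e l] l']; exists w''; rewrite ?(le_trans l).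
Qed.

Lemma dominates_walk G' G x p : dominates G' G -> path (adj G) x p ->
  path (adj G') x p /\ walk_weight G' x p <= walk_weight G x p.
Proof.
move=> d; elim: p x => //= y p IH x /andP[]; rewrite /adj.
case e: (G x y) => [w|] // _ /IH[h1 h2]; have [w' -> l] := d _ _ _ e.
by split=> //; rewrite /= lerD.
Qed.

Lemma walk_weight_rcons G x p y :
  walk_weight G x (rcons p y) = walk_weight G x p + odflt 0 (G (last x p) y).
Proof. by elim: p x => /= [|z p IH] x; rewrite ?addr0 ?add0r // IH addrA. Qed.

Lemma versionS G e us j : version G (e :: us) j.+1 = version (apply_update G e) us j.
Proof. by []. Qed.

Context (W : R) (W1 : 1 <= W).

Lemma apply_update_weights G e : e.2 = 0 \/ 1 <= e.2 <= W -> weights_in W G ->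
  weights_in W (apply_update G e).
Proof. by move=> he hG x y w; rewrite /apply_update; case: ifP => _; [case=> <-|exact: hG]. Qed.

Lemma version_weights G us j : weights_in W G -> incremental_seq W G us ->
  weights_in W (version G us j).
Proof.
elim: us G j => [|e us IH] G [|j] //= hG [he _ hus].
by rewrite versionS; apply: IH => //; exact: apply_update_weights.
Qed.

Lemma apply_update_dominates G e : incremental G e -> dominates (apply_update G e) G.
Proof.
move=> inc x y w Gw; rewrite /apply_update; case: ifP => [/andP[/eqP ex /eqP ey]|_].
  by exists e.2 => //; move: inc; rewrite /incremental -ex -ey Gw => /ltW.
by exists w.
Qed.

Lemma version_dominates G us i j : incremental_seq W G us -> (i <= j)%N ->
  dominates (version G us j) (version G us i).
Proof.
elim: us G i j => [|e us IH] G i j /=; first by move=> _ _; exact: dominates_refl.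
case=> _ inc hus; case: j i => [|j] [|i] //= ij.
- exact: dominates_refl.
- by rewrite versionS; apply: dominates_trans (IH _ 0%N j hus isT) _; rewrite /version take0;
    exact: apply_update_dominates.
- exact: IH.
Qed.

Lemma walk_weight_ge0 G x p : weights_in W G -> 0 <= walk_weight G x p.
Proof.
move=> hG; elim: p x => //= y p IH x; apply: addr_ge0 => //.
by case e: (G x y) => [w|] //=; case: (hG _ _ _ e) => [->//|/andP[/(le_trans ler01)]].
Qed.

Lemma walk_weight_le G x p : weights_in W G -> path (adj G) x p ->
  walk_weight G x p <= (size p)%:R * W.
Proof.
move=> hG; elim: p x => [|y p IH] x /=; first by rewrite mul0r.
case/andP=> _ /IH h; rewrite -natr1 mulrDl mul1r addrC lerD //.
case e: (G x y) => [w|] /=; last exact: le_trans ler01 W1.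
by case: (hG _ _ _ e) => [->|/andP[]//]; exact: le_trans ler01 W1.
Qed.

(** The vertices after [s] are distinct and each is the head of an edge. *)
Lemma uniq_path_size G s p : path (adj G) s p -> uniq (s :: p) -> (size p <= nb_edges G)%N.
Proof.
move=> + /= /andP[_ up]; rewrite -(card_uniqP up) => pp.
pose E := [set q : 'I_n * 'I_n | adj G q.1 q.2]%SET.
apply: leq_trans (leq_imset_card (fun q : 'I_n * 'I_n => q.2) (mem E)).
apply/subset_leq_card/fintype.subsetP => y; elim: p s pp {up} => //= z p IH s /andP[sz pp].
rewrite inE => /predU1P[->|]; last exact: IH pp.
by apply/imsetP; exists (s, z); rewrite // inE.
Qed.

Lemma shorten_walk G s p : weights_in W G -> path (adj G) s p ->
  exists p', [/\ path (adj G) s p', last s p' = last s p & uniq (s :: p')].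
Proof. by move=> hG /shortenP[p' pp up _]; exists p'. Qed.

End Walks.

(** * Two-sided estimates of distances and their passage through time *)

Section Estimates.
Context {R : realType} (n : nat) (W inf : R) (G : wgraph R n) (us : seq (wedge R n)) (s : 'I_n).
Context (W1 : 1 <= W) (wG : weights_in W G) (iG : incremental_seq W G us).
Implicit Types (t : nat) (u v : 'I_n) (x y E : R).

(* Time 0 precedes the initial graph, and time t > 0 stands for version t - 1. *)
Definition vg t := version G us t.-1.

(** Here and in [tight], which bounds the distance from below up to the factor [E], everything is
    expressed by single walks: no infimum and no infinite distance appears until the answers are
    interpreted. A value from [inf] on means that no walk is claimed. *)
Definition sound t v x :=
  inf <= x \/ exists p, [/\ path (adj (vg t)) s p, last s p = v & walk_weight (vg t) s p <= x].

Definition tight E t v x :=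
  forall p, path (adj (vg t)) s p -> last s p = v -> x <= E * walk_weight (vg t) s p.

Lemma vg_weights t : weights_in W (vg t). Proof. exact: version_weights. Qed.

Lemma vg_dominates t t' : (t <= t')%N -> dominates (vg t') (vg t).
Proof. by move=> tt; apply: version_dominates iG _; lia. Qed.

(** Soundness passes to later times and, by [tight_mono], tightness to earlier ones. An estimate
    shared by both ends of an interval thus inherits one property from each end. *)
Lemma sound_mono t t' v x y : (t <= t')%N -> x <= y -> sound t v x -> sound t' v y.
Proof.
move=> tt xy [h|[p [pp lp wp]]]; first by left; exact: le_trans xy.
have [pp' wp'] := dominates_walk (vg_dominates tt) pp.
right; exists p; split=> //; exact: (le_trans wp' (le_trans wp xy)).
Qed.

Lemma sound_edge t u v w w' x : 0 <= x -> sound t u x -> vg t u v = Some w -> w <= w' ->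
  sound t v (x + w').
Proof.
move=> x0 sx ew ww'; have w0 : 0 <= w.
  by case: (vg_weights ew) => [->//|/andP[/(le_trans ler01)]].
have w0' := le_trans w0 ww'.
case: sx => [h|[p [pp lp wp]]]; first by left; rewrite (le_trans h) // lerDl.
right; exists (rcons p v); rewrite rcons_path pp lp /adj ew last_rcons; split=> //.
by rewrite walk_weight_rcons lp ew /= lerD.
Qed.

Lemma sound_source t x : 0 <= x -> sound t s x.
Proof. by move=> x0; right; exists [::]. Qed.

Lemma tight_mono E E' t t' v x y : 0 <= E -> (t <= t')%N -> y <= x -> E <= E' ->
  tight E t' v x -> tight E' t v y.
Proof.
move=> E0 tt yx EE ti p pp lp; have [pp' wp'] := dominates_walk (vg_dominates tt) pp.
apply: le_trans yx (le_trans (ti p pp' lp) _).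
by apply: ler_pM => //; apply: (walk_weight_ge0 _ _ (@vg_weights t')).
Qed.

Lemma tight_scale E c t v x : 0 <= c -> tight E t v x -> tight (c * E) t v (c * x).
Proof. by move=> c0 ti p pp lp; rewrite -mulrA ler_wpM2l // ti. Qed.

Lemma tight_le0 E t v x : 0 <= E -> x <= 0 -> tight E t v x.
Proof.
move=> E0 x0 p _ _; apply: le_trans x0 (mulr_ge0 E0 _).
exact: (walk_weight_ge0 _ _ (@vg_weights t)).
Qed.

(** [f] is a feasible potential for the weights multiplied by [E], except at vertices where the
    bound is already known. The induction follows a walk backwards from its end and stops at the
    first such vertex. *)
Lemma tight_potential E t (f : 'I_n -> R) : 0 <= E -> f s <= 0 ->
  (forall v, tight E t v (f v) \/
     forall u w, vg t u v = Some w -> f v <= f u + E * w) ->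
  forall v, tight E t v (f v).
Proof.
move=> E0 fs h v p; elim/last_ind: p v => [|p y IH] v pp lp; have [ti|ti] := h v.
- exact: ti.
- by rewrite -lp /= mulr0.
- exact: ti.
- move: pp lp; rewrite rcons_path last_rcons walk_weight_rcons => /andP[pp].
  rewrite /adj; case ew: (vg _ _ _) => [w|] // _ ey /=; subst y.
  by rewrite mulrDr; apply: le_trans (ti _ _ ew) _; rewrite lerD2r IH.
Qed.

End Estimates.

(** * Counting the drops of a geometrically decreasing sequence *)

Section Drops.
Context {R : realType} (q : R) (K : nat).
Context (q1 : 1 < q).

(** While the value is at least 1, c drops give [q ^+ c <= f 0 < q ^+ K], so c < K. The strict
    inequality leaves room for one drop to 0, after which nothing changes. *)
Lemma count_drops (f : nat -> R) N : f 0%N < q ^+ K ->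
  (forall i, (i <= N)%N -> f i = 0 \/ 1 <= f i) ->
  (forall i, (i < N)%N -> f i = f i.+1 \/ q * f i.+1 <= f i) ->
  (\sum_(i < N) (f i != f i.+1) <= K)%N.
Proof.
move=> f0 fv fs.
suff [_ ->//] : (1 <= f N -> q ^+ (\sum_(i < N) (f i != f i.+1)) * f N <= f 0%N) /\
    (\sum_(i < N) (f i != f i.+1) <= K)%N.
elim: N fv fs => [|N IH] fv fs; first by rewrite big_ord0 expr0 mul1r.
have [||i1 i2] := IH; [by move=> i hi; apply: fv; lia|by move=> i hi; apply: fs; lia|].
rewrite big_ord_recr /=; set c := (\sum_(_ < _) _)%N in i1 i2 *.
have [<-|ne] := eqVneq (f N) (f N.+1); first by rewrite addn0.
rewrite addn1; have [e|qle] := fs N (ltnSn N); first by rewrite e eqxx in ne.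
have lt_c k : q ^+ k <= f 0%N -> (k < K)%N.
  move=> h; rewrite ltnNge; apply/negP => kK; have := lt_le_trans f0 (ler_weXn2l (ltW q1) kK).
  by rewrite ltNge h.
have q0 : 0 < q by apply: lt_trans q1.
have [h1|h1] := fv N.+1 (leqnn _).
  split; first by rewrite h1 ler10.
  have [h2|h2] := fv N (leqnSn _); first by rewrite h1 h2 eqxx in ne.
  apply: lt_c; apply: le_trans (i1 h2); rewrite ler_peMr // exprn_ge0 //; exact: ltW.
have h2 : 1 <= f N by apply: le_trans qle; rewrite -[1]mulr1 ler_pM // ltW.
have h3 : q ^+ c.+1 * f N.+1 <= f 0%N.
  by rewrite exprSr -mulrA; apply: le_trans (i1 h2); rewrite ler_wpM2l // exprn_ge0 // ltW.
split=> //; apply: leq_trans (leqnSn _) _; apply: lt_c; apply: le_trans h3.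
by rewrite ler_peMr // exprn_ge0 // ltW.
Qed.

End Drops.

(** * Thinning the updates *)

Section Thinning.
Context {R : realType} (n : nat) (W q : R) (K : nat).
Context (W1 : 1 <= W) (q1 : 1 < q) (WK : W < q ^+ K).
Notation entry := (nat * ('I_n * 'I_n) * R)%type.
Implicit Types (G : wgraph R n) (u v : 'I_n) (El : seq ('I_n * 'I_n)) (kl : seq entry).

Definition kept kl u v : option R :=
  foldl (fun o e => if e.1.2 == (u, v) then Some e.2 else o) None kl.

Lemma kept_rcons kl t u v w u' v' :
  kept (rcons kl (t, (u, v), w)) u' v' =
  if (u' == u) && (v' == v) then Some w else kept kl u' v'.
Proof. by rewrite /kept foldl_rcons /= xpair_eqE [u == _]eq_sym [v == _]eq_sym. Qed.

Definition thins kl G := forall u v,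
  if G u v is Some w then exists2 w0, kept kl u v = Some w0 & w <= w0 <= q * w
  else kept kl u v = None.

Definition hits kl u v := count (fun e : entry => e.1.2 == (u, v)) kl.

Definition ev_step t (ek : seq ('I_n * 'I_n) * seq entry) (e : wedge R n) :=
  let: (El, kl) := ek in
  if e.1 \notin El then (rcons El e.1, rcons kl (t, e.1, e.2))
  else if odflt 0 (kept kl e.1.1 e.1.2) <= q * e.2 then (El, kl)
  else (El, rcons kl (t, e.1, e.2)).

(* Each kept entry of an edge is smaller than the previous one by a factor q, which
   bounds the number of entries of an edge. *)
Record ev_inv (t : nat) (ek : seq ('I_n * 'I_n) * seq entry) G : Prop := EvInv {
  ev_uniq : uniq ek.1;
  ev_adj : forall u v, ((u, v) \in ek.1) = adj G u v;
  ev_thin : thins ek.2 G;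
  ev_time : all (fun e => e.1.1 <= t)%N ek.2;
  ev_sort : sorted leq [seq e.1.1 | e <- ek.2];
  ev_hits : forall u v, (hits ek.2 u v <= K.+1)%N;
  ev_pow : forall u v w, kept ek.2 u v = Some w -> 1 <= w -> q ^+ (hits ek.2 u v).-1 * w <= W;
  ev_sub : all (fun e => e.1.2 \in ek.1) ek.2 }.

Lemma hits_rcons kl t u v w u' v' :
  hits (rcons kl (t, (u, v), w)) u' v' = (hits kl u' v' + ((u' == u) && (v' == v)))%N.
Proof. by rewrite /hits -cats1 count_cat /= addn0 xpair_eqE [u == _]eq_sym [v == _]eq_sym. Qed.

Lemma kept_hits0 kl u v : kept kl u v = None -> hits kl u v = 0%N.
Proof.
elim/last_ind: kl => // kl [[t [a b]] w] IH; rewrite kept_rcons hits_rcons.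
by case: ifP => // _ /IH ->.
Qed.

Lemma adj_update G e u v :
  adj (apply_update G e) u v = ((u, v) == e.1) || adj G u v.
Proof.
by rewrite /adj /apply_update; case: e => -[a b] w /=; rewrite xpair_eqE; case: ifP.
Qed.

Lemma sorted_rcons_leq (l : seq nat) t : sorted leq l -> all (fun x => x <= t)%N l ->
  sorted leq (rcons l t).
Proof.
case: l => //= x l; rewrite rcons_path => -> /= /andP[xt /allP h].
by have := mem_last x l; rewrite inE => /predU1P[->//|/h].
Qed.

(** A further entry of an edge is written only for a weight below the last one by more than a factor
    [q], which feeds [ev_pow]. This allows at most [K] entries of weight at least 1 and then one
    entry 0, hence the bound [K.+1]. *)
Lemma ev_step_inv t t' ek G e : (t <= t')%N -> e.2 = 0 \/ 1 <= e.2 <= W ->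
  incremental G e -> weights_in W G -> ev_inv t ek G ->
  ev_inv t' (ev_step t' ek e) (apply_update G e).
Proof.
case: ek => El kl; case: e => -[a b] w tt /= hw inc wG [/= i1 i2 i3 i4 i5 i6 i7 i8].
have q0 : 0 < q := lt_trans ltr01 q1.
have w0 : 0 <= w by case: hw => [->//|/andP[/(le_trans ler01)]].
have i4' : all (fun e : entry => e.1.1 <= t')%N kl.
  by apply: sub_all i4 => x; move/leq_trans; apply.
have keepP El' : (kept kl a b = None) \/ (exists2 w1, kept kl a b = Some w1 & q * w < w1) ->
    uniq El' -> {subset El <= El'} -> (a, b) \in El' ->
    (forall u v, ((u, v) \in El') = adj (apply_update G (a, b, w)) u v) ->
    ev_inv t' (El', rcons kl (t', (a, b), w)) (apply_update G (a, b, w)).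
  move=> hk u' s' ab' m'; split=> //=.
  - move=> u v; rewrite kept_rcons /apply_update /=.
    case: ifP => _; last exact: i3.
    by exists w => //; rewrite lexx /= ler_peMl // ltW.
  - by rewrite all_rcons /= leqnn.
  - by rewrite map_rcons; apply: sorted_rcons_leq => //; rewrite all_map.
  - move=> u v; rewrite hits_rcons; case: eqP => [->|_] /=; last by rewrite addn0.
    case: eqP => [->|_] /=; last by rewrite addn0.
    case: hk => [/kept_hits0 -> //|[w1 kw1 qw]]; rewrite addn1 ltnS.
    (* The last entry [w1] is positive, being above [q * w]. It is at most [q] times the current
       weight, which is therefore not 0, hence at least 1, and it is not below that weight. *)
    have w11 : 1 <= w1.
      have [gw|] := boolP (adj G a b); last first.
        by move: (i3 a b); rewrite /adj kw1; case: (G a b).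
      have := i3 a b; move: gw; rewrite /adj; case ew: (G a b) => [g|] // _.
      rewrite kw1 => -[w2 [<-] /andP[l1 l2]].
      have w1p : 0 < w1 by apply: le_lt_trans qw; rewrite mulr_ge0 // ltW.
      case: (wG _ _ _ ew) => [g0|/andP[/le_trans->//]].
      by move: l2; rewrite g0 mulr0 leNgt w1p.
    have h := i7 a b w1 kw1 w11.
    have : q ^+ (hits kl a b).-1 < q ^+ K.
      apply: le_lt_trans WK; apply: le_trans h; rewrite ler_peMr // exprn_ge0 //; exact: ltW.
    by rewrite ltr_eXn2l //; case: (hits kl a b).
  - move=> u v w'; rewrite kept_rcons hits_rcons.
    case: eqP => [->|_] /=; last by rewrite addn0; exact: i7.
    case: eqP => [->|_] /=; last by rewrite addn0; exact: i7.
    case=> <- wge1; rewrite addn1 /=.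
    case: hk => [/kept_hits0 ->|[w1 kw1 qw]].
      by rewrite expr0 mul1r; case: hw => [w00|/andP[]//]; move: wge1; rewrite w00 ler10.
    have w11 : 1 <= w1.
      by apply: ltW; apply: le_lt_trans qw; rewrite -[1]mulr1 ler_pM // ltW.
    have h := i7 a b w1 kw1 w11; apply: le_trans h.
    case e: (hits kl a b) => [|k].
      have : hits kl a b = 0%N -> kept kl a b = None.
        rewrite /hits /kept; elim/last_ind: (kl) => // l x IH.
        rewrite -cats1 count_cat foldl_cat /= addn0.
        by case: ifP => //= _ /eqP; rewrite addn_eq0 // => /andP[/eqP/IH].
      by move=> /(_ e); rewrite kw1.
    rewrite exprSr /= -mulrA ler_wpM2l ?exprn_ge0 //; exact: ltW.
  - by rewrite all_rcons /= ab' /=; apply: sub_all i8 => x /s'.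
have gab := i3 a b; rewrite /ev_step /=.
case: ifPn => [nab|]; last rewrite negbK => ab.
  apply: keepP.
  - by left; move: nab; rewrite i2 /adj; move: gab; case: (G a b).
  - by rewrite rcons_uniq nab.
  - by move=> x; rewrite mem_rcons inE => ->; rewrite orbT.
  - by rewrite mem_rcons mem_head.
  - by move=> u v; rewrite adj_update mem_rcons inE i2.
have mEl u v : ((u, v) \in El) = adj (apply_update G (a, b, w)) u v.
  by rewrite adj_update /= -i2; case: eqP => // ->.
move: (ab); rewrite i2 /adj; case eg: (G a b) gab => [g|] // [g0 kg0 /andP[l1 l2]] _.
rewrite kg0 /=; case: leP => [le|lt]; last first.
  by apply: keepP => //; right; exists g0.
split=> //= u v; rewrite /apply_update /=; case: ifP => [/andP[/eqP -> /eqP ->]|_]; last exact: i3.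
exists g0 => //; rewrite le andbT; apply: le_trans l1.
by move: inc; rewrite /incremental /= eg => /ltW.
Qed.

Lemma size_kept t ek G : ev_inv t ek G -> (size ek.2 <= size ek.1 * K.+1)%N.
Proof.
case: ek => El kl [/= i1 _ _ _ _ i6 _ i8].
suff -> : size kl = (\sum_(p <- El) hits kl p.1 p.2)%N.
  rewrite -sum_seq_const; apply: leq_sum => p _; exact: i6.
elim: kl {i6} i8 => [|e kl IH] /= => [_|/andP[eE /IH ->]].
  by rewrite big1 // => -[].
rewrite /hits /= big_split /= -/hits; rewrite -add1n; congr (_ + _)%N.
rewrite (bigD1_seq e.1.2) //= -surjective_pairing eqxx big1 // => p pe.
by rewrite -surjective_pairing eq_sym (negbTE pe).
Qed.

End Thinning.
(** * Refining the time intervals *)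

Section Snap.
Context {R : realType} (q : R) (q1 : 1 < q).

(* Estimates are only raised, by a factor of at most q * q, and so that the values
   da >= dm >= db of two adjacent half intervals are equal or differ by a factor q. *)
Definition snap_up (da db c : R) :=
  let c1 := if c <= db then db else c in
  if da <= q * q * c1 then da else q * c1.

(** If [da] exceeds [q * q * c1], the value [q * c1] is a factor [q] below [da] and a factor [q]
    above [db <= c1]; otherwise [da] itself is within [q * q] of [c1]. The need for room on both
    sides explains the square. *)
Lemma snap_upP da db c : 0 <= db -> q * db <= da ->
  let dm := snap_up da db c in let c1 := Num.max c db in
  [/\ db <= dm <= da, da = dm \/ q * dm <= da, dm = db \/ q * db <= dm,
      dm = da \/ dm = q * c1 & dm <= q * q * c1].
Proof.
move=> db0 qda; rewrite /snap_up /=.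
have q0 : 0 < q := lt_trans ltr01 q1.
have -> : (if c <= db then db else c) = Num.max c db by case: leP.
set c1 := Num.max c db; have c1b : db <= c1 by rewrite le_max lexx orbT.
have qx x : 0 <= x -> x <= q * x by move=> x0; rewrite ler_peMl // ltW.
have c10 : 0 <= c1 := le_trans db0 c1b.
have [le|lt] := leP da (q * q * c1).
  split; rewrite ?lexx ?andbT //.
  - by apply: le_trans qda; exact: qx.
  - by left.
  - by right.
  - by left.
have qq : q * c1 <= da by apply: le_trans (ltW lt); rewrite -mulrA ler_wpM2l ?qx // ltW.
split.
- by rewrite qq (le_trans c1b) ?qx.
- by right; rewrite mulrA ltW.
- by right; rewrite ler_wpM2l // ltW.
- by right.
- by rewrite -mulrA qx // mulr_ge0 // ltW.
Qed.

End Snap.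

Lemma sorted_filter_take (T : Type) (f : T -> nat) (l : seq T) t :
  sorted leq (map f l) ->
  [seq e <- l | (f e <= t)%N] = take (count (fun e => f e <= t)%N l) l.
Proof.
elim: l => //= e l IH; rewrite path_sortedE; last exact: leq_trans.
case/andP=> /allP al sl; case: ifP => [_|/negbT h]; first by rewrite add1n /= IH.
have z : count (fun e => f e <= t)%N l = 0%N.
  elim: l al {IH sl} => //= e' l IH al; rewrite IH ?addn0; last first.
    by move=> x xl; apply: al; rewrite inE xl orbT.
  by have := al (f e'); rewrite mem_head => /(_ isT); lia.
by rewrite z take0; apply: size0nil; rewrite size_filter.
Qed.

Lemma sorted_count_lt (T : Type) (f : T -> nat) (x0 : T) (l : seq T) t j :
  sorted leq (map f l) -> (j < size l)%N ->
  (f (nth x0 l j) <= t)%N = (j < count (fun e => f e <= t)%N l)%N.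
Proof.
elim: l j => //= e l IH j; rewrite path_sortedE; last exact: leq_trans.
case/andP=> /allP al sl; case: j => [|j] lj /=.
  case h: (f e <= t)%N => //=; symmetry; apply/negbTE; rewrite -leqNgt leqn0 add0n.
  elim: l al {IH sl lj} => //= e' l IH al; rewrite addn_eq0 IH ?andbT; last first.
    by move=> x xl; apply: al; rewrite inE xl orbT.
  by have := al (f e'); rewrite mem_head => /(_ isT); lia.
rewrite IH //; case h: (f e <= t)%N => /=; first by rewrite add1n.
suff -> : count (fun e => f e <= t)%N l = 0%N by [].
elim: l al {IH sl lj} => //= e' l IH al; rewrite IH ?addn0; last first.
  by move=> x xl; apply: al; rewrite inE xl orbT.
by have := al (f e'); rewrite mem_head => /(_ isT); lia.
Qed.

(** * One level of the recursion: current weights, intervals, refinement *)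

Section Level.
Context {R : realType} (B n H lgn : nat) (W inf big q : R) (G : wgraph R n).
Context (us : seq (wedge R n)) (s : 'I_n) (El : seq ('I_n * 'I_n)).
Context (kl : seq (nat * ('I_n * 'I_n) * R)).
Context (W1 : 1 <= W) (wG : weights_in W G) (iG : incremental_seq W G us).
Context (hB : (4 * (H + 1) * (n + 1) * (n + 1) < B)%N) (hlg : (n <= 2 ^ lgn)%N).
Context (q1 : 1 < q) (infW : W <= inf) (inf_big : inf < big).
Implicit Types (st : state R) (u v x : 'I_n) (t g h a : nat).

Definition outs u := [seq e.2 | e <- El & e.1 == u].
Definition ins v := [seq e.1 | e <- El & e.2 == v].

Context (uEl : uniq El).
Context (mEl : forall t u v, (0 < t < H)%N -> adj (vg G us t) u v -> (u, v) \in El).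
Context (skl : sorted leq [seq e.1.1 | e <- kl]).
Context (tkl : forall t, (0 < t < H)%N ->
  thins q [seq e <- kl | (e.1.1 <= t)%N] (vg G us t)).
Context (zkl : forall e, e \in kl -> e.2 = 0 \/ 1 <= e.2).

Lemma mem_outs u v : (v \in outs u) = ((u, v) \in El).
Proof.
apply/mapP/idP => [[[a b]]|uv]; last by exists (u, v) => //; rewrite mem_filter eqxx.
by rewrite mem_filter /= => /andP[/eqP -> ?] ->.
Qed.

Lemma mem_ins u v : (u \in ins v) = ((u, v) \in El).
Proof.
apply/mapP/idP => [[[a b]]|uv]; last by exists (u, v) => //; rewrite mem_filter eqxx.
by rewrite mem_filter /= => /andP[/eqP -> ?] ->.
Qed.

Lemma outs_ins u v : (v \in outs u) = (u \in ins v).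
Proof. by rewrite mem_outs mem_ins. Qed.

Lemma uniq_outs u : uniq (outs u).
Proof.
rewrite map_inj_in_uniq ?filter_uniq // => -[a b] [c d].
by rewrite !mem_filter /= => /andP[/eqP -> _] /andP[/eqP -> _] ->.
Qed.

Lemma uniq_ins v : uniq (ins v).
Proof.
rewrite map_inj_in_uniq ?filter_uniq // => -[a b] [c d].
by rewrite !mem_filter /= => /andP[/eqP -> _] /andP[/eqP -> _] ->.
Qed.

Lemma size_El : (size El <= n * n)%N.
Proof.
by move/card_uniqP: uEl => <-; apply: leq_trans (max_card _) _; rewrite card_prod card_ord.
Qed.

Lemma ix_bound t k : (t <= H)%N -> (k <= n)%N -> (t * n + k < B)%N.
Proof.
move=> tH kn; apply: (B_bound hB).
by have := leq_mul tH (leqnn n); nlia.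
Qed.

Lemma ix_bound0 t : (t <= H)%N -> (t * n < B)%N.
Proof. by move=> tH; rewrite -[(t * n)%N]addn0 ix_bound. Qed.

Definition entry0 : nat * ('I_n * 'I_n) * R := (0%N, (s, s), 0).

Record base st : Prop := Base {
  b_gm : graph_mem outs ins st;
  b_H : ireg st xH = H;
  b_S : ireg st xS = s;
  b_M : ireg st xM = size El;
  b_Kc : ireg st xKc = size kl;
  b_q : rreg st yQ = q;
  b_inf : rreg st yInf = inf;
  b_big : rreg st yBig = big;
  b_et : forall i, (i < size El)%N -> iarr st aET i = (nth (s, s) El i).1;
  b_eh : forall i, (i < size El)%N -> iarr st aEH i = (nth (s, s) El i).2;
  b_kl : forall j, (j < size kl)%N -> let e := nth entry0 kl j in
    [/\ iarr st aKE j = (e.1.2.1 * n + e.1.2.2)%N, iarr st aKT j = e.1.1 &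
        rarr st bKW j = e.2] }.

Lemma base_frame c st st' : frame c st st' ->
  [&& all (fun y => y \notin wir c) [:: xN; xH; xS; xM; xKc],
      all (fun y => y \notin wrr c) [:: yQ; yInf; yBig],
      all (fun a => a \notin wia c) [:: aOd; aOut; aId; aIn; aET; aEH; aKE; aKT] &
      bKW \notin wra c] ->
  base st -> base st'.
Proof.
move=> fr /and4P[/and5P[h1 h2 h3 h4 /andP[h5 _]] /and4P[h6 h7 h8 _] h9 h10].
case/and5P: h9 => h11 h12 h13 h14 /and5P[h15 h16 h17 h18 _].
case=> *; split; rewrite ?(frI fr) ?(frR fr) // => *;
  rewrite ?(frIA fr) ?(frRA fr) //; last by auto.
by apply: graph_mem_frame fr _ _ => //; rewrite h1 /= h11 h12 h13 h14.
all: by auto.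
Qed.

(** The default [inf] covers the edges that appear only at a later time. *)
Definition edge_weight l u v := odflt inf (kept l u v).
Definition upto t := [seq e <- kl | (e.1.1 <= t)%N].
Definition nupto t := count (fun e => e.1.1 <= t)%N kl.

(** The events up to a given time form a prefix of [kl], so a single pointer moving to the right
    keeps the weights current. *)
Lemma upto_take t : upto t = take (nupto t) kl.
Proof. exact: (@sorted_filter_take _ (fun e => e.1.1)). Qed.

Lemma nupto_mono t t' : (t <= t')%N -> (nupto t <= nupto t')%N.
Proof. by move=> tt; apply: sub_count => e /leq_trans; apply. Qed.

(** The cost is charged to the events passed over; along a level these charges telescope to at most
    [3 * size kl]. *)
Lemma advance_run st t0 t : base st -> ireg st xP = nupto t0 -> (t0 <= t)%N ->
  ireg st xMid = t -> wt_mem outs (edge_weight (upto t0)) st ->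
  run B advance st (3 * (nupto t - nupto t0)).+1 (fun st' =>
    ireg st' xP = nupto t /\ wt_mem outs (edge_weight (upto t)) st').
Proof.
move=> bs ep tt em wm.
have sz : (nupto t <= size kl)%N by exact: count_size.
apply: (@run_while _ _ _ _ (fun c st' => exists p, [/\ ireg st' xP = p,
  (nupto t0 <= p <= nupto t)%N, c = (3 * (nupto t - p))%N &
  wt_mem outs (edge_weight (take p kl)) st'])).
- move=> c st' fr [p [ep' hp -> wm']]; split=> //=.
  have bs' := base_frame fr isT bs.
  rewrite (b_Kc bs') ep' -ltnNge (frI fr) // em.
  (* A conjunction evaluates both of its sides, so [aKT] is also read past the end of the list;
     whatever is found there, the test is then false. *)
  have hlt : (p < size kl)%N && (iarr st' 12 p <= t)%N = (p < nupto t)%N.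
    have [lt|ge] := ltnP p (size kl) => /=; last by nlia.
    have [_ -> _] := b_kl bs' lt.
    exact: (@sorted_count_lt _ (fun e => e.1.1)).
  rewrite hlt; case: ltnP => h.
    have lt : (p < size kl)%N by nlia.
    have [e1 _ e3] := b_kl bs' lt; rewrite /= in e1 e3.
    exists 2%N; first by nlia.
    (* [size kl] is held in a register, so it is a word and the pointer can be incremented. *)
    apply: run_wsafe => ws; have kb := ws.1 xKc; rewrite (b_Kc bs') in kb.
    apply: (@run_seq _ _ _ _ _ 1 1); xs => //; rewrite /incr; xs => /=.
      by split=> //; rewrite ?ep'; nlia.
    rewrite ep' e1 e3; exists (3 * (nupto t - p.+1))%N; first by nlia.
    exists p.+1; rewrite addn1; split=> //; first by nlia.
    move=> u v uv; rewrite /= ix_eq // !val_eqE (take_nth entry0) // /edge_weight.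
    case: (nth entry0 kl p) => -[t' [a b]] w /=; rewrite kept_rcons.
    by case: ifP => // _; rewrite wm'.
  have pe : nupto t = p by nlia.
  by split=> [|u v uv]; rewrite ?upto_take pe //; exact: wm'.
- by exists (nupto t0); split=> //; rewrite ?leqnn ?nupto_mono // -?upto_take.
Qed.

Section SnapGroup.
Context (vs : seq 'I_n) (a b m : nat) (da db kf : 'I_n -> R).
Context (uvs : uniq vs) (hamb : (a < m < b)%N) (bH : (b <= H)%N).

Let dm v := snap_up q (da v) (db v) (kf v).
Let f1 l := [seq v <- l | da v != dm v].
Let f2 l := [seq v <- l | dm v != db v].

Context (dmP : forall v, v \in vs -> db v <= dm v <= da v).

Lemma snap_run st : ireg st xN = n -> rreg st yQ = q -> ireg st xA = a -> ireg st xB = b ->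
  ireg st xMid = m -> ireg st xO = (a * n)%N -> ireg st xR = size vs ->
  (forall k, (k < size vs)%N -> iarr st aAL (a * n + k)%N = nth s vs k) ->
  (forall v, rarr st bKey v = if v \in vs then kf v else 0) ->
  (forall v, v \in vs -> rarr st bD (a * n + v)%N = da v /\ rarr st bD (b * n + v)%N = db v) ->
  run B snap st (size vs * 22 + 10) (fun st' =>
    [/\ forall v, rarr st' bKey v = 0,
        forall v, rarr st' bCur v = if v \in vs then db v else rarr st bCur v,
        forall t v, rarr st' bD (t * n + v)%N =
          if (t == m) && (v \in vs) then dm v else rarr st bD (t * n + v)%N,
        forall t, iarr st' aCN t = if t == a then size (f1 vs) else
          if t == m then size (f2 vs) else iarr st aCN t &
        [/\ forall k, (k < size (f1 vs))%N -> iarr st' aAL (a * n + k)%N = nth s (f1 vs) k,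
            forall k, (k < size (f2 vs))%N -> iarr st' aAL (m * n + k)%N = nth s (f2 vs) k &
            forall t k, t != a -> t != m -> (k < n)%N ->
              iarr st' aAL (t * n + k)%N = iarr st aAL (t * n + k)%N]]).
Proof.
move=> en eq ea eb em eo er eal ek ed.
have rn := uniq_size_ord uvs.
have bnd := ix_bound.
rewrite /snap; apply: (@run_time _ _ _ _ (1 + (1 + ((size vs * (20 + 2) + 2) + (1 + 1))))%N); last by nlia.
have B2 : (2 < B)%N by apply: (B_bound hB); nlia.
xs; xs; first by rewrite /=; nlia.
xs; xs; first by rewrite /=; nlia.
xs.
apply: (@run_for_const _ _ _ _ _ _ _ 20 (fun j st' =>
  [/\ forall v, rarr st' bKey v = if v \in drop j vs then kf v else 0,
      forall v, rarr st' bCur v = if v \in take j vs then db v else rarr st bCur v,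
      forall t v, rarr st' bD (t * n + v)%N =
        if (t == m) && (v \in take j vs) then dm v else rarr st bD (t * n + v)%N,
      ireg st' xK1 = size (f1 (take j vs)) /\ ireg st' xK2 = size (f2 (take j vs)) &
      [/\ forall k, (k < size (f1 (take j vs)))%N ->
             iarr st' aAL (a * n + k)%N = nth s (f1 (take j vs)) k,
          forall k, (k < size (f2 (take j vs)))%N ->
             iarr st' aAL (m * n + k)%N = nth s (f2 (take j vs)) k,
          forall k, (j <= k < size vs)%N -> iarr st' aAL (a * n + k)%N = nth s vs k &
          forall t k, t != a -> t != m -> (k < n)%N ->
              iarr st' aAL (t * n + k)%N = iarr st aAL (t * n + k)%N]])) => //.
- by nlia.
- rewrite take0 drop0; split=> //= t v; by rewrite andbF.
- move=> j st1 fr ej er1 lt [i1 i2 i3 [i4 i5] [i6 i7 i8 i9]].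
  have en1 : ireg st1 xN = n by rewrite (frI fr).
  have eq1 : rreg st1 yQ = q by rewrite (frR fr).
  have ea1 : ireg st1 xA = a by rewrite (frI fr).
  have eb1 : ireg st1 xB = b by rewrite (frI fr).
  have em1 : ireg st1 xMid = m by rewrite (frI fr).
  have eo1 : ireg st1 xO = (a * n)%N by rewrite (frI fr).
  set v := nth s vs j.
  have vv : v \in vs by exact: mem_nth.
  have vn := ltn_ord v.
  have dropj : drop j vs = v :: drop j.+1 vs by rewrite /v -drop_nth.
  have takej : take j.+1 vs = rcons (take j vs) v by rewrite -take_nth.
  have vj : v \notin take j vs.
    by move: (take_uniq j.+1 uvs); rewrite takej rcons_uniq => /andP[].
  have vd : v \notin drop j.+1 vs.
    by move: (drop_uniq j uvs); rewrite dropj => /andP[].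
  (* The left list is written over the row that is being read: having at most [j] entries so far, it
     does not reach those still to be read. *)
  have sf1 : (size (f1 (take j vs)) <= j)%N.
    by rewrite size_filter; apply: leq_trans (count_size _ _) _; rewrite size_take lt.
  have sf2 : (size (f2 (take j vs)) <= j)%N.
    by rewrite size_filter; apply: leq_trans (count_size _ _) _; rewrite size_take lt.
  have [dmb dma] : db v <= dm v /\ dm v <= da v by apply/andP/dmP.
  apply: (@run_time _ _ _ _ (1 + (1 + (1 + (1 + (1 + (1 + ((maxn 1 1).+1 + ((maxn 1 1).+1 + (1 +
    ((maxn 1 (1 + 1)).+1 + (maxn 1 (1 + 1)).+1))))))))))%N); last by [].
  rewrite /snap1.
  xs; xs; first by rewrite /= eo1 ej; split=> //; apply: bnd; nlia.
  rewrite /= eo1 ej i8 ?leqnn // -/v.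
  xs; xs => //; rewrite /= i1 dropj mem_head.
  xs; xs => //; rewrite /=.
  xs; xs; first by rewrite /= eb1 en1; repeat split=> //; first [apply: ix_bound0|apply: bnd]; nlia.
  rewrite /= eb1 en1 i3 (_ : (b == m) = false) /=; last by nlia.
  rewrite (ed _ vv).2.
  xs; xs => //; rewrite /=.
  xs; xs; first by rewrite /= ea1 en1; repeat split=> //; first [apply: ix_bound0|apply: bnd]; nlia.
  rewrite /= ea1 en1 i3 (_ : (a == m) = false) /=; last by nlia.
  rewrite (ed _ vv).1.
have q0 : 0 <= q by apply: ltW; exact: lt_trans q1.
  pose c1 := if kf v <= db v then db v else kf v.
  set st2 := set_rreg _ yZ _.
  xs; apply: run_then (_ : run B _ st2 (maxn 1 1).+1 (fun st3 => rreg st3 yX = c1)) _.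
    by apply: run_if => //= h; xs => //=; rewrite /c1 ?h ?(negbTE h).
  move=> st3 [fr3 x3]; have y3 : rreg st3 yY = db v by rewrite (frR fr3).
  have z3 : rreg st3 yZ = da v by rewrite (frR fr3).
  have q3 : rreg st3 yQ = q by rewrite (frR fr3).
  xs; apply: run_then (_ : run B _ st3 (maxn 1 1).+1 (fun st4 => rreg st4 yX = dm v)) _.
    apply: run_if => //=; rewrite z3 q3 x3 => h; xs => //=; rewrite ?z3 ?q3 ?x3 /dm /snap_up -/c1.
      by rewrite h.
    by rewrite (negbTE h).
  move=> st4 [fr4 x4].
  have y4 : rreg st4 yY = db v by rewrite (frR fr4).
  have z4 : rreg st4 yZ = da v by rewrite (frR fr4).
  have iE (x : nat) : ireg st4 x = ireg st2 x by rewrite (frI fr4) // (frI fr3).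
  have aE (x : nat) : iarr st4 x = iarr st1 x by rewrite (frIA fr4) // (frIA fr3).
  have rE (x : nat) : rarr st4 x = rarr st2 x by rewrite (frRA fr4) // (frRA fr3).
  xs; xs => //=; first by rewrite !iE /= em1 en1; repeat split=> //; first [apply: ix_bound0|apply: bnd]; nlia.
  rewrite !iE /= em1 en1 x4.
  set st5 := set_rarr _ _ _ _.
  have eN : size (f1 (take j.+1 vs)) = (size (f1 (take j vs)) + (da v != dm v))%N.
    by rewrite takej /f1 filter_rcons; case: ifP => _; rewrite ?size_rcons ?addn0 ?addn1.
  have eN2 : size (f2 (take j.+1 vs)) = (size (f2 (take j vs)) + (dm v != db v))%N.
    by rewrite takej /f2 filter_rcons; case: ifP => _; rewrite ?size_rcons ?addn0 ?addn1.
  have mna : m != a by nlia.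
  have anm : a != m by nlia.
  have sn1 : (size (f1 (take j vs)) < n)%N by nlia.
  have sn2 : (size (f2 (take j vs)) < n)%N by nlia.
  have b1 : (a * n + size (f1 (take j vs)) < B)%N by apply: bnd; nlia.
  have b2 : (m * n + size (f2 (take j vs)) < B)%N by apply: bnd; nlia.
  have b3 : (size vs + 2 < B)%N by apply: (B_bound hB); nlia.
  have b4 : (m * n < B)%N by apply: ix_bound0; nlia.
  (* Because [db <= dm <= da], the comparisons of the program decide equality. *)
  have p1 : ~~ (da v <= dm v) = (da v != dm v).
    by rewrite eq_le dma andbT.
  have p2 : ~~ (dm v <= db v) = (dm v != db v).
    by rewrite eq_le dmb andbT.
  xs; apply: run_then (_ : run B _ st5 (maxn 1 (1 + 1)).+1 (fun st6 =>
    [/\ ireg st6 xK1 = size (f1 (take j.+1 vs)),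
        forall k, (k < size (f1 (take j.+1 vs)))%N ->
             iarr st6 aAL (a * n + k)%N = nth s (f1 (take j.+1 vs)) k,
        forall k, (j < k < size vs)%N -> iarr st6 aAL (a * n + k)%N = nth s vs k &
        forall t k, t != a -> (k < n)%N -> iarr st6 aAL (t * n + k)%N = iarr st1 aAL (t * n + k)%N])) _.
    apply: run_if => //=; rewrite z4 x4 => h.
      xs; rewrite /= iE /= i4 aE eN.
      have -> : (da v != dm v) = false by rewrite -p1 h.
      rewrite addn0 takej /f1 filter_rcons -p1 h /=; split=> //.
      by move=> k hk; apply: i8; nlia.
    xs; xs => //=; first by rewrite !iE /= eo1 i4.
    rewrite !iE /= eo1 i4; rewrite /incr; xs => /=.
      by rewrite ?iE /= ?i4; repeat split=> //; nlia.
    rewrite ?iE /= ?i4 ?aE eN; rewrite p1 in h; rewrite h.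
    split=> //.
    + move=> k; rewrite addn1 ltnS => hk.
      rewrite eqn_add2l takej /f1 filter_rcons h nth_rcons.
      case: ltngtP hk => // hk _; first by rewrite i6.
    + move=> k hk; rewrite eqn_add2l.
      have /negbTE -> : k != size (f1 (take j vs)) by nlia.
      by rewrite i8 //; nlia.
    + by move=> t k ta kn; rewrite (ix_eq _ _ kn sn1) (negbTE ta).
  move=> st6 [fr6 [k6 l6 m6 n6]].
  have x6 : rreg st6 yX = dm v by rewrite (frR fr6).
  have y6 : rreg st6 yY = db v by rewrite (frR fr6).
  have iE6 (x : nat) : x \notin [:: xK1] -> ireg st6 x = ireg st2 x.
    by move=> hx; rewrite (frI fr6) //= iE.
  apply: run_then (_ : run B _ st6 (maxn 1 (1 + 1)).+1 (fun st7 =>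
    [/\ ireg st7 xK2 = size (f2 (take j.+1 vs)),
        forall k, (k < size (f2 (take j.+1 vs)))%N ->
             iarr st7 aAL (m * n + k)%N = nth s (f2 (take j.+1 vs)) k &
        forall t k, t != m -> (k < n)%N -> iarr st7 aAL (t * n + k)%N = iarr st6 aAL (t * n + k)%N])) _.
    apply: run_if => //=; rewrite y6 x6 => h.
      xs; rewrite /= iE6 //= i5 eN2.
      have -> : (dm v != db v) = false by rewrite -p2 h.
      rewrite addn0 takej /f2 filter_rcons -p2 h /=; split=> // k hk.
      by rewrite n6 // ?i7 //; exact: ltn_trans hk sn2.
    xs; xs => //=; first by rewrite !iE6 //= em1 en1 i5.
    rewrite !iE6 //= em1 en1 i5; rewrite /incr; xs => /=.
      by rewrite ?iE6 //= ?i5; repeat split=> //; nlia.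
    rewrite ?iE6 //= ?i5 eN2; rewrite p2 in h; rewrite h.
    split=> //.
    + move=> k; rewrite addn1 ltnS => hk.
      rewrite eqn_add2l takej /f2 filter_rcons h nth_rcons.
      case: ltngtP hk => // hk _; by rewrite n6 // ?i7 //; exact: ltn_trans hk sn2.
    + by move=> t k ta kn; rewrite (ix_eq _ _ kn sn2) (negbTE ta).
  move=> st7 [fr7 [k7 l7 m7]].
  have rE7 (x : nat) : rarr st7 x = rarr st5 x by rewrite (frRA fr7) // (frRA fr6).
  split=> /=.
  + move=> u; rewrite rE7 /= rE /= val_eqE i1 dropj inE.
    by case: eqP => [->|//]; rewrite (negbTE vd).
  + move=> u; rewrite rE7 /= rE /= val_eqE i2 takej mem_rcons inE.
    by case: eqP => [->|//].
  + move=> t u; rewrite rE7 /= rE /= ix_eq // val_eqE i3 takej mem_rcons inE.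
    by case: eqP => //= _; case: eqP => [->|//].
  + by rewrite k7 (frI fr7).
  + split.
    * move=> k hk; rewrite m7 ?l6 //; apply: leq_trans hk _.
      by rewrite eN; nlia.
    * exact: l7.
    * by move=> k hk; rewrite m7 // ?m6 //; nlia.
    * by move=> t k ta tm kn; rewrite m7 // n6 // i9.
- move=> st1 fr [i1 i2 i3 [i4 i5] [i6 i7 i8 i9]].
  rewrite take_size drop_size in i1 i2 i3 i4 i5 i6 i7.
  xs; xs => //=; xs => //=.
  have -> : ireg st1 xA = a by rewrite (frI fr).
  have -> : ireg st1 xMid = m by rewrite (frI fr).
  rewrite i4 i5; split=> //.
  move=> t; rewrite (frIA fr) //=; case: eqP => [->|_]; last by [].
  by have /negbTE -> : m != a by nlia.
Qed.
End SnapGroup.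

Lemma inf1 : 1 <= inf. Proof using W1 infW. exact: le_trans infW. Qed.

Lemma kept_mem (l : seq (nat * ('I_n * 'I_n) * R)) u v w :
  kept l u v = Some w -> exists2 e, e \in l & e.2 = w.
Proof.
elim/last_ind: l => // l [[t [a b]] w'] IH; rewrite kept_rcons; case: ifP => _.
  by case=> <-; exists (t, (a, b), w'); rewrite ?mem_rcons ?mem_head.
by case/IH=> e el ee; exists e => //; rewrite mem_rcons inE el orbT.
Qed.

Lemma edge_weight_val t u v : edge_weight (upto t) u v = 0 \/ 1 <= edge_weight (upto t) u v.
Proof using zkl W1 infW.
rewrite /edge_weight; case e: (kept _ u v) => [w|] /=; last by right; exact: inf1.
by have [x] := kept_mem e; rewrite mem_filter => /andP[_ /zkl] h <-.
Qed.

Lemma edge_weight_ge0 t u v : 0 <= edge_weight (upto t) u v.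
Proof using zkl W1 infW. by case: (edge_weight_val t u v) => [->//|]; exact: le_trans. Qed.

(* Nothing is claimed about the soundness of the estimates at time H, where they are 0. *)
Definition point E t (D : nat -> 'I_n -> R) := forall v,
  [/\ (t < H)%N -> sound inf G us s t v (D t v), (0 < t)%N -> tight G us s E t v (D t v),
      D t v = 0 \/ 1 <= D t v & v = s -> D t v = 0].

Definition drop_ok t t' (D : nat -> 'I_n -> R) := forall v,
  D t v = D t' v \/ q * D t' v <= D t v.

(** * Error analysis of one interval *)

Section IntervalMath.
Context (E : R) (D : nat -> 'I_n -> R) (a m b : nat) (vs : seq 'I_n) (kf : 'I_n -> R).
Context (qE : q <= E) (hamb : (a < m < b)%N) (bH : (b <= H)%N).
Context (pa : point E a D) (pb : point E b D) (dab : drop_ok a b D).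
Context (mvs : forall v, (v \in vs) = (D a v != D b v)).

(** This takes the place of [P] in [dijkstra_run]. That values are 0 or at least 1 will be needed to
    count drops. *)
Definition key_inv v (x : R) := sound inf G us s m v x /\ (x = 0 \/ 1 <= x).

Lemma D_ge0 t E' v : point E' t D -> 0 <= D t v.
Proof. by move=> /(_ v)[_ _ [->//|h] _]; exact: le_trans h. Qed.

Lemma key_inv_inf v : key_inv v inf.
Proof using W1 infW. by split; [left|right; exact: inf1]. Qed.

Lemma key_inv_cur v : key_inv v (D a v).
Proof using W1 iG hamb bH pa.
have [sa _ va _] := pa v; split=> //.
by apply: (sound_mono W1 iG _ _ (sa _)) => //; clear -hamb bH; lia.
Qed.

(** Recorded weights are never below the true ones, so a walk still certifies the sum; an absent
    edge contributes [inf], and then no walk is claimed. *)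
Lemma key_inv_edge u v (x : R) : v \in outs u -> key_inv u x -> key_inv v (x + edge_weight (upto m) u v).
Proof using W1 wG iG infW tkl zkl hamb bH.
move=> _ [sx vx]; have x0 : 0 <= x by case: vx => [->//|]; exact: le_trans.
have w0 := edge_weight_ge0 m u v.
split; last first.
  case: vx => [->|vx]; first by rewrite add0r; exact: edge_weight_val.
  by right; apply: le_trans vx _; rewrite lerDl.
have hm : (0 < m < H)%N by clear -hamb bH; lia.
have := tkl hm u v; rewrite -/(upto m).
case e: (vg G us m u v) => [w|].
  by case=> w' ew' /andP[l1 _]; apply: (sound_edge wG iG x0 sx e); rewrite /edge_weight ew'.
by move=> ew; left; rewrite /edge_weight ew /= lerDr.
Qed.

Context (ok : key_ok ins (edge_weight (upto m)) (D a) inf vs key_inv kf).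
Context (rel : relaxed outs (edge_weight (upto m)) vs vs kf).

Let dm v := snap_up q (D a v) (D b v) (kf v).
Definition refine t v := if t == m then (if v \in vs then dm v else D a v) else D t v.

Lemma vs_drop v : v \in vs -> q * D b v <= D a v.
Proof using mvs dab. by rewrite mvs; case: (dab v) => [->|//]; rewrite eqxx. Qed.

Lemma refine_range v : v \in vs -> D b v <= dm v <= D a v.
Proof using q1 mvs dab pb.
by move=> vv; have [] := snap_upP q1 (kf v) (D_ge0 v pb) (vs_drop vv).
Qed.

Lemma tight_estimate v : tight G us s E m v (if v \in vs then kf v else D a v).
Proof using W1 wG iG q1 mEl tkl hamb bH qE pa pb dab mvs ok rel.
have E0 : 0 <= E by apply: le_trans qE; apply: ltW; apply: lt_trans q1.
have hm : (0 < m < H)%N by clear -hamb bH; lia.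
have frozen u : u \notin vs -> tight G us s E m u (D a u).
  rewrite mvs negbK => /eqP ->; have [_ tb _ _] := pb u.
  by apply: (tight_mono W1 wG iG E0 _ _ _ (tb _)) => //; clear -hamb bH; lia.
have snv : s \notin vs.
  by rewrite mvs; have [_ _ _ ->//] := pa s; have [_ _ _ ->//] := pb s; rewrite eqxx.
apply: (tight_potential E0 (f := fun v => if v \in vs then kf v else D a v)) => [|{}v] /=.
  by rewrite (negbTE snv); have [_ _ _ ->] := pa s.
have [vv|nv] := boolP (v \in vs); last by left; exact: frozen.
right=> u w ew; have uEl' : (u, v) \in El by apply: (mEl hm); rewrite /adj ew.
have := tkl hm u v; rewrite ew -/(upto m) => -[w0 kw0 /andP[_ l2]].
have {}l2 : edge_weight (upto m) u v <= q * w by rewrite /edge_weight kw0.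
have wE : edge_weight (upto m) u v <= E * w.
  apply: le_trans l2 _; apply: ler_wpM2r => //.
  by case: (vg_weights wG iG ew) => [->//|/andP[h _]]; exact: le_trans h.
have [ok1 ok2 ok3] := ok.
have [uv|nuv] := boolP (u \in vs).
  by apply: le_trans (rel uv vv _) _; rewrite ?mem_outs // lerD2l.
by apply: le_trans (ok2 v u vv _ nuv) _; rewrite ?mem_ins // lerD2l.
Qed.

(** A refined value is [D a], sound since an earlier time, or [q * c1], which is not below the sound
    key. For the other bound, [c1] is the larger of two tight values, and rounding raises it by a
    factor of at most [q * q]. *)
Lemma refine_point : point (q * q * E) m refine.
Proof using W1 wG iG q1 infW mEl tkl zkl hamb bH qE pa pb dab mvs ok rel.
have q0 : 0 < q := lt_trans ltr01 q1.
have E0 : 0 <= E by apply: le_trans qE; exact: ltW.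
move=> v; rewrite /refine eqxx; have ti := @tight_estimate v.
have [vv|nv] := boolP (v \in vs); last first.
  rewrite (negbTE nv) in ti.
  have [sd vd] := key_inv_cur v; have [_ _ _ zd] := pa v; split=> // _.
  apply: (tight_mono W1 wG iG E0 _ _ _ ti) => //.
  by rewrite ler_peMl // -[1]mulr1 ler_pM // ltW.
rewrite vv in ti; have [ok1 ok2 ok3] := ok.
have [sk vk] := ok3 v vv; have db0 := D_ge0 v pb.
have [r1 _ _ r4 r5] := snap_upP q1 (kf v) db0 (vs_drop vv); rewrite -/(dm v) in r1 r4 r5.
have [sa va] := key_inv_cur v; have [_ tb vb sb] := pb v; have [_ _ _ ssa] := pa v.
set c1 := Num.max (kf v) (D b v) in r4 r5.
have vc1 : c1 = 0 \/ 1 <= c1 by rewrite /c1; case: (leP (kf v) (D b v)).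
split.
- move=> _; case: r4 => [->//|e]; rewrite e.
  apply: (sound_mono W1 iG (leqnn _) _ sk).
  have c1k : kf v <= c1 by rewrite le_max lexx.
  apply: le_trans c1k _; rewrite ler_peMl //; last exact: ltW.
  by case: vc1 => [->//|h]; exact: le_trans h.
- move=> _; have t1 : tight G us s E m v c1.
    rewrite /c1; case: (leP (kf v) (D b v)) => _ //.
    by apply: (tight_mono W1 wG iG E0 _ _ _ (tb _)) => //; clear -hamb bH; lia.
  have qq0 : 0 <= q * q by rewrite mulr_ge0 // ltW.
  apply: (tight_mono W1 wG iG _ (leqnn m) r5 (lexx _) (tight_scale qq0 t1)).
  by rewrite mulr_ge0.
- case: r4 => [->//|->]; case: vc1 => [->|h]; first by left; rewrite mulr0.
  by right; rewrite -[1]mulr1 ler_pM // ltW.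
- by move=> e; move: vv; rewrite mvs ssa // sb // eqxx.
Qed.

Lemma refine_drop_left : drop_ok a m refine.
Proof using q1 hamb bH mvs dab pb.
move=> v; rewrite /refine eqxx (_ : (a == m) = false); last by clear -hamb bH; lia.
case: ifP => vv; last by left.
by have [] := snap_upP q1 (kf v) (D_ge0 v pb) (vs_drop vv).
Qed.

Lemma refine_drop_right : drop_ok m b refine.
Proof using q1 hamb bH mvs dab pb.
move=> v; rewrite /refine eqxx (_ : (b == m) = false); last by clear -hamb bH; lia.
case: ifPn => vv; last by left; move: vv; rewrite mvs negbK => /eqP.
by have [] := snap_upP q1 (kf v) (D_ge0 v pb) (vs_drop vv).
Qed.

End IntervalMath.

(** [D] is a complete table that exists in the analysis only; here the memory is required to hold
    the estimates at the two ends just for the vertices alive in between. *)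
Definition alive_mem t t' (D : nat -> 'I_n -> R) st := exists vs : seq 'I_n,
  [/\ uniq vs, forall v, (v \in vs) = (D t v != D t' v), iarr st aCN t = size vs,
      forall k, (k < size vs)%N -> iarr st aAL (t * n + k)%N = nth s vs k &
      forall v, v \in vs -> rarr st bD (t * n + v)%N = D t v /\ rarr st bD (t' * n + v)%N = D t' v].

Definition rows_kept (a m : nat) st st' :=
  [/\ forall t, t != a -> t != m -> iarr st' aCN t = iarr st aCN t,
      forall t k, t != a -> t != m -> (k < n)%N ->
        iarr st' aAL (t * n + k)%N = iarr st aAL (t * n + k)%N &
      forall t v, t != m -> rarr st' bD (t * n + v)%N = rarr st bD (t * n + v)%N].

Lemma alive_mem_kept a m t t' D D' st st' : rows_kept a m st st' -> t != a -> t != m -> t' != m ->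
  (forall t v, t != m -> D' t v = D t v) -> alive_mem t t' D st -> alive_mem t t' D' st'.
Proof.
move=> [r1 r2 r3] ta tm tm' eD [vs [uv mv cv lv dv]].
exists vs; split=> //.
- by move=> v; rewrite !eD.
- by rewrite r1.
- move=> k kv; rewrite r2 ?lv //; exact: leq_trans kv (uniq_size_ord uv).
- by move=> v vv; rewrite !r3 // !eD //; exact: dv.
Qed.

Definition vcost v := (dij_cost lgn outs ins v + 22)%N.

Lemma interval_run st a g h E D t0 :
  base st -> ireg st xA = a -> ireg st xG = g -> ireg st xHalf = h ->
  (0 < h < g)%N -> (a + g <= H)%N ->
  ireg st xP = nupto t0 -> (t0 <= a + h)%N -> wt_mem outs (edge_weight (upto t0)) st ->
  cur_mem ins (D a) st -> (forall v, rarr st bKey v = 0) ->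
  alive_mem a (a + g) D st -> q <= E -> point E a D -> point E (a + g) D ->
  drop_ok a (a + g) D ->
  run B interval st (3 * (nupto (a + h) - nupto t0) +
      \sum_(v | D a v != D (a + g)%N v) vcost v + 40) (fun st' => exists D',
    [/\ forall t v, t != (a + h)%N -> D' t v = D t v,
        [/\ point (q * q * E) (a + h) D', drop_ok a (a + h) D' & drop_ok (a + h) (a + g) D'],
        alive_mem a (a + h) D' st' /\ alive_mem (a + h) (a + g) D' st',
        [/\ ireg st' xA = (a + g)%N, ireg st' xP = nupto (a + h),
            wt_mem outs (edge_weight (upto (a + h))) st',
            cur_mem ins (D (a + g)%N) st' & forall v, rarr st' bKey v = 0] &
        rows_kept a (a + h) st st']).
Proof.
move=> bs ea eg eh hh agH ep t0m wm cm ek [vs [uvs mvs ecn eal edd]] qE pa pb dab.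
set m := (a + h)%N; set b := (a + g)%N.
have hamb : (a < m < b)%N by rewrite /m /b; clear -hh; lia.
have bH : (b <= H)%N by [].
have aH : (a <= H)%N by clear -hamb bH; lia.
have mH : (m <= H)%N by clear -hamb bH; lia.
have rn := uniq_size_ord uvs.
have HB : (H < B)%N by apply: (B_bound hB); have := leq_mul (leqnn H) (ltn_ord s); nlia.
have -> : (3 * (nupto m - nupto t0) + \sum_(v | D a v != D b v) vcost v + 40 =
   1 + (1 + ((3 * (nupto m - nupto t0)).+1 + ((\sum_(v <- vs) dij_cost lgn outs ins v + 10) +
   ((size vs * 22 + 10) + (1 + 16))))))%N.
  rewrite (_ : (\sum_(v | _) _)%N = (\sum_(v <- vs) vcost v)%N).
    rewrite /vcost big_split /= sum_seq_const; nlia.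
  by rewrite [RHS]big_uniq //=; apply: eq_bigl => v; rewrite mvs.
rewrite /interval.
xs; xs; first by rewrite /= ea eg; repeat split=> //; rewrite -/b; nlia.
rewrite /= ea eg.
xs; xs; first by rewrite /= ea eh; repeat split=> //; rewrite -/m; nlia.
rewrite /= ea eh -/m -/b.
set st1 := set_ireg _ _ _.
have bs1 : base st1 by case: bs => -[*] *; split=> //; split.
xs; apply: run_then (advance_run bs1 _ t0m _ _) _ => // st2 [fr2 [p2 w2]].
have bs2 := base_frame fr2 isT bs1.
have wm0 u v : v \in outs u -> 0 <= edge_weight (upto m) u v by move=> _; exact: edge_weight_ge0.
have aHn : (a * n <= H * n)%N by rewrite leq_mul2r aH orbT.
have cur0 u : 0 <= D a u by exact: D_ge0 pa.
have inf0 : 0 < inf by exact: lt_le_trans inf1.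
xs; apply: run_then (dijkstra_run (v0 := s) hB aHn hlg outs_ins uniq_outs uniq_ins wm0
   inf0 uvs inf_big cur0 (P := key_inv m) _ _ _ (b_gm bs2) w2 _ _ erefl aH _ _ (b_inf bs2) (b_big bs2) _) _.
- exact: key_inv_inf.
- by move=> u v _ _; exact: (key_inv_cur hamb bH pa).
- move=> u v x; exact: (key_inv_edge hamb bH).
- by move=> v u uv; rewrite (frRA fr2) //= (cm v).
- by rewrite (frI fr2).
- by rewrite (frIA fr2).
- by move=> k kv; rewrite (frIA fr2) //= eal.
- by move=> v; rewrite (frRA fr2) //= ek.
move=> st3 [fr3 [kf [k3 ok3 rel3 [q3 r3] c3]]].
have bs3 := base_frame fr3 isT bs2.
pose D' := refine D a m b vs kf.
have rng := refine_range kf pb dab mvs.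
xs; apply: run_then (snap_run (vs := vs) (a := a) (b := b) (m := m) (da := D a) (db := D b)
   (kf := kf) uvs hamb bH rng (gm_n (b_gm bs3)) (b_q bs3) _ _ _ q3 r3 _ k3 _) _.
- by rewrite (frI fr3) // (frI fr2).
- by rewrite (frI fr3) // (frI fr2).
- by rewrite (frI fr3) // (frI fr2).
- by move=> k kv; rewrite (frIA fr3) // (frIA fr2) //= eal.
- by move=> v vv; rewrite (frRA fr3) // (frRA fr2) //=; exact: edd.
move=> st4 [fr4 [k4 c4 d4 n4 [l4 l4' l4'']]].
apply: (@run_time _ _ _ _ 1); last by [].
have fA : iarr st3 aAL = iarr st aAL by rewrite (frIA fr3) // (frIA fr2).
have fC : iarr st3 aCN = iarr st aCN by rewrite (frIA fr3) // (frIA fr2).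
have fD : rarr st3 bD = rarr st bD by rewrite (frRA fr3) // (frRA fr2).
have e4 : ireg st4 xB = b by rewrite (frI fr4) // (frI fr3) // (frI fr2).
have am : (a == m) = false by clear -hamb; lia.
have bm : (b == m) = false by clear -hamb; lia.
have D'm v : v \in vs -> D' m v = snap_up q (D a v) (D b v) (kf v).
  by move=> vv; rewrite /D' /refine eqxx vv.
have D'nm v : v \notin vs -> D' m v = D a v.
  by move=> vv; rewrite /D' /refine eqxx (negbTE vv).
have D'o t v : t != m -> D' t v = D t v by move=> tm; rewrite /D' /refine (negbTE tm).
xs => //=; rewrite e4; exists D'; split.
- exact: D'o.
- split.
  + exact: (refine_point qE hamb bH pa pb dab mvs ok3 rel3).
  + exact: (refine_drop_left kf hamb bH pb dab mvs).
  + exact: (refine_drop_right kf hamb bH pb dab mvs).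
- split; rewrite /alive_mem /=.
  + exists [seq v <- vs | D a v != snap_up q (D a v) (D b v) (kf v)]; split.
    * exact: filter_uniq.
    * move=> v; rewrite mem_filter (D'o a) ?am //.
      have [vv|nv] := boolP (v \in vs); first by rewrite andbT D'm.
      by rewrite andbF D'nm // eqxx.
    * by rewrite n4 eqxx.
    * by move=> k kl'; rewrite l4.
    * move=> v; rewrite mem_filter => /andP[_ vv].
      by rewrite !d4 am eqxx vv /= fD (edd v vv).1 (D'o a) ?am // D'm.
  + exists [seq v <- vs | snap_up q (D a v) (D b v) (kf v) != D b v]; split.
    * exact: filter_uniq.
    * move=> v; rewrite mem_filter (D'o b) ?bm //.
      have [vv|nv] := boolP (v \in vs); first by rewrite andbT D'm.
      by rewrite andbF D'nm //; move: nv; rewrite mvs negbK => /eqP ->; rewrite eqxx.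
    * by rewrite n4 eqxx eq_sym am.
    * by move=> k kl'; rewrite l4'.
    * move=> v; rewrite mem_filter => /andP[_ vv].
      by rewrite !d4 bm eqxx vv /= fD (edd v vv).2 (D'o b) ?bm // D'm.
- split=> //=.
  + by rewrite (frI fr4) // (frI fr3).
  + by move=> u v uv; rewrite (frRA fr4) // (frRA fr3) // w2.
  (* Off the group the estimates at [a] and [b] agree, so [bCur] now holds those at [b], where the
     next interval starts, without any work on frozen vertices. *)
  + move=> v u uv; rewrite c4; case: ifPn => [//|nv].
    by rewrite (c3 u v) //; move: nv; rewrite mvs negbK => /eqP ->.
- split=> /=.
  + by move=> t /negbTE ta /negbTE tm; rewrite n4 ta tm fC.
  + by move=> t k ta tm kn; rewrite l4'' // fA.
  + by move=> t v /negbTE tm; rewrite d4 tm /= fD.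
Qed.

(** * All intervals of a level, and all levels *)

Context (pkl : forall e, e \in kl -> (0 < e.1.1)%N).

(** Row 0 of [bD] is required for all tails of edges, alive or not, as it initializes [bCur] at the
    start of a level. *)
Record level_inv g E (D : nat -> 'I_n -> R) st : Prop := LevelInv {
  l_base : base st;
  l_g : ireg st xG = g;
  l_key : forall v, rarr st bKey v = 0;
  l_row : forall v u, u \in ins v -> rarr st bD u = D 0%N u;
  l_point : forall t, (g %| t)%N -> (t <= H)%N -> point E t D;
  l_drop : forall t, (g %| t)%N -> (t < H)%N -> drop_ok t (t + g) D;
  l_alive : forall t, (g %| t)%N -> (t < H)%N -> alive_mem t (t + g) D st }.

Lemma point_eq E t D D' : (forall v, D' t v = D t v) -> point E t D -> point E t D'.
Proof. by move=> e p v; rewrite e; exact: p. Qed.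

Lemma point_mono E E' t D : 0 <= E -> E <= E' -> point E t D -> point E' t D.
Proof.
move=> E0 EE p v; have [p1 p2 p3 p4] := p v; split=> // t0.
exact: (tight_mono W1 wG iG E0 (leqnn t) (lexx _) EE (p2 t0)).
Qed.

Lemma reset_run st D : base st -> (forall v u, u \in ins v -> rarr st bD u = D u) ->
  run B reset st (size El * 5 + 2) (fun st' =>
    wt_mem outs (fun _ _ => inf) st' /\ cur_mem ins D st').
Proof.
move=> bs rowD; have sE := size_El.
apply: (@run_for_const _ _ _ _ _ _ _ 3 (fun j st' =>
  (forall u v, (u, v) \in take j El -> rarr st' bWt (u * n + v)%N = inf) /\
  (forall u v, (u, v) \in take j El -> rarr st' bCur u = D u))) => //.
- by apply: (B_bound hB); nlia.
- by case: bs.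
- by rewrite take0.
- move=> j st1 fr ej er lt [i1 i2].
  have bs1 := base_frame fr isT bs.
  case eE: (nth (s, s) El j) => [u v].
  have uvE : (u, v) \in El by rewrite -eE mem_nth.
  have uu := ltn_ord u; have vn := ltn_ord v.
  have uvn : (u * n + v < n * n)%N by clear -uu vn; nia.
  apply: (@run_time _ _ _ _ (1 + (1 + 1))); last by [].
  xs; xs => //=; rewrite ej (b_et bs1) // eE /=.
  xs; xs => //=; rewrite ?ej ?(gm_n (b_gm bs1)) ?(b_eh bs1) // eE /=.
    by repeat split=> //; apply: (B_bound hB); nlia.
  xs => //=.
  have e8 : rarr st1 bD = rarr st bD by rewrite (frRA fr).
  rewrite (b_inf bs1) e8 (rowD v u) ?mem_ins //; split=> a b.
  + rewrite (take_nth (s, s)) // mem_rcons inE eE ix_eq // !val_eqE xpair_eqE.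
    by case: ifP => //= _; exact: i1.
  + rewrite (take_nth (s, s)) // mem_rcons inE eE xpair_eqE val_eqE.
    by case: eqP => [->|_] //=; exact: i2.
- move=> st1 fr; rewrite take_size => -[i1 i2]; split.
  + by move=> u v; rewrite mem_outs; exact: i1.
  + by move=> v u; rewrite mem_ins; exact: i2.
Qed.

Definition drop_cost g (D : nat -> 'I_n -> R) t := (\sum_(v | D t v != D (t + g)%N v) vcost v)%N.

Lemma dvdn_half g h t : g = (2 * h)%N -> (0 < h)%N -> (h %| t)%N ->
  (g %| t)%N \/ exists2 t', (g %| t')%N & t = (t' + h)%N.
Proof.
move=> -> h0 /dvdnP[k ->]; case ok : (odd k).
  right; exists (k.-1 * h)%N.
    by rewrite dvdn_pmul2r // dvdn2; case: k ok => //= k; case: odd.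
  by case: k ok => //= k _; rewrite mulSn addnC.
by left; rewrite dvdn_pmul2r // dvdn2 ok.
Qed.

Lemma level_run st g h M E D : level_inv g E D st -> g = (2 * h)%N -> (0 < h)%N ->
  H = (M * g)%N -> q <= E ->
  run B level st (size El * 5 + 3 * size kl + \sum_(i < M) (drop_cost g D (i * g) + 42) + 10)
    (fun st' => exists D', level_inv h (q * q * E) D' st' /\
       forall t v, (g %| t)%N -> D' t v = D t v).
Proof.
move=> li eg h0 eH qE; have [bs xg ek row pt dr al] := li.
have sE := size_El.
have q0 : 0 < q by exact: lt_trans q1.
have E0 : 0 <= E by apply: le_trans qE; exact: ltW.
have B2 : (2 < B)%N by apply: (B_bound hB); nlia.
have hh : (0 < h < g)%N by rewrite eg; clear -h0; lia.
have EE : E <= q * q * E by rewrite ler_peMl // -[1]mulr1 ler_pM // ltW.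
have gh : (g %/ 2 = h)%N by rewrite eg mulKn.
have ndvd t : (g %| t)%N -> ~~ (g %| t + h)%N.
  by move=> gt; rewrite dvdn_addr // gtnNdvd //; case/andP: hh.
pose S i := (\sum_(i <= j < M) (drop_cost g D (j * g) + 42))%N.
rewrite -(big_mkord xpredT (fun i => drop_cost g D (i * g) + 42)%N) -/(S 0%N).
apply: (@run_time _ _ _ _ (1 + (1 + ((size El * 5 + 2) + (1 + ((3 * size kl + S 0%N).+1 + 1)))))%N); last by nlia.
rewrite /level.
xs; xs => //=; rewrite xg gh.
xs; xs => /=; first by nlia.
set st1 := set_ireg _ _ _.
have bs1 : base st1 by case: bs => -[*] *; split=> //; split.
xs; apply: run_then (reset_run (D := D 0%N) bs1 row) _ => st2 [fr2 [w2 c2]].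
have bs2 := base_frame fr2 isT bs1.
xs; xs => /=; first by nlia.
set st3 := set_ireg _ _ _.
have bs3 : base st3 by case: bs2 => -[*] *; split=> //; split.
have n0 : nupto 0 = 0%N.
  by apply/eqP; rewrite eqn0Ngt -has_count; apply/hasPn => e /pkl; rewrite -ltnNge.
(* Estimates at multiples of [g] never change, only midpoints are added: to the left of [i * g] the
   invariant speaks of half intervals, to the right of whole ones. [t0] is the last midpoint
   treated, or 0; the recorded weights are those of that time. *)
xs; apply: (@run_while _ _ _ _ (fun c st' => exists D' i t0,
  [/\ [/\ base st', ireg st' xA = (i * g)%N, ireg st' xP = nupto t0, (t0 <= i * g)%N & (i <= M)%N],
      c = (3 * (size kl - nupto t0) + S i)%N,
      [/\ wt_mem outs (edge_weight (upto t0)) st', cur_mem ins (D (i * g)%N) st',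
          forall v, rarr st' bKey v = 0 & forall v u, u \in ins v -> rarr st' bD u = D 0%N u],
      forall t v, (g %| t)%N \/ (i * g <= t)%N -> D' t v = D t v &
      (forall t, (g %| t)%N -> (i * g <= t < H)%N -> alive_mem t (t + g) D' st') /\
      (forall t, (g %| t)%N -> (t < i * g)%N ->
        [/\ point (q * q * E) (t + h) D', drop_ok t (t + h) D', drop_ok (t + h) (t + g) D',
            alive_mem t (t + h) D' st' & alive_mem (t + h) (t + g) D' st'])])).
- move=> c st' fr [D' [i [t0 [[bs' xa xp t0i iM] -> [w' c' k' r'] eD [al' pr']]]]].
  split=> //=; rewrite (b_H bs') xa -ltnNge.
  have -> : (i * g < H)%N = (i < M)%N.
    by rewrite eH ltn_mul2r; case/andP: hh => /ltn_trans h1 /h1 ->.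
  case: ltnP => [lt|ge]; last first.
    have {ge iM} eM : i = M by apply/eqP; rewrite eqn_leq iM.
    subst i; rewrite -eH in eD al' pr'.
    xs => //=; exists D'; split; last by move=> t v gt; apply: eD; left.
    have split_t t : (h %| t)%N -> (t < H)%N ->
        (g %| t)%N \/ exists2 t', (g %| t')%N /\ (t' < H)%N & t = (t' + h)%N.
      move=> ht tH; have [|[t' gt' e]] := dvdn_half eg h0 ht; [by left|right].
      by exists t' => //; split=> //; nlia.
    split=> //.
    + by case: bs' => -[*] *; split=> //; split.
    + by rewrite /= (frI fr) //= (frI fr2).
    + by move=> v u uv; rewrite /= (r' v u uv) eD //; left; exact: dvdn0.
    + move=> t ht; rewrite leq_eqVlt => /predU1P[->|tH].
        apply: (point_eq (D := D)); first by move=> v; apply: eD; left; rewrite eH dvdn_mull.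
        by apply: point_mono E0 EE (pt _ _ _) => //; rewrite eH dvdn_mull.
      have [gt|[t' [gt' lt'] ->]] := split_t t ht tH; last by have [] := pr' t' gt' lt'.
      apply: (point_eq (D := D)); first by move=> v; apply: eD; left.
      by apply: point_mono E0 EE (pt _ gt _); exact: ltnW.
    + move=> t ht tH; have [gt|[t' [gt' lt'] ->]] := split_t t ht tH; first by have [] := pr' t gt tH.
      have -> : (t' + h + h = t' + g)%N by rewrite eg; clear; lia.
      by have [] := pr' t' gt' lt'.
    + move=> t ht tH; have [gt|[t' [gt' lt'] ->]] := split_t t ht tH.
        by have [_ _ _ x _] := pr' t gt tH; exact: x.
      have -> : (t' + h + h = t' + g)%N by rewrite eg; clear; lia.
      by have [_ _ _ _ x] := pr' t' gt' lt'; exact: x.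
  set a := (i * g)%N in xa t0i c' eD al' pr' *.
  have ga : (g %| a)%N by rewrite dvdn_mull.
  have gb : (g %| a + g)%N by rewrite dvdn_addr.
  have aH : (a + g <= H)%N by rewrite /a eH -mulSnr leq_mul2r lt orbT.
  have aH' : (a < H)%N by clear -aH hh; lia.
  have e2 : ireg st' xG = g by rewrite (frI fr) //= (frI fr2).
  have e3 : ireg st' xHalf = h by rewrite (frI fr) //= (frI fr2).
  have Da v : D' a v = D a v by apply: eD; left.
  have Db v : D' (a + g)%N v = D (a + g)%N v by apply: eD; left.
  have gH t : (g %| t)%N -> (t < a)%N -> (t + g <= a)%N.
    by move=> /dvdnP[k ->]; rewrite /a ltn_mul2r -mulSnr leq_mul2r => /andP[_ ->]; rewrite orbT.
  exists (3 * (nupto (a + h) - nupto t0) + drop_cost g D a + 40)%N.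
    by rewrite /S (big_ltn lt) -/a; have := count_size (fun e => e.1.1 <= a + h)%N kl; rewrite -/(nupto _);
       have := @nupto_mono t0 (a + h) ltac:(clear -t0i; lia); clear; lia.
  have dab : drop_ok a (a + g) D' by move=> v; rewrite Da Db; exact: dr.
  have pa : point E a D' by apply: point_eq Da (pt _ ga _); exact: ltnW.
  have pb : point E (a + g) D' by exact: point_eq Db (pt _ gb aH).
  have c'' : cur_mem ins (D' a) st' by move=> v u uv; rewrite Da (c' v).
  have ala : alive_mem a (a + g) D' st' by apply: al' => //; rewrite leqnn.
  have t0m : (t0 <= a + h)%N by clear -t0i; lia.
  have := interval_run bs' xa e2 e3 hh aH xp t0m w' c'' k' ala qE pa pb dab.
  rewrite (_ : (\sum_(v | _) _)%N = drop_cost g D a); last first.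
    by apply: eq_bigl => v; rewrite Da Db.
  move=> /run_frame /run_le; apply=> // st4 [fr4 [D4 [eD4 [p4 d4 d4'] [al4 al4'] [xa4 xp4 w4 c4 k4] rk4]]].
  exists (3 * (size kl - nupto (a + h)) + S i.+1)%N.
    rewrite /S (big_ltn lt) -/a; have := count_size (fun e => e.1.1 <= a + h)%N kl; rewrite -/(nupto _).
    by have := @nupto_mono t0 (a + h) t0m; clear; lia.
  have ai : (i.+1 * g = a + g)%N by rewrite mulSnr.
  exists D4, i.+1, (a + h)%N; rewrite ai; split=> //.
  + split=> //; [exact: base_frame fr4 isT bs'|by clear -hh; lia].
  + split=> //; first by move=> v u uv; rewrite (c4 v u uv) Db.
    move=> v u uv; have [_ _ r4] := rk4; have := r4 0%N u; rewrite mul0n add0n => -> //.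
      exact: r' uv.
    by clear -hh; lia.
  + move=> t v ht; rewrite eD4.
      by apply: eD; case: ht => ht; [left|right; clear -ht; lia].
    case: ht => [gt|ht]; last by clear -ht hh; lia.
    by apply/eqP => e; move: (ndvd a ga); rewrite -e gt.
  + have neq t : (g %| t)%N -> t != (a + h)%N.
      by move=> gt; apply/eqP => e; move: (ndvd a ga); rewrite -e gt.
    split.
    * move=> t gt ht; apply: (alive_mem_kept rk4 _ _ _ eD4); last by apply: al' => //; clear -ht; lia.
      - by clear -ht hh; lia.
      - exact: neq.
      - by apply: neq; rewrite dvdn_addr.
    * move=> t gt; have [ta _|ta|-> _] := ltngtP t a.
      - have [x1 x2 x3 x4 x5] := pr' t gt ta; have tga := gH t gt ta.
        have eDt v : D4 t v = D' t v by apply: eD4; exact: neq.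
        have eDg v : D4 (t + g)%N v = D' (t + g)%N v by apply: eD4; apply: neq; rewrite dvdn_addr.
        have eDh v : D4 (t + h)%N v = D' (t + h)%N v by apply: eD4; rewrite eqn_add2r; clear -ta; lia.
        split.
        - exact: point_eq eDh x1.
        - by move=> v; rewrite eDt eDh.
        - by move=> v; rewrite eDg eDh.
        - apply: (alive_mem_kept rk4 _ _ _ eD4 x4); [by clear -ta; lia|exact: neq|].
          by rewrite eqn_add2r; clear -ta; lia.
        - apply: (alive_mem_kept rk4 _ _ _ eD4 x5); [by clear -tga hh; lia| |].
          by rewrite eqn_add2r; clear -ta; lia.
          by apply: neq; rewrite dvdn_addr.
      - by move=> tg; move/dvdnP: gt => [k ek']; move: ta tg; rewrite ek' /a -mulSnr !ltn_mul2r; clear; lia.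
      - by [].
- exists D, 0%N, 0%N; split=> //.
  + by split=> //=; rewrite ?n0 //= (frI fr2).
  + by rewrite n0 subn0.
  + split=> //.
    * move=> u v uv; rewrite w2 // /upto.
      suff -> : [seq e <- kl | (e.1.1 <= 0)%N] = [::] by [].
      by apply: size0nil; rewrite size_filter -/(nupto 0) n0.
    * by move=> v; rewrite /= (frRA fr2) //= ek.
    * by move=> v u uv; rewrite /= (frRA fr2) //= (row v).
  + split=> // t gt ht; have /andP[_ tH] := ht.
    have [vs [x1 x2 x3 x4 x5]] := al t gt tH.
    exists vs; split=> //=.
    * by rewrite (frIA fr2) //= x3.
    * by move=> k kv; rewrite (frIA fr2) //= x4.
    * by move=> v vv; rewrite (frRA fr2) //=; exact: x5.
Qed.

(** Exchanging the sums charges [vcost v] once for each drop of [v] on the level, at most [K] times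
    by [count_drops]. As estimates never increase, a vertex with equal values at 0 and [H] has no
    drop and pays nothing, which keeps vertices without in-edges out of the bound. *)
Lemma drop_total g E (D : nat -> 'I_n -> R) M K :
  (forall t, (g %| t)%N -> (t <= H)%N -> point E t D) ->
  (forall t, (g %| t)%N -> (t < H)%N -> drop_ok t (t + g) D) ->
  (forall v, D 0%N v < q ^+ K) -> H = (M * g)%N -> (0 < g)%N ->
  (\sum_(i < M) drop_cost g D (i * g) <= K * \sum_(v | D 0%N v != D H v) vcost v)%N.
Proof.
move=> pt dr D0K eH g0.
have eS i : (i * g + g = i.+1 * g)%N by rewrite mulSnr.
have q0 : 0 < q := lt_trans ltr01 q1.
rewrite (eq_bigr (fun i : 'I_M => \sum_v
    (if D (i * g)%N v != D (i.+1 * g)%N v then vcost v else 0))%N); last first.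
  by move=> i _; rewrite /drop_cost big_mkcond eS.
rewrite exchange_big /= big_distrr /= [X in (_ <= X)%N]big_mkcond /=.
apply: leq_sum => v _; pose f i := D (i * g)%N v.
have fp i : (i <= M)%N -> f i = 0 \/ 1 <= f i.
  move=> iM; have gi : (g %| i * g)%N by rewrite dvdn_mull.
  have iH : (i * g <= H)%N by rewrite eH leq_mul2r iM orbT.
  by have [_ _ h _] := pt _ gi iH v.
have fd i : (i < M)%N -> f i = f i.+1 \/ q * f i.+1 <= f i.
  move=> iM; rewrite /f -eS; apply: dr; rewrite ?dvdn_mull //.
  by rewrite eH ltn_mul2r g0.
rewrite (_ : (\sum_(i < M) _)%N = ((\sum_(i < M) (f i != f i.+1)) * vcost v)%N); last first.
  by rewrite big_distrl /=; apply: eq_bigr => i _; case: ifP => _; rewrite ?mul1n.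
have f0 : f 0%N = D 0%N v by rewrite /f mul0n.
have fM : f M = D H v by rewrite /f -eH.
rewrite -f0 -fM; case: eqP => [e|_] /=; last first.
  by rewrite leq_mul2r (count_drops q1) ?orbT // f0.
suff -> : (\sum_(i < M) (f i != f i.+1) = 0)%N by [].
have mono i : (i < M)%N -> f i.+1 <= f i.
  move=> iM; case: (fd i iM) => [->//|]; apply: le_trans.
  rewrite ler_peMl //; last exact: ltW.
  by case: (fp i.+1 iM) => [->//|h]; exact: le_trans h.
have mono2 i j : (i <= j)%N -> (j <= M)%N -> f j <= f i.
  elim: j => [|j IH]; first by rewrite leqn0 => /eqP ->.
  rewrite leq_eqVlt => /predU1P[->//|ij] jM.
  by apply: le_trans (mono j jM) (IH ij _); exact: ltnW.
rewrite big1 // => i _; have iM := ltn_ord i; apply/eqP; rewrite eqb0 negbK eq_le mono // andbT.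
apply: le_trans (mono2 0%N i _ _) _ => //; first exact: ltnW.
by rewrite e mono2.
Qed.

Definition level_cost K (D : nat -> 'I_n -> R) :=
  (size El * 5 + 3 * size kl + K * (\sum_(v | D 0%N v != D H v) vcost v) + 12)%N.

(* A level with M intervals pays 42 for each of them; as M runs through 1, 2, 4, ...,
   this adds up to less than 42 * H. *)
Lemma levels_run st L K D : level_inv (2 ^ L) q D st -> H = (2 ^ L)%N ->
  (forall v, D 0%N v < q ^+ K) ->
  run B (While (BILe (c_ 2) (r_ xG)) level) st (L * level_cost K D + 42 * H).+1
    (fun st' => exists D', [/\ level_inv 1 (q ^+ (2 * L + 1)) D' st',
       D' 0%N = D 0%N & D' H = D H]).
Proof.
move=> li eH DK.
have q0 : 0 < q := lt_trans ltr01 q1.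
apply: (@run_while _ _ _ _ (fun c st' => exists D' l j,
  [/\ (j + l = L)%N, level_inv (2 ^ l) (q ^+ (2 * j + 1)) D' st',
      (l * level_cost K D + 42 * (2 ^ L - 2 ^ j) <= c)%N,
      D' 0%N = D 0%N & D' H = D H])); last first.
  exists D, L, 0%N; split=> //; rewrite ?muln0 ?expr1 // eH.
  by rewrite leq_add2l leq_mul2l leq_subr.
move=> c st' fr [D' [l [j [jl li' hc e0' eH']]]].
have B2 : (2 < B)%N by apply: (B_bound hB); nlia.
split; first by rewrite /=.
rewrite /= (l_g li'); case: l jl li' hc => [|l] jl li' hc.
  rewrite expn0 /=; exists D'; split=> //.
  by have -> : L = j by clear -jl; lia.
have l0 : (0 < 2 ^ l)%N by rewrite expn_gt0.
have -> : (1 < 2 ^ l.+1)%N by rewrite expnS; clear -l0; lia.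
have eH2 : H = (2 ^ j * 2 ^ l.+1)%N by rewrite -expnD jl.
have qE : q <= q ^+ (2 * j + 1) by rewrite addn1 exprS ler_peMr ?exprn_ege1 // ltW.
have := level_run li' (expnS 2 l) l0 eH2 qE.
set T := (_ + 10)%N => rl.
have hT : (T + 2 <= level_cost K D + 42 * 2 ^ j)%N.
  have [_ _ _ _ pt dr _] := li'.
  have D'K v : D' 0%N v < q ^+ K by rewrite e0'.
  have g0 : (0 < 2 ^ l.+1)%N by rewrite expn_gt0.
  have h := drop_total pt dr D'K eH2 g0; rewrite e0' eH' in h.
  rewrite /T /level_cost big_split /= sum_nat_const card_ord.
  by move: h; set x := (\sum_(_ < _) _)%N; set y := (K * _)%N; clear; lia.
have h2 : (2 ^ j.+1 <= 2 ^ L)%N by rewrite leq_exp2l // -jl; clear; lia.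
have e2 : (2 ^ j.+1 = 2 * 2 ^ j)%N by rewrite expnS.
exists T; first by move: hc hT; rewrite mulSn; clear -h2 e2 l0; have := expn_gt0 2 j; lia.
apply: run_le rl (leqnn _) _ => st2 [D2 [li2 eD2]].
exists (l * level_cost K D + 42 * (2 ^ L - 2 ^ j.+1))%N.
  by move: hc hT; rewrite mulSn; clear -h2 e2; lia.
exists D2, l, j.+1; split=> //.
- by clear -jl; lia.
- have -> : (2 * j.+1 + 1 = (2 * j + 1).+2)%N by clear; lia.
  by rewrite 2!exprS mulrA.
- by rewrite -e0'; apply/funext => v; apply: eD2.
- by rewrite -eH'; apply/funext => v; apply: eD2; rewrite eH2 dvdn_mull.
Qed.

End Level.
(** * Reading the events *)

Section Events.
Context {R : realType} (B n H : nat) (W q : R) (s : 'I_n).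
Context (hB : (4 * (H + 1) * (n + 1) * (n + 1) < B)%N).
Notation entry := (nat * ('I_n * 'I_n) * R)%type.
Implicit Types (st : state R) (u v x : 'I_n) (El : seq ('I_n * 'I_n)) (kl : seq entry)
  (ek : seq ('I_n * 'I_n) * seq entry) (w : R).

Lemma outs_rcons El u v x : outs (rcons El (u, v)) x =
  if u == x then rcons (outs El x) v else outs El x.
Proof. by rewrite /outs filter_rcons /=; case: ifP => _ //; rewrite map_rcons. Qed.

Lemma ins_rcons El u v x : ins (rcons El (u, v)) x =
  if v == x then rcons (ins El x) u else ins El x.
Proof. by rewrite /ins filter_rcons /=; case: ifP => _ //; rewrite map_rcons. Qed.

Definition heads_mem El st := exists hs : seq 'I_n,
  [/\ uniq hs, forall v, (v \in hs) = (v != s) && (ins El v != [::]),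
      ireg st xHc = size hs &
      forall k, (k < size hs)%N -> iarr st aAL k = nth s hs k].

Record ev_mem (ek : seq ('I_n * 'I_n) * seq entry) st : Prop := EvMem {
  em_gm : graph_mem (outs ek.1) (ins ek.1) st;
  em_S : ireg st xS = s;
  em_M : ireg st xM = size ek.1;
  em_Kc : ireg st xKc = size ek.2;
  em_q : rreg st yQ = q;
  em_W : rreg st yW = W;
  em_inf : rreg st yInf = 2 * W * ((size ek.1)%:R + 1);
  em_mat : forall u v, iarr st aMat (u * n + v)%N = ((u, v) \in ek.1);
  em_last : forall u v w, kept ek.2 u v = Some w -> rarr st bLast (u * n + v)%N = w;
  em_et : forall i, (i < size ek.1)%N -> iarr st aET i = (nth (s, s) ek.1 i).1;
  em_eh : forall i, (i < size ek.1)%N -> iarr st aEH i = (nth (s, s) ek.1 i).2;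
  em_kl : forall j, (j < size ek.2)%N -> let e := nth (entry0 s) ek.2 j in
    [/\ iarr st aKE j = (e.1.2.1 * n + e.1.2.2)%N, iarr st aKT j = e.1.1 &
        rarr st bKW j = e.2];
  em_heads : heads_mem ek.1 st }.

Lemma keep_run st ek t u v w :
  ireg st xE = (u * n + v)%N -> ireg st xT = t -> rreg st yX = w ->
  ireg st xKc = size ek.2 -> (size ek.2 + 1 < B)%N ->
  (forall u v w, kept ek.2 u v = Some w -> rarr st bLast (u * n + v)%N = w) ->
  (forall j, (j < size ek.2)%N -> let e := nth (entry0 s) ek.2 j in
    [/\ iarr st aKE j = (e.1.2.1 * n + e.1.2.2)%N, iarr st aKT j = e.1.1 &
        rarr st bKW j = e.2]) ->
  run B keep st 5 (fun st' => let kl' := rcons ek.2 (t, (u, v), w) in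
    [/\ ireg st' xKc = size kl',
      forall u v w, kept kl' u v = Some w -> rarr st' bLast (u * n + v)%N = w &
      forall j, (j < size kl')%N -> let e := nth (entry0 s) kl' j in
       [/\ iarr st' aKE j = (e.1.2.1 * n + e.1.2.2)%N, iarr st' aKT j = e.1.1 &
        rarr st' bKW j = e.2]]).
Proof.
case: ek => El kl /= ee et ew ek hk hl hm.
apply: (@run_time _ _ _ _ (1 + (1 + (1 + (1 + 1))))); last by [].
rewrite /keep; xs; xs => //=; xs; xs => //=; xs; xs => //=; xs; xs => //=; rewrite /incr.
have B1 : (1 < B)%N by lia.
xs => /=; first by rewrite ek.
rewrite ee et ew ek size_rcons addn1; split=> //.
- move=> u' v' w' /=; rewrite kept_rcons ix_eq // !val_eqE.
  by case: ifP => [_ [->]//|_]; exact: hl.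
- move=> j; rewrite nth_rcons ltnS => hj; case: (ltngtP j (size kl)) hj => //= lt _.
  by have := hm j lt.
Qed.

Lemma event_run st El kl t u v w i aT aH aW : (aT < 4)%N -> (aH < 4)%N -> (aW < 2)%N ->
  ireg st xI = i -> ireg st xT = t -> iarr st aT i = u -> iarr st aH i = v -> rarr st aW i = w ->
  uniq El -> (size kl + 1 < B)%N ->
  (forall u v, (u, v) \in El -> kept kl u v) ->
  ev_mem (El, kl) st ->
  run B (event aT aH aW) st 30 (fun st' => ev_mem (ev_step q t (El, kl) (u, v, w)) st').
Proof.
move=> lT lH lW ei et eu ev ew uE hk kE em.
have sE : (size El <= n * n)%N := size_El uE.
have uin x : uniq (ins El x) by exact: uniq_ins.
have uout x : uniq (outs El x) by exact: uniq_outs.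
have un := ltn_ord u; have vn := ltn_ord v.
have uvn : (u * n + n <= n * n)%N by clear -un; nia.
have vun : (v * n + n <= n * n)%N by clear -vn; nia.
have B2 : (2 < B)%N by apply: (B_bound hB); nlia.
have nB : (n * n + 2 < B)%N by apply: (B_bound hB); nlia.
have [[gn god gout gid gin] eS eM eK eq eW eI emat elast eet eeh ekl [hs [uhs mhs ehs lhs]]] := em.
rewrite /= in god gout gid gin eM eK eI emat elast eet eeh ekl.
apply: (@run_time _ _ _ _ (1 + (1 + (1 + (1 + (maxn (1 + (1 + (1 + ((maxn (1 + 1) 1).+1 +
   (1 + (1 + (1 + (1 + (1 + (1 + 5)))))))))) (maxn 1 5).+1).+1))))); last by [].
rewrite /event; xs; xs => //=; xs; xs => //=; xs; xs => //=.
rewrite ei eu ev ew.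
xs; xs => //=; first by rewrite gn; repeat split=> //; nlia.
rewrite gn /ev_step /=.
set st1 := set_ireg _ xE _.
have m1 : iarr st1 aMat (ireg st1 xE) = ((u, v) \in El) by rewrite /= emat.
apply: run_if => /=.
- by split=> //; nlia.
- rewrite emat; case: (boolP ((u, v) \in El)) => // nuv _.
  have su : (size (outs El u) < n)%N.
    have := uniq_size_ord (uniq_outs (El := rcons El (u, v)) _ u).
    by rewrite rcons_uniq nuv uE outs_rcons eqxx size_rcons => /(_ isT).
  have sv : (size (ins El v) < n)%N.
    have := uniq_size_ord (uniq_ins (El := rcons El (u, v)) _ v).
    by rewrite rcons_uniq nuv uE ins_rcons eqxx size_rcons => /(_ isT).
  have sEl : (size El < n * n)%N.
    by have := @size_El n (rcons El (u, v)); rewrite rcons_uniq nuv uE size_rcons => /(_ isT).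
  xs; xs => //=; first by nlia.
  xs; xs => //=; first by rewrite gn god; repeat split=> //; nlia.
  rewrite gn god.
  xs; xs => //=; first by rewrite god; split=> //; nlia.
  rewrite god; set st2 := set_iarr _ aOd _ _.
  xs; apply: run_then (_ : run B _ st2 (maxn (1 + 1) 1).+1
     (heads_mem (rcons El (u, v)))) _.
    apply: run_if => /=.
    + by repeat split=> //; nlia.
    + rewrite gid eS => /andP[/eqP sz0 nvs].
      have vs : v != s by move: nvs; rewrite -eqn_leq.
      have iv : ins El v = [::] by apply: size0nil; move: sz0; case: size.
      have vhs : v \notin hs by rewrite mhs iv eqxx andbF.
      have shs : (size hs < n)%N.
        by have := @uniq_size_ord n (v :: hs); rewrite /= vhs uhs => /(_ isT).
      xs; xs => //=; rewrite /incr; xs => /=; rewrite ehs; first by repeat split=> //; nlia.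
      exists (rcons hs v); split.
      * by rewrite rcons_uniq vhs.
      * move=> x; rewrite mem_rcons inE mhs ins_rcons [v == x]eq_sym.
        by case: (eqVneq x v) => //= ->; rewrite vs -size_eq0 size_rcons.
      * by rewrite size_rcons addn1.
      * move=> k; rewrite size_rcons ltnS nth_rcons /= => hk'.
        by case: ltngtP hk' => // lt _; exact: lhs.
    + rewrite gid eS negb_and negbK => hno; xs.
      exists hs; split=> // x; rewrite mhs ins_rcons.
      case: (eqVneq v x) => [<-|//]; rewrite -[rcons _ _ == _]size_eq0 size_rcons /= andbT.
      case: (eqVneq v s) => //= vs; rewrite -size_eq0.
      by case/orP: hno => [|/andP[h1 h2]]; [case: size|rewrite -val_eqE /= eqn_leq h1 h2 in vs].
  move=> st3 [fr3 hm3].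
  have iE (x : nat) : x != xHc -> ireg st3 x = ireg st2 x.
    by move=> hx; rewrite (frI fr3) //= inE.
  have aE (a : nat) : a != aAL -> iarr st3 a = iarr st2 a.
    by move=> hx; rewrite (frIA fr3) //= inE.
  have rE (a : nat) : rarr st3 a = rarr st2 a by rewrite (frRA fr3).
  have gE (a : nat) : rreg st3 a = rreg st2 a by rewrite (frR fr3).
  xs; xs => //=; first by rewrite !iE //= aE //= gid gn; repeat split=> //; nlia.
  rewrite !iE //= aE //= gid gn.
  xs; xs => //=; first by rewrite !iE //= aE //= gid; repeat split=> //; nlia.
  rewrite !iE //= aE //= gid.
  xs; xs => //=; rewrite !iE //= eM.
  xs; xs => //=; rewrite !iE //= eM.
  xs; rewrite /incr; xs => //=; first by rewrite !iE //= eM; repeat split=> //; nlia.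
  rewrite !iE //= eM.
  xs; xs => //=; rewrite !gE /= eI eW.
  set st4 := set_rreg _ _ _.
  have E4 : ireg st4 xE = (u * n + v)%N by rewrite /= iE.
  have T4 : ireg st4 xT = t by rewrite /= iE.
  have X4 : rreg st4 yX = w by rewrite /= gE.
  have K4 : ireg st4 xKc = size kl by rewrite /= iE.
  apply: run_then (keep_run (ek := (El, kl)) E4 T4 X4 K4 hk _ _) _.
  + by move=> u' v' w' h; rewrite /= rE; exact: elast.
  + by move=> j hj; rewrite /= rE !aE //; exact: ekl.
  move=> st5 [fr5 [k5 l5 m5]].
  have jE (x : nat) : x != xKc -> ireg st5 x = ireg st4 x.
    by move=> hx; rewrite (frI fr5) //= inE.
  have bE (a : nat) : a \notin [:: aKE; aKT] -> iarr st5 a = iarr st4 a.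
    by move=> hx; rewrite (frIA fr5).
  have hE (a : nat) : rreg st5 a = rreg st4 a by rewrite (frR fr5).
  split=> //=.
  + split; rewrite ?jE //= ?iE //.
    * move=> x; rewrite bE //= aE //= outs_rcons val_eqE [u == x]eq_sym.
      by case: eqP => [->|_]; rewrite ?size_rcons ?addn1 ?god.
    * move=> x j; rewrite bE //= aE //= outs_rcons.
      case: eqVneq => [<-|ne].
        rewrite size_rcons ltnS eqn_add2l nth_rcons => hj.
        by case: ltngtP hj => // lt _; rewrite gout.
      move=> hj; rewrite ix_eq //; last by exact: leq_trans hj (uniq_size_ord _).
      by rewrite val_eqE eq_sym (negbTE ne) /= gout.
    * move=> x; rewrite bE //= ins_rcons val_eqE [v == x]eq_sym.
      by case: eqP => [->|_]; rewrite ?size_rcons ?addn1 ?aE //= gid.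
    * move=> x j; rewrite bE //= aE //= ins_rcons.
      case: eqVneq => [<-|ne].
        rewrite size_rcons ltnS eqn_add2l nth_rcons => hj.
        by case: ltngtP hj => // lt _; rewrite gin.
      move=> hj; rewrite ix_eq //; last by exact: leq_trans hj (uniq_size_ord _).
      by rewrite val_eqE eq_sym (negbTE ne) /= gin.
  + by rewrite jE //= iE.
  + by rewrite jE //= size_rcons addn1.
  + by rewrite hE /= gE.
  + by rewrite hE /= gE.
  + by rewrite hE /= size_rcons -natr1; ring.
  + move=> a b; rewrite bE //= aE //= ix_eq // !val_eqE emat mem_rcons inE xpair_eqE.
    by case: ifP.
  + move=> j; rewrite bE //= aE //= size_rcons ltnS nth_rcons => hj.
    by case: ltngtP hj => // lt _; rewrite eet.
  + move=> j; rewrite bE //= aE //= size_rcons ltnS nth_rcons => hj.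
    by case: ltngtP hj => // lt _; rewrite eeh.
  + have [hs3 [x1 x2 x3 x4]] := hm3; exists hs3; split=> //.
    * by rewrite jE.
    * by move=> k hk'; rewrite bE //= x4.
- rewrite emat -ltnNge => uvE; have {}uvE : (u, v) \in El by move: uvE; case: (_ \in _).
  rewrite uvE /=.
  move: (kE u v uvE); case kw: (kept kl u v) => [w0|] // _ /=.
  have q1' : rreg st1 yQ = q by [].
  apply: run_if => //=; rewrite (elast _ _ _ kw) eq => h.
    by rewrite h; xs; split=> //; exists hs.
  rewrite (negbTE h).
  apply: run_then (keep_run (st := st1) (ek := (El, kl)) (u := u) (v := v) (w := w) (t := t)
    _ _ _ _ hk _ _) _ => //.
  move=> st5 [fr5 [k5 l5 m5]].
  split=> //=; rewrite ?(frI fr5) ?(frR fr5) //.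
  + split; rewrite ?(frI fr5) //; move=> *; rewrite (frIA fr5) //=; by auto.
  + by move=> a b; rewrite (frIA fr5) //= emat.
  + by move=> j hj; rewrite (frIA fr5) //= eet.
  + by move=> j hj; rewrite (frIA fr5) //= eeh.
  + exists hs; split=> //; first by rewrite (frI fr5).
    by move=> k hk'; rewrite (frIA fr5) //= lhs.
Qed.

End Events.

(** * The list of kept events, for all versions at once *)

Section EventList.
Context {R : realType} (n : nat) (W q : R) (K : nat) (G : wgraph R n).
Context (W1 : 1 <= W) (q1 : 1 < q) (WK : W < q ^+ K) (wG : weights_in W G).
Notation entry := (nat * ('I_n * 'I_n) * R)%type.
Implicit Types (u v : 'I_n) (es us : seq (wedge R n))
  (ek : seq ('I_n * 'I_n) * seq entry).

Lemma version_succ us j e : (j < size us)%N ->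
  version G us j.+1 = apply_update (version G us j) (nth e us j).
Proof. by move=> lt; rewrite /version (take_nth e) // foldl_rcons. Qed.

Lemma version_size us j : (size us <= j)%N -> version G us j = version G us (size us).
Proof. by move=> h; rewrite /version take_oversize // take_size. Qed.

Lemma incremental_nth us j e : incremental_seq W G us -> (j < size us)%N ->
  ((nth e us j).2 = 0 \/ 1 <= (nth e us j).2 <= W) /\
  incremental (version G us j) (nth e us j).
Proof.
clear wG; elim: us j G => // e' us IH [|j] G' /=; first by case=> ? ? _ _.
by case=> _ _ h lt; exact: IH.
Qed.

(** The initial edges are read one by one as insertions into the empty graph, so that [ev_step_inv]
    covers them as well. *)
Definition part es : wgraph R n :=
  fun u v => if has (fun e => e.1 == (u, v)) es then G u v else None.

Definition ev_es es := foldl (ev_step q 1) ([::], [::]) es.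
Fixpoint ev_us t ek us :=
  if us is e :: us' then ev_us t.+1 (ev_step q t ek e) us' else ek.

Lemma ev_us_rcons t ek us e :
  ev_us t ek (rcons us e) = ev_step q (t + size us) (ev_us t ek us) e.
Proof. by elim: us t ek => [|e' us IH] t ek /=; rewrite ?addn0 // IH addSnnS. Qed.

Definition entries_ok t ek := all (fun e : entry =>
  (0 < e.1.1 <= t)%N && ((e.2 == 0) || (1 <= e.2))) ek.2.

Lemma ev_step_size t ek e : (size (ev_step q t ek e).2 <= (size ek.2).+1)%N.
Proof.
by case: ek => El kl; rewrite /ev_step; (case: ifP => _; [|case: ifP => _]) => //=; rewrite ?size_rcons.
Qed.

Lemma ev_step_ok t t' ek e : (0 < t)%N -> (t' <= t)%N -> e.2 = 0 \/ 1 <= e.2 <= W ->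
  entries_ok t' ek -> entries_ok t (ev_step q t ek e).
Proof.
move=> t0 tt he ok.
have ok' : entries_ok t ek.
  by apply: sub_all ok => x /andP[/andP[-> h] ->]; rewrite (leq_trans h tt).
have e' : (e.2 == 0) || (1 <= e.2).
  by case: he => [->|/andP[-> _]]; rewrite ?eqxx ?orbT.
case: ek ok ok' => El kl ok ok'; rewrite /ev_step.
by (case: ifP => _; [|case: ifP => _]) => //; rewrite /entries_ok /= all_rcons /= t0 leqnn e'.
Qed.

Lemma ev_inv0 : ev_inv W q K 1 ([::], [::]) (part [::]).
Proof. by split. Qed.

Lemma edge_list_val es e : edge_list G es -> e \in es -> G e.1.1 e.1.2 = Some e.2.
Proof. by case: e => -[a b] w [_ h]; rewrite h /= => /eqP. Qed.

Lemma ev_es_inv es i : edge_list G es -> (i <= size es)%N ->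
  [/\ ev_inv W q K 1 (ev_es (take i es)) (part (take i es)),
      entries_ok 1 (ev_es (take i es)) & (size (ev_es (take i es)).2 <= i)%N].
Proof.
move=> hes; elim: i => [|i IH] lt; first by rewrite take0; split=> //; exact: ev_inv0.
have [i1 i2 i3] := IH (ltnW lt); case: es hes lt i1 i2 i3 {IH} => // x0 es0.
set es := x0 :: es0 => hes lt i1 i2 i3.
set e := nth x0 es i; have ein : e \in es by exact: mem_nth.
have ge := edge_list_val hes ein.
rewrite (take_nth x0) // -/e /ev_es foldl_rcons -/(ev_es _).
have ew : e.2 = 0 \/ 1 <= e.2 <= W by exact: wG ge.
have nh : has (fun e' => e'.1 == e.1) (take i es) = false.
  apply/negbTE/hasPn => e' e'in; apply/negP => /eqP ee.
  have : e' = e.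
    have := edge_list_val hes (mem_take e'in); rewrite ee ge => -[e2].
    by case: (e) (e') ee e2 => [a b] [c d] /= -> ->.
  move=> e'e; move: (take_uniq i.+1 hes.1); rewrite (take_nth x0) // rcons_uniq -/e -e'e.
  by rewrite e'in.
have pe : part (rcons (take i es) e) = apply_update (part (take i es)) e.
  apply/funext => u; apply/funext => v; rewrite /part /apply_update has_rcons.
  have -> : (e.1 == (u, v)) = (u == e.1.1) && (v == e.1.2).
    by rewrite {1}[e.1]surjective_pairing xpair_eqE [u == _]eq_sym [v == _]eq_sym.
  by case: (boolP (_ && _)) => [/andP[/eqP -> /eqP ->]|_].
split.
- rewrite pe; apply: (ev_step_inv q1 WK (leqnn 1) ew _ _ i1).
    by rewrite /incremental /part -surjective_pairing nh.
  by move=> u v w; rewrite /part; case: ifP => // _; exact: wG.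
- exact: (ev_step_ok _ _ ew i2).
- by apply: leq_trans (ev_step_size _ _ _) _.
Qed.

Lemma part_full es : edge_list G es -> part es = G.
Proof.
move=> hes; apply/funext => u; apply/funext => v; rewrite /part.
case e: (G u v) => [w|]; last by case: ifP.
suff -> : has (fun e' : wedge R n => e'.1 == (u, v)) es by [].
by apply/hasP; exists (u, v, w) => //=; rewrite hes.2 e.
Qed.

(** As entries carry their times, one list represents every version: those up to time t describe
    version t - 1. The minimum accounts for the updates that have not been read yet. *)
Lemma ev_us_inv ek us j : incremental_seq W G us ->
  ev_inv W q K 1 ek G -> entries_ok 1 ek -> (j <= size us)%N ->
  let ek' := ev_us 2 ek (take j us) in
  [/\ ev_inv W q K j.+1 ek' (version G us j), entries_ok j.+1 ek',
      (size ek'.2 <= size ek.2 + j)%N &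
      forall t, (0 < t)%N ->
        thins q [seq e <- ek'.2 | (e.1.1 <= t)%N] (version G us (minn t.-1 j))].
Proof.
move=> inc i1 ok1; elim: j => [|j IH] lt.
  have v0 : version G us 0 = G by rewrite /version take0.
  rewrite v0 take0; split; rewrite ?addn0 // => t t0.
  rewrite (_ : [seq e <- _ | _] = ek.2); first by case: i1.
  by apply/all_filterP; apply: sub_all ok1 => e /andP[/andP[_ h] _]; exact: leq_trans h t0.
move=> ek'; rewrite {}/ek'.
have [/= j1 j2 j3 j4] := IH (ltnW lt); case: us inc lt j1 j2 j3 j4 {IH} => // x0 us0.
set us := x0 :: us0 => inc lt j1 j2 j3 j4.
have [ew ei] := incremental_nth x0 inc lt.
rewrite (take_nth x0) // ev_us_rcons size_take lt (version_succ x0 lt).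
set e := nth x0 us j in ew ei *; set ek1 := ev_us _ _ _ in j1 j2 j3 j4 *.
have s1 : ev_inv W q K (2 + j) (ev_step q (2 + j) ek1 e) (apply_update (version G us j) e).
  by apply: (ev_step_inv q1 WK _ ew ei _ j1) => //; exact: version_weights.
split.
- exact: s1.
- by apply: (ev_step_ok _ _ ew j2).
- by apply: leq_trans (ev_step_size _ _ _) _; rewrite addnS ltnS.
- move=> t t0; have [tj|tj] := leqP t j.+1.
    (* The update of index [j] has time [j + 2], so it is invisible up to time [j + 1]. *)
    have -> : minn t.-1 j.+1 = minn t.-1 j by lia.
    have := j4 t t0; case: (ek1) => El kl; rewrite /ev_step.
    have h : (2 + j <= t)%N = false by lia.
    by (case: ifP => _; [|case: ifP => _]) => //=; rewrite filter_rcons /= h.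
  have -> : minn t.-1 j.+1 = j.+1 by lia.
  rewrite (version_succ x0 lt) -/e; case: s1 => _ _ s1 s2 _ _ _ _.
  rewrite (_ : [seq e <- _ | _] = (ev_step q (2 + j) ek1 e).2) //.
  by apply/all_filterP; apply: sub_all s2 => e1 /leq_trans; apply.
Qed.

End EventList.

(** * Choice of the number of levels and of the ratio [q] *)

Section Setup.
Context {R : realType} (B n : nat) (W eps : R).
Implicit Types (st : state R).

Lemma leq_expn_up_log D l : (2 ^ l <= D + 1)%N = (l < up_log 2 (D + 2))%N.
Proof.
apply/idP/idP => [le|lt].
  rewrite ltnNge; apply/negP => lel.
  have := up_logP (D + 2) (isT : (1 < 2)%N).
  have := leq_pexp2l (isT : (0 < 2)%N) lel; lia.
rewrite leqNgt; apply/negP => gt.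
have := up_log_min (isT : (1 < 2)%N) (_ : (D + 2 <= 2 ^ l)%N).
by move=> /(_ ltac:(lia)); rewrite leqNgt lt.
Qed.

Lemma setup_run st D k s : ireg st 0%N = n -> ireg st 1%N = k -> ireg st xD = D ->
  ireg st xS = s -> rreg st yEps = eps -> rreg st yW = W -> (2 * (D + 2) < B)%N ->
  let L := up_log 2 (D + 2) in
  run B setup st (4 * L + 7) (fun st' =>
    [/\ ireg st' xN = n, ireg st' xEs = k, ireg st' xH = (2 ^ L)%N,
        rreg st' yQ = 1 + eps / (2 * (2 * L%:R + 1)) & rreg st' yInf = 2 * W]).
Proof.
move=> e0' e1 e2 e3 e4 e5 hB L.
have -> : (4 * L + 7 = 1 + (1 + (1 + (1 + ((4 * L).+1 + (1 + 1))))))%N by lia.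
rewrite /setup; xs; xs => //=; xs; xs => //=; xs; xs => /=; first by lia.
xs; xs => //=; rewrite e0' e1.
set st1 := set_rreg _ _ _.
xs; apply: (run_then (@run_while _ _ _ _ (fun c st' => exists l,
   [/\ ireg st' xH = (2 ^ l)%N, rreg st' yX = 2 * l%:R + 1, (l <= L)%N & c = (4 * (L - l))%N])
   (fun st' => ireg st' xH = (2 ^ L)%N /\ rreg st' yX = 2 * L%:R + 1) st1 _ _ _) _).
- move=> c st' fr [l [eh ex lL ->]]; have ed : ireg st' xD = D by rewrite (frI fr).
  split=> /=; first by rewrite ed; repeat split=> //; lia.
  rewrite eh ed leq_expn_up_log -/L; case: ltnP => lt; last first.
    by have -> : L = l by lia.
  have := leq_expn_up_log D l; rewrite -/L lt => hl.
  exists 2%N; first by lia.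
  apply: (@run_seq _ _ _ _ _ 1 1); xs => /=; first by rewrite eh; repeat split=> //; lia.
  xs => //=; exists (4 * (L - l.+1))%N; first by lia.
  exists l.+1; rewrite eh ex; split=> //; first by rewrite expnS mulnC.
  by rewrite -natr1; ring.
- by exists 0%N; split=> //=; rewrite ?mulr0 ?add0r ?subn0.
move=> st2 [fr2 [h2 x2]].
have L0 : 2 * (2 * L%:R + 1) != 0 :> R.
  by apply: lt0r_neq0; rewrite mulr_gt0 // ltr_wpDl // mulr_ge0.
apply: (@run_seq _ _ _ _ _ 1 1); xs => /=; first by repeat split=> //=; rewrite x2.
xs => //=; rewrite x2 (frR fr2) //= (frR fr2) //= e4 e5; split=> //.
- by rewrite (frI fr2) //= e0'.
- by rewrite (frI fr2) //= e1.
Qed.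

End Setup.

Section EventsRun.
Context {R : realType} (B n H : nat) (W q : R) (K : nat) (G : wgraph R n) (s : 'I_n).
Context (hB : (4 * (H + 1) * (n + 1) * (n + 1) < B)%N).
Context (W1 : 1 <= W) (q1 : 1 < q) (WK : W < q ^+ K) (wG : weights_in W G).
Notation entry := (nat * ('I_n * 'I_n) * R)%type.
Implicit Types (st : state R) (es us : seq (wedge R n)).

Lemma nb_edges_le (G' : wgraph R n) : (nb_edges G' <= n * n)%N.
Proof. by apply: leq_trans (max_card _) _; rewrite card_prod card_ord. Qed.

Lemma edge_list_size (G' : wgraph R n) es : edge_list G' es -> (size es <= nb_edges G')%N.
Proof.
move=> hes; have u1 : uniq [seq e.1 | e <- es].
  rewrite map_inj_in_uniq; first by case: hes.
  move=> e e' ein e'in ee; have := edge_list_val hes ein; rewrite ee (edge_list_val hes e'in).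
  by case: (e) (e') ee => [a b] [c d] /= -> [->].
rewrite -(size_map fst) -(card_uniqP u1).
apply/subset_leq_card/fintype.subsetP => x /mapP[e ein ->].
by rewrite inE /adj (edge_list_val hes ein).
Qed.

Lemma ev_inv_kept t (ek : seq ('I_n * 'I_n) * seq entry) G' u v : ev_inv W q K t ek G' -> (u, v) \in ek.1 -> kept ek.2 u v.
Proof.
by case=> _ h1 h2 _ _ _ _ _; rewrite h1 /adj => g; have := h2 u v; case: (G' u v) g => // w _ [w0 ->].
Qed.

Definition events_out es us := ev_us q 2 (ev_es q es) us.

Lemma events_run st es us : edge_list G es -> incremental_seq W G us ->
  (size us + 1 < H)%N ->
  ireg st xEs = size es -> ireg st xD = size us ->
  (forall i e, (i < size es)%N -> [/\ iarr st 0 i = (nth e es i).1.1,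
     iarr st 1 i = (nth e es i).1.2 & rarr st 0 i = (nth e es i).2]) ->
  (forall i e, (i < size us)%N -> [/\ iarr st 2 i = (nth e us i).1.1,
     iarr st 3 i = (nth e us i).1.2 & rarr st 1 i = (nth e us i).2]) ->
  ev_mem W q s ([::], [::]) st ->
  run B events st (size es * 32 + size us * 33 + 5) (fun st' => ev_mem W q s (events_out es us) st').
Proof.
move=> hes inc HD ees eD hin1 hin2 em0.
have ses : (size es <= n * n)%N by apply: leq_trans (edge_list_size hes) (nb_edges_le _).
have B2 : (2 < B)%N by apply: (B_bound hB); clear; lia.
have H1 : (n * n + H < B)%N by clear -hB; nia.
have -> : (size es * 32 + size us * 33 + 5 =
   1 + ((size es * (30 + 2) + 2) + (size us * (31 + 2) + 2)))%N by lia.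
rewrite /events; xs; xs => /=; first by lia.
xs; set st1 := set_ireg _ _ _.
have em1 : ev_mem W q s ([::], [::]) st1.
  by case: em0 => -[*] *; split=> //; split.
apply: (run_then (@run_for_const _ _ _ _ _ _ _ 30
   (fun i st' => ev_mem W q s (ev_es q (take i es)) st')
   (fun st' => ev_mem W q s (ev_es q es) st') _ _ _ _ (ees : ireg st1 xEs = size es) _ _ _) _) => //.
- by lia.
- rewrite take0; case: em1 => -[*] *; split=> //; split => //.
- move=> i st2 fr ei e2 lt em2.
  have e : wedge R n by exact: (s, s, 0).
  have [h1 h2 h3] := hin1 i e lt.
  have [x1 x2 x3] := ev_es_inv q1 WK wG hes (ltnW lt).
  have kE u v : (u, v) \in (ev_es q (take i es)).1 -> kept (ev_es q (take i es)).2 u v.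
    exact: ev_inv_kept x1.
  rewrite (take_nth e) // /ev_es foldl_rcons -/(ev_es q _).
  have := @event_run _ B n H W q s hB st2 (ev_es q (take i es)).1 (ev_es q (take i es)).2 1
     (nth e es i).1.1 (nth e es i).1.2 (nth e es i).2 i 0 1 0 isT isT isT ei.
  rewrite -!surjective_pairing => er.
  apply: run_le (er _ _ _ _ _ _ kE em2) (leqnn _) _.
  + by rewrite (frI fr).
  + by rewrite (frIA fr).
  + by rewrite (frIA fr).
  + by rewrite (frRA fr).
  + by case: x1.
  + by move: x3; lia.
  + by move=> st3; case=> -[*] *; split=> //; split.
- by move=> st2 _; rewrite take_size.
move=> st2 [fr2 em2].
have [_ _ i3'] := ev_es_inv q1 WK wG hes (leqnn _); rewrite take_size in i3'.
have [i1 i2 _] := ev_es_inv q1 WK wG hes (leqnn _).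
rewrite take_size (part_full hes) in i1 i2.
apply: (@run_for_const _ _ _ _ _ _ _ 31
   (fun i st' => ev_mem W q s (ev_us q 2 (ev_es q es) (take i us)) st')) => //.
- by lia.
- by rewrite (frI fr2).
- rewrite take0 /=; case: em2 => -[*] *; split=> //; split => //.
- move=> i st3 fr ei e2 lt em3.
  have e : wedge R n by exact: (s, s, 0).
  have [h1 h2 h3] := hin2 i e lt.
  have [/= x1 x2 x3 _] := ev_us_inv W1 q1 WK wG inc i1 i2 (ltnW lt).
  set ek := ev_us q 2 (ev_es q es) (take i us) in x1 x2 x3 em3.
  have kE u v : (u, v) \in ek.1 -> kept ek.2 u v by exact: ev_inv_kept x1.
  rewrite (take_nth e) // ev_us_rcons -/ek size_take lt.
  apply: (@run_seq _ _ _ _ _ 1 30); xs => /=.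
    by rewrite ei; repeat split=> //; lia.
  rewrite ei; set st4 := set_ireg _ _ _.
  have em4 : ev_mem W q s ek st4 by case: em3 => -[*] *; split=> //; split.
  have := @event_run _ B n H W q s hB st4 ek.1 ek.2 (2 + i)
     (nth e us i).1.1 (nth e us i).1.2 (nth e us i).2 i 2 3 1 isT isT isT ei.
  rewrite -!surjective_pairing => er.
  apply: run_le (er _ _ _ _ _ _ kE em4) (leqnn _) _.
  + by rewrite /= addnC.
  + by rewrite /= (frIA fr) // (frIA fr2).
  + by rewrite /= (frIA fr) // (frIA fr2).
  + by rewrite /= (frRA fr) // (frRA fr2).
  + by case: x1.
  + by move: x3 i3'; lia.
  + by move=> st5; case=> -[*] *; split=> //; split.
- by move=> st3 _; rewrite take_size.
Qed.

End EventsRun.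
(** * Recording the drops and answering queries *)

Section Record.
Context {R : realType} (B n H lgn : nat) (W inf big q : R) (G : wgraph R n).
Context (us : seq (wedge R n)) (s : 'I_n) (El : seq ('I_n * 'I_n)).
Context (kl : seq (nat * ('I_n * 'I_n) * R)).
Context (W1 : 1 <= W) (wG : weights_in W G) (iG : incremental_seq W G us).
Context (hB : (4 * (H + 1) * (n + 1) * (n + 1) < B)%N) (H0 : (1 < H)%N).
Context (q1 : 1 < q) (infW : W <= inf).
Implicit Types (st : state R) (u v x : 'I_n) (t a : nat).
Context (uEl : uniq El).
Context (mEl : forall t u v, (0 < t)%N -> adj (vg G us t) u v -> (u, v) \in El).

(* Before the initial graph all distances are infinite, and at time H, after the last
   version, they are taken to be 0; both ends are thus known without any computation.
   Vertices without in-edges keep infinite estimates. *)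
Definition dist0 t v : R :=
  if v == s then 0 else if t == 0%N then inf else if ins El v == [::] then inf else 0.

(** Makes the infinite estimate at time [H] tight for a vertex without in-edges: there is no walk to
    compare it with. *)
Lemma nonhead_walk t v p : (0 < t)%N -> v != s -> ins El v = [::] ->
  path (adj (vg G us t)) s p -> last s p = v -> False.
Proof.
move=> t0 vs iv; case/lastP: p => [|p y] /=; first by move=> _ e; rewrite e eqxx in vs.
rewrite rcons_path last_rcons => /andP[_ ay] ey; subst y.
by have := mEl t0 ay; rewrite -mem_ins iv.
Qed.

(** The coarsest level is the single interval from 0 to [H], so only its two ends have to be
    described: infinite values are sound at 0, and zeros are tight at [H]. *)
Lemma init_dist_run st : ev_mem W q s (El, kl) st -> ireg st xH = H ->
  inf = 2 * W * ((size El)%:R + 1) -> big = inf + 1 ->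
  (forall i, rarr st bD i = 0) -> (forall i, rarr st bKey i = 0) ->
  run B init_dist st (size El * 4 + 6) (fun st' => level_inv H inf big q G us s El kl H q dist0 st').
Proof.
move=> em eH einf ebig zD zK.
have [gm eS eM eK eq eW eI emat elast eet eeh ekl [hs [uhs mhs ehs lhs]]] := em.
rewrite /= in gm eM eK eI emat elast eet eeh ekl mhs.
have sE : (size El <= n * n)%N := size_El uEl.
have B2 : (2 < B)%N by apply: (B_bound hB); clear; lia.
have inf_ge1 : 1 <= inf by exact: le_trans infW.
have -> : (size El * 4 + 6 = 1 + ((size El * (2 + 2) + 2) + (1 + (1 + 1))))%N by lia.
rewrite /init_dist; xs; xs => //=; rewrite eI -einf -ebig.
set st1 := set_rreg _ _ _.
have eM1 : ireg st1 xM = size El by [].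
xs; apply: (run_then (@run_for_const _ _ _ _ _ _ _ 2
   (fun i st' => (forall u, (u \in [seq e.1 | e <- take i El]) ||
        (u \in [seq e.2 | e <- take i El]) -> rarr st' bD u = inf) /\
      forall x : nat, (n <= x)%N -> rarr st' bD x = 0)
   (fun st' => (forall u, (u \in [seq e.1 | e <- El]) ||
        (u \in [seq e.2 | e <- El]) -> rarr st' bD u = inf) /\
      forall x : nat, (n <= x)%N -> rarr st' bD x = 0) _ _ _ _ eM1 _ _ _) _) => //.
- by lia.
- by rewrite take0; split=> [u|x _]; rewrite ?in_nil //=; exact: zD.
- move=> i st2 fr ei e2 lt [i1 i2].
  have f9 : iarr st2 aET = iarr st aET by rewrite (frIA fr).
  have f10 : iarr st2 aEH = iarr st aEH by rewrite (frIA fr).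
  have fI : rreg st2 yInf = inf by rewrite (frR fr) //= eI einf.
  apply: (@run_seq _ _ _ _ _ 1 1); xs => //=; xs => //=.
  rewrite ei f9 f10 eet // eeh // fI; case eE: (nth (s, s) El i) => [a b] /=.
  split.
  + move=> u; rewrite (take_nth (s, s)) // eE !map_rcons !mem_rcons !inE /= !val_eqE.
    case: eqP => //= _; case: eqP => //= _; exact: i1.
  + move=> x nx; have xa : x != a by have := ltn_ord a; move: nx; clear; lia.
    have xb : x != b by have := ltn_ord b; move: nx; clear; lia.
    by rewrite (negbTE xa) (negbTE xb) i2.
- by move=> st2 _; rewrite take_size.
move=> st2 [fr2 [D2 Z2]].
apply: (@run_seq _ _ _ _ _ 1 2); xs => //=.
apply: (@run_seq _ _ _ _ _ 1 1); xs => //=; first by lia.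
rewrite (frI fr2) //= eS (frI fr2) //= ehs.
have hsle : (size hs <= n)%N by exact: uniq_size_ord.
xs => //=; rewrite (frI fr2) //= eH.
have dvdH t : (H %| t)%N -> (t < H)%N -> t = 0%N.
  by move=> ht tH; apply/eqP; rewrite -leqn0; have := gtnNdvd (n := t) (d := H); case: t ht tH => // t ht tH /(_ isT tH); rewrite ht.
split.
- split=> //=.
  + case: gm => g1 g2 g3 g4 g5; split=> //=.
    * by rewrite (frI fr2).
    * by move=> u; rewrite (frIA fr2) //= g2.
    * by move=> u j hj; rewrite (frIA fr2) //= g3.
    * by move=> u; rewrite (frIA fr2) //= g4.
    * by move=> u j hj; rewrite (frIA fr2) //= g5.
  + by rewrite (frI fr2).
  + by rewrite (frI fr2).
  + by rewrite (frI fr2).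
  + by rewrite (frI fr2).
  + by rewrite (frR fr2).
  + by rewrite (frR fr2) //= eI.
  + by rewrite (frR fr2).
  + by move=> i hi; rewrite (frIA fr2) //= eet.
  + by move=> i hi; rewrite (frIA fr2) //= eeh.
  + by move=> j hj; rewrite !(frIA fr2) //= (frRA fr2) //=; exact: ekl.
- by [].
- by move=> v; rewrite /= (frRA fr2) //= zK.
- move=> v u uv; rewrite /= /dist0 val_eqE; case: ifP => // _ /=.
  apply: D2; apply/orP; left; apply/mapP; exists (u, v) => //.
  by move: uv; rewrite mem_ins.
- move=> t ht tH v; have [t0|tp] := posnP t.
    subst t; split=> //; rewrite /dist0 /=.
    + by move=> _; case: eqP => [->|_]; [exact: sound_source|left].
    + by case: eqP => _; [left|right].
    + by move=> ->; rewrite eqxx.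
  have -> : t = H.
    by apply/eqP; rewrite eqn_leq tH dvdn_leq.
  have HN : (H == 0)%N = false by lia.
  have q0 : 0 <= q by apply: ltW; exact: lt_trans q1.
  split; rewrite /dist0 ?HN ?ltnn //.
  + move=> _; case: eqP => vs; first exact: (tight_le0 wG iG).
    case: eqP => iv; last exact: (tight_le0 wG iG).
    by move=> p pp lp; exfalso; apply: (@nonhead_walk H v p) => //; [exact: ltnW|exact/eqP].
  + by case: eqP => _; [left|case: eqP => _; [right|left]].
  + by move=> ->; rewrite eqxx.
- move=> t ht tH; rewrite (dvdH t ht tH) add0n => v.
  have HN : (H == 0)%N = false by lia.
  rewrite /dist0 HN /=; case: eqP => _; first by left.
  case: eqP => _; first by left.
  by right; rewrite mulr0; exact: le_trans inf_ge1.
- move=> t ht tH; rewrite (dvdH t ht tH) add0n.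
  have HN : (H == 0)%N = false by lia.
  have mh v : (v \in hs) = (dist0 0 v != dist0 H v).
    rewrite mhs /dist0 HN /=; case: (eqVneq v s) => [_|_] /=; first by rewrite eqxx.
    case: eqP => _ /=; first by rewrite eqxx.
    by rewrite gt_eqF // (lt_le_trans ltr01).
  exists hs; split=> //=.
  + by move=> k hk; rewrite (frIA fr2) //= lhs.
  + move=> v; rewrite mhs => /andP[vs iv]; rewrite !val_eqE (negbTE vs).
    rewrite /dist0 (negbTE vs) HN (negbTE iv) /=.
    (* Row [H] lies beyond the first [n] cells, the only ones written so far, so it still holds
       zeros. *)
    have Hv : (n <= H * n + v)%N by apply: leq_trans (leq_addr _ _); rewrite leq_pmull //; lia.
    have -> : (H * n + v == s)%N = false.
      by apply/negbTE; have := ltn_ord s; move: Hv; clear; lia.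
    rewrite mul0n add0n; split; last exact: Z2.
    apply: D2; apply/orP; right.
    case ev: (ins El v) iv => [//|u l] _.
    have uv : u \in ins El v by rewrite ev mem_head.
    by apply/mapP; exists (u, v) => //; rewrite -mem_ins.
Qed.

Definition drops (D : nat -> 'I_n -> R) a v := [seq t <- iota 0 a | D t v != D t.+1 v].

Definition list_mem (D : nat -> 'I_n -> R) (l : 'I_n -> seq nat) st := forall v,
  iarr st aFC v = size (l v) /\
  forall k, (k < size (l v))%N ->
    iarr st aFT (v * H + k)%N = (nth 0%N (l v) k).+1 /\
    rarr st bFV (v * H + k)%N = D (nth 0%N (l v) k).+1 v.

Lemma record1_run st D l a o v j : list_mem D l st -> ireg st xO = o -> ireg st xK = j ->
  ireg st xA = a -> ireg st xH = H -> ireg st xN = n -> (a < H)%N ->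
  (size (l v) <= a)%N -> (forall u, size (l u) <= H)%N -> (o + j < B)%N ->
  iarr st aAL (o + j)%N = v -> rarr st bD (a.+1 * n + v)%N = D a.+1 v ->
  run B record1 st 5 (list_mem D (fun u => if u == v then rcons (l u) a else l u)).
Proof.
move=> lm eo ej ea eH en aH sv sl ojB ev eD.
have vn := ltn_ord v.
have vH : (v * H + H <= H * n)%N by rewrite -mulSnr mulnC leq_mul2l vn orbT.
have aHn : ((a + 1) * n <= H * n)%N by rewrite leq_mul2r addn1 aH orbT.
have b1 k : (k <= H)%N -> (v * H + k < B)%N.
  by move=> kH; apply: (B_bound hB); move: vH kH; clear; lia.
have b2 : ((a + 1) * n + v < B)%N.
  by apply: (B_bound hB); move: aHn vn; clear; lia.
have HB : (H + 1 < B)%N.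
  by apply: (B_bound hB); have := leq_mul (leqnn H) (leq_ltn_trans (leq0n _) vn); move: H0; clear; lia.
have [lv _] := lm v.
apply: (@run_time _ _ _ _ (1 + (1 + (1 + (1 + 1))))); last by [].
rewrite /record1; xs; xs => /=; first by rewrite eo ej; split=> //; move: ojB; clear; lia.
rewrite eo ej ev.
xs; xs => //=; rewrite lv.
xs; xs => /=.
- rewrite eH; repeat split=> //; last by apply: b1; move: sv aH; clear; lia.
  by have := b1 0%N (leq0n _); rewrite addn0.
- by rewrite ea; repeat split=> //; move: HB aH; clear; lia.
rewrite eH ea.
xs; xs => /=.
- rewrite eH; repeat split=> //; last by apply: b1; move: sv aH; clear; lia.
  by have := b1 0%N (leq0n _); rewrite addn0.
- rewrite ea en; repeat split=> //; try by move: HB aH b2; clear; lia.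
rewrite eH ea en addn1 eD.
xs => //=; first by repeat split=> //; move: HB aH sv; clear; lia.
move=> u; have [l1 l2] := lm u; split=> /=.
  by rewrite val_eqE l1; case: eqP => [->|//]; rewrite size_rcons addn1.
move=> k; case: (eqVneq u v) => [->|uv].
  rewrite size_rcons ltnS nth_rcons eqn_add2l.
  by case: (ltngtP k (size (l v))) => //= lt _; have [_ h] := lm v; exact: h.
move=> hk; have kH : (k < H)%N by exact: leq_trans hk (sl u).
have sH : (size (l v) < H)%N by move: sv aH; clear; lia.
by rewrite ix_eq // val_eqE (negbTE uv) /=; exact: l2.
Qed.

(** With intervals of length 1, row a lists the vertices that drop between a and a + 1. Reading the
    rows from left to right gives each vertex its times in increasing order. *)
Lemma record_run st E D : level_inv H inf big q G us s El kl 1 E D st ->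
  (forall i, iarr st aFC i = 0%N) ->
  run B record_all st (\sum_(a < H) (drop_cost lgn El 1 D a + 4 + 2) + 2)
    (list_mem D (drops D H)).
Proof.
move=> li zF; have [bs xg ek row pt dr al] := li.
have HB : (2 < B)%N by apply: (B_bound hB); clear; lia.
apply: (@run_for _ _ _ _ _ _ _ (fun a => drop_cost lgn El 1 D a + 4)%N
  (fun a st' => list_mem D (drops D a) st')) => //.
- by move: HB; clear; lia.
- by case: bs.
- by move=> v /=; rewrite zF.
- move=> a st1 fr ea eh lt lm.
  have [vs [uvs mvs cn lv dv]] := al a (dvd1n _) lt.
  have bs1 := base_frame fr isT bs.
  have en := gm_n (b_gm bs1); have eH := b_H bs1.
  have rn := uniq_size_ord uvs.
  have aHn : (a * n <= H * n)%N by rewrite leq_mul2r ltnW ?orbT.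
  have e14 : iarr st1 aCN = iarr st aCN by rewrite (frIA fr).
  have e13 : iarr st1 aAL = iarr st aAL by rewrite (frIA fr).
  have e8 : rarr st1 bD = rarr st bD by rewrite (frRA fr).
  apply: (@run_le _ _ _ _ (1 + (1 + (size vs * (5 + 2) + 2)))); [| |by move=> ? x; exact: x]; last first.
    have -> : drop_cost lgn El 1 D a = (\sum_(v <- vs) vcost lgn El v)%N.
      by rewrite /drop_cost [RHS]big_uniq //=; apply: eq_bigl => v; rewrite mvs.
    suff : (size vs * 7 <= \sum_(v <- vs) vcost lgn El v)%N by clear; lia.
    by rewrite -sum_seq_const; apply: leq_sum => v _; rewrite /vcost; clear; lia.
  xs; xs => /=.
    by rewrite ea en; repeat split=> //; apply: (B_bound hB); move: aHn; clear; lia.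
  rewrite ea en; xs; xs => //=; rewrite ea e14 cn.
  apply: (@run_for_const _ _ _ _ _ _ _ 5
     (fun j st' => list_mem D (fun v => if v \in take j vs then rcons (drops D a v) a else drops D a v) st')).
  + by move: HB; clear; lia.
  + by [].
  + by [].
  + by [].
  + by [].
  + by rewrite take0.
  + move=> j st2 fr2 ej er jlt lm2.
    set v := nth s vs j; have vv : v \in vs by exact: mem_nth.
    have vj : v \notin take j vs.
      by move: (take_uniq j.+1 uvs); rewrite (take_nth s) // rcons_uniq => /andP[].
    have sd u : (size (drops D a u) <= a)%N.
      by rewrite size_filter -[X in (_ <= X)%N](size_iota 0) count_size.
    apply: run_le (record1_run (a := a) (o := (a * n)%N) (v := v) (j := j) lm2 _ ej _ _ _ lt _ _ _ _ _) (leqnn _) _.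
    * by rewrite (frI fr2).
    * by rewrite (frI fr2).
    * by rewrite (frI fr2) //= (b_H bs1).
    * by rewrite (frI fr2).
    * by rewrite (negbTE vj).
    * move=> u; case: ifP => _; rewrite ?size_rcons; first exact: leq_ltn_trans (sd u) lt.
      exact: leq_trans (sd u) (ltnW lt).
    * by apply: (B_bound hB); move: aHn jlt rn; clear; lia.
    * by rewrite (frIA fr2) //= e13 lv.
    * by have [_ h] := dv v vv; rewrite addn1 in h; rewrite (frRA fr2) //= e8.
    move=> st3 lm3 u; have := lm3 u.
    rewrite /= (take_nth s) // mem_rcons inE -/v.
    by case: (eqVneq u v) => [->|_] //=; rewrite (negbTE vj).
  + move=> st2 _; rewrite take_size => lm2 v; have := lm2 v.
    rewrite mvs addn1 /= /drops -[in iota 0 a.+1]addn1 iotaD filter_cat add0n /=.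
    by case: ifP => _; rewrite ?cats1 ?cats0.
Qed.

Lemma drops_value (D : nat -> 'I_n -> R) v t :
  D t v = if drops D t v is [::] then D 0%N v else D (last 0%N (drops D t v)).+1 v.
Proof.
elim: t => [//|t IH].
rewrite /drops -[in iota 0 t.+1]addn1 iotaD filter_cat add0n /=.
case: eqP => [e|_] /=; first by rewrite cats0 -e IH.
by rewrite cats1; case: (seq.filter _ _) => [|x l] //=; rewrite last_rcons.
Qed.

Lemma search_run st (l : seq nat) v t k : sorted leq [seq d.+1 | d <- l] ->
  ireg st xV = v -> ireg st xH = H -> ireg st xT = t ->
  (forall i, (i < size l)%N -> iarr st aFT (v * H + i)%N = (nth 0%N l i).+1) ->
  ireg st xLo = 0%N -> ireg st xHi = size l -> (size l < 2 ^ k)%N ->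
  (v * H + H < B)%N -> (size l <= H)%N -> (2 * H + 2 < B)%N ->
  run B search st (5 * k).+1 (fun st' => ireg st' xLo = count (fun d => d.+1 <= t)%N l).
Proof.
move=> sl ev eH et el elo ehi sk hb1 hb2 hb3.
set c := count _ l.
have cs : (c <= size l)%N by exact: count_size.
apply: (@run_while _ _ _ _ (fun cr st' => exists j lo hi,
  [/\ ireg st' xLo = lo, ireg st' xHi = hi, (lo <= c <= hi)%N, (hi <= size l)%N &
      (hi - lo < 2 ^ j)%N /\ cr = (5 * j)%N])); last first.
  by exists k, 0%N, (size l); split=> //; rewrite subn0.
move=> cr st' fr [j [lo [hi [e1 e2 hc hs [hj ->]]]]]; split=> //=; rewrite e1 e2 -ltnNge.
case: ltnP => lt; last by move: hc lt; clear; lia.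
case: j hj => [|j] hj; first by move: hj lt; rewrite expn0; clear; lia.
have ev' : ireg st' xV = v by rewrite (frI fr).
have eH' : ireg st' xH = H by rewrite (frI fr).
have et' : ireg st' xT = t by rewrite (frI fr).
set md := ((lo + hi) %/ 2)%N.
have hmd : (lo <= md < hi)%N by rewrite /md; move: lt; clear; lia.
have mds : (md < size l)%N by move: hmd hs; clear; lia.
exists (1 + (maxn 1 1).+1)%N; first by rewrite /=; clear; lia.
xs; xs => /=; first by rewrite e1 e2; repeat split=> //; move: lt hs hb2 hb3; clear; lia.
rewrite e1 e2 -/md.
have hft : (iarr st' aFT (v * H + md) <= t)%N = (md < c)%N.
  rewrite (frIA fr) // el //.
  by rewrite -(@sorted_count_lt _ S 0%N l t md sl mds).
have pj : (2 ^ j.+1 = 2 * 2 ^ j)%N by rewrite expnS.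
xs => /=.
- rewrite ev' eH'; repeat split=> //; move: hb1 mds hb2; clear; lia.
- rewrite ev' eH' et' hft => mc.
  xs => /=; first by move: hb2 hb3 mds; repeat split=> //; clear -hb2 hb3 mds; lia.
  exists (5 * j)%N; first by clear; lia.
  exists j, (md + 1)%N, hi; split=> //; first by move: mc hc; clear; lia.
  by split=> //; move: hj; rewrite pj /md; clear; lia.
- rewrite ev' eH' et' hft -leqNgt => mc.
  xs => //=; exists (5 * j)%N; first by clear; lia.
  exists j, lo, md; split=> //; [by rewrite mc; move: hc; clear; lia|by apply: ltnW|].
  by split=> //; move: hj hmd lt; rewrite pj /md; clear; lia.
Qed.

Lemma drops_sorted (D : nat -> 'I_n -> R) v : sorted leq [seq d.+1 | d <- drops D H v].
Proof.
apply: (homo_sorted (e := leq)) => //.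
by apply: sorted_filter; [exact: leq_trans|exact: iota_sorted].
Qed.

Lemma drops_upto (D : nat -> 'I_n -> R) v t : (t <= H)%N ->
  [seq d <- drops D H v | (d.+1 <= t)%N] = drops D t v.
Proof.
move=> tH; rewrite /drops -{1}(subnKC tH) iotaD filter_cat filter_cat add0n.
have -> : [seq d <- [seq x <- iota t (H - t) | D x v != D x.+1 v] | (d < t)%N] = [::].
  apply: size0nil; rewrite size_filter; apply/eqP; rewrite eqn0Ngt -has_count.
  by apply/hasPn => d; rewrite mem_filter mem_iota -leqNgt => /and3P[].
rewrite cats0; apply/all_filterP/allP => d.
by rewrite mem_filter mem_iota => /and3P[].
Qed.

Lemma drops_size (D : nat -> 'I_n -> R) v t : (size (drops D t v) <= t)%N.
Proof. by rewrite size_filter -[X in (_ <= X)%N](size_iota 0) count_size. Qed.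

Definition query_mem D st :=
  [/\ ireg st xS = s, ireg st xH = H, rreg st yInf = inf & list_mem D (drops D H) st].

Lemma query_run st D v j k : query_mem D st -> ireg st 0%N = v -> ireg st 1%N = j ->
  (j.+1 < H)%N -> (forall u, D 0%N u = dist0 0 u) -> D j.+1 s = 0 ->
  (size (drops D H v) < 2 ^ k)%N ->
  run B query st (5 * k + 10) (fun st' =>
    if inf <= D j.+1 v then ireg st' 0%N = 0%N
    else ireg st' 0%N = 1%N /\ rreg st' 0%N = D j.+1 v).
Proof.
move=> [eS eH eI lm] ev ej jH D0 Ds sk.
have vn := ltn_ord v.
have vH : (v * H + H <= H * n)%N by rewrite -mulSnr mulnC leq_mul2l vn orbT.
have b1 : (v * H + H < B)%N.
  by apply: (B_bound hB); move: vH; clear; lia.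
have b2 : (2 * H + 2 < B)%N.
  apply: (B_bound hB); have := leq_mul (leqnn H) (leq_ltn_trans (leq0n _) vn).
  by move: H0; clear; lia.
have inf_pos : 0 < inf by apply: lt_le_trans (le_trans W1 infW).
have -> : (5 * k + 10 = 1 + (1 + (maxn (1 + 1)
   (1 + (1 + ((5 * k).+1 + (maxn 1 (1 + (maxn 1 1).+1)).+1)))).+1))%N by lia.
rewrite /query; xs; xs => //=; xs; xs => /=.
  by rewrite ej; repeat split=> //; move: b2 jH; clear; lia.
rewrite ev ej addn1.
xs => //=; rewrite eS -eqn_leq val_eqE.
  move=> /eqP ->; xs; xs => /=; first by move: b2; clear; lia.
  by xs => //=; rewrite Ds leNgt inf_pos.
move=> vs; have [lv lk] := lm v.
xs; xs => /=; first by move: b2; clear; lia.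
xs; xs => //=; rewrite lv.
set st1 := set_ireg _ _ _.
have Dv := drops_value D v j.+1.
have du : [seq d <- drops D H v | (d.+1 <= j.+1)%N] = drops D j.+1 v.
  by apply: drops_upto; exact: ltnW.
xs; apply: run_then (search_run (st := st1) (t := j.+1) (v := v) (k := k) (drops_sorted D v)
   _ _ _ _ _ _ sk b1 (drops_size D v H) b2) _ => //.
  by move=> i hi; have [] := lk i hi.
move=> st2 [fr2 lo2].
set c := count _ _ in lo2.
have ec : drops D j.+1 v = take c (drops D H v).
  by rewrite -du; apply: sorted_filter_take; exact: drops_sorted.
have sc : size (drops D j.+1 v) = c by rewrite -du size_filter.
xs => /=.
- by split=> //; move: b2; clear; lia.
- rewrite lo2 leqn0 => /eqP c0; xs => /=; first by move: b2; clear; lia.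
  have d0 : drops D j.+1 v = [::] by apply: size0nil; rewrite sc.
  by rewrite Dv d0 D0 /dist0 (negbTE vs) /= lexx.
- rewrite lo2 -ltnNge => c0.
  have cl : (c.-1 < size (drops D H v))%N.
    by have := count_size (fun d => d < j.+1)%N (drops D H v); rewrite -/c; move: c0; clear; lia.
  have sH := drops_size D v H.
  have e1 : ireg st2 xV = v by rewrite (frI fr2).
  have e2 : ireg st2 xH = H by rewrite (frI fr2).
  have e3 : rarr st2 bFV = rarr st bFV by rewrite (frRA fr2).
  have e4 : rreg st2 yInf = inf by rewrite (frR fr2).
  have val : rarr st bFV (v * H + (c - 1))%N = D j.+1 v.
    rewrite subn1 (lk _ cl).2 Dv; case ed: (drops D j.+1 v) => [|x l]; first by rewrite ed in sc; rewrite -sc in c0.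
    by rewrite -ed -nth_last sc ec nth_take // prednK.
  xs; xs => /=.
    rewrite e1 e2 lo2; repeat split=> //; move: b1 b2 sH cl c0; clear; lia.
  rewrite e1 e2 lo2 e3 val.
  xs => //=; rewrite e4 => h; xs => /=; try by move: b2; clear; lia.
  + by rewrite h.
  + by rewrite (negbTE h).
Qed.

End Record.
(** * Asymptotic bounds *)

Section Bounds.
Context {R : realType}.
Implicit Types (x y : R).

Lemma ln_ge_frac x : 0 < x -> 1 - x^-1 <= ln x.
Proof.
move=> x0; have := expR_ge1Dx (- ln x).
by rewrite expRN lnK ?posrE //; lra.
Qed.

Lemma ln_le_sub1 x : 0 < x -> ln x <= x - 1.
Proof. by move=> x0; have := expR_ge1Dx (ln x); rewrite lnK ?posrE //; lra. Qed.

Lemma lg_ge1 x : 1 <= lg x. Proof. by rewrite /lg le_max lexx. Qed.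
Lemma ln_le_lg x : ln x <= lg x. Proof. by rewrite /lg le_max lexx orbT. Qed.

Lemma half_le_ln2 : 2^-1 <= ln 2 :> R.
Proof. by have := @ln_ge_frac 2 (ltr0n _ 2); lra. Qed.

Lemma ln2_le1 : ln 2 <= 1 :> R.
Proof. by have := @ln_le_sub1 2 (ltr0n _ 2); lra. Qed.

(** The factor 2 is a bound for 1 / ln 2. *)
Lemma up_log_ln k : (0 < k)%N -> (up_log 2 k)%:R <= 1 + 2 * ln (k%:R : R).
Proof.
move=> k0; have [k1|k1] := ltnP 1 k; last first.
  have -> : k = 1%N by lia.
  by rewrite up_log1 ln1; lra.
have := up_log_gtn (isT : (1 < 2)%N) k1; have : (0 < up_log 2 k)%N by rewrite up_log_gt0 k1.
case: (up_log 2 k) => // l _ /= lt.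
have : ln (2 ^+ l) <= ln (k%:R : R).
  by rewrite ler_ln ?posrE ?exprn_gt0 ?ltr0n // -natrX ler_nat ltnW.
rewrite lnXn // -[ln 2 *+ l]mulr_natl -natr1.
have l0 : 0 <= l%:R :> R by [].
have := half_le_ln2; nra.
Qed.

Lemma up_log_lg D : (up_log 2 (D + 2))%:R <= 4 * lg (D%:R : R).
Proof.
have := lg_ge1 (D%:R : R); case: D => [|D]; first by rewrite up_lognn //; lra.
move=> g1; have D1 : (1 < D.+1 + 2)%N by lia.
have lt := up_log_gtn (isT : (1 < 2)%N) D1.
have L0 : (0 < up_log 2 (D.+1 + 2))%N by rewrite up_log_gt0 D1.
case: (up_log 2 (D.+1 + 2)) L0 lt => // l _ /= lt.
have lt2 : (2 ^ l <= 2 * D.+1)%N by lia.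
have : ln (2 ^+ l) <= ln (2 * D.+1%:R : R).
  by rewrite ler_ln ?posrE ?exprn_gt0 ?mulr_gt0 ?ltr0n // -natrX -natrM ler_nat.
rewrite lnXn // lnM ?posrE ?ltr0n // -[ln 2 *+ l]mulr_natl -natr1.
have := ln_le_lg (D.+1%:R : R); have := half_le_ln2; have := ln2_le1.
have l0 : 0 <= l%:R :> R by [].
nra.
Qed.

(** A converse of Bernoulli's inequality: in the induction, [2 k x <= 1] bounds the product
    [2 k x * x] by [x], which the factor 2 absorbs. *)
Lemma expr_le_linear x k : 0 <= x -> 2 * k%:R * x <= 1 -> (1 + x) ^+ k <= 1 + 2 * k%:R * x.
Proof.
move=> x0; elim: k => [|k IH] h; first by rewrite expr0 mulr0 mul0r addr0.
have hk : 2 * k%:R * x <= 1 by apply: le_trans h; rewrite -natr1; nra.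
rewrite exprSr; apply: le_trans (ler_wpM2r _ (IH hk)) _; first by lra.
rewrite -natr1; nra.
Qed.

(** The least K with [inf < q ^+ K], for [inf >= 1] and [q > 1]. *)
Definition drop_bound (inf q : R) := (Num.truncn (ln inf / ln q)).+1.

Lemma drop_bound_gt inf q : 1 <= inf -> 1 < q -> inf < q ^+ drop_bound inf q.
Proof.
move=> i1 q1; have q0 : 0 < q by exact: lt_trans q1.
have l0 : 0 < ln q by rewrite ln_gt0.
rewrite -ltr_ln ?posrE ?exprn_gt0 // ?(lt_le_trans ltr01) // lnXn // -[ln q *+ _]mulr_natl -ltr_pdivrMr //.
by rewrite /drop_bound; apply: truncnS_gt.
Qed.

(** As [inf <= 4 (n W) ^ 2], its logarithm is at most [4 lg (n W)]; with [ln (1 + x) >= x / 2] the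
    quotient is at most [16 lg (n W) (2 L + 1) / eps]. Then [2 L + 1 <= 9 lg D] gives 144, and
    rounding up adds 1. *)
Lemma drop_bound_le (n m L D : nat) (W eps : R) : (0 < n)%N -> (m <= n * n)%N -> 1 <= W ->
  0 < eps < 1 -> L%:R <= 4 * lg (D%:R : R) ->
  (drop_bound (2 * W * (m%:R + 1)) (1 + eps / (2 * (2 * L%:R + 1))))%:R <=
    145 * (lg (n%:R * W) * lg (D%:R : R) / eps).
Proof.
move=> n0 mn W1 /andP[e0 e1] hL; set inf := 2 * W * _; set x := eps / _.
have W0 : 0 < W by exact: lt_le_trans W1.
have nR : 1 <= n%:R :> R by rewrite ler1n.
have mR : m%:R <= n%:R * n%:R :> R by rewrite -natrM ler_nat.
have m0 : 0 <= m%:R :> R by [].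
have L0 : 0 <= L%:R :> R by [].
have d0 : 0 < 2 * (2 * L%:R + 1) :> R by nra.
have x0 : 0 < x by rewrite divr_gt0.
have x1 : x <= 1 by rewrite ler_pdivrMr // mul1r; nra.
have inf_ge1 : 1 <= inf by rewrite /inf; nra.
have lq : x / 2 <= ln (1 + x).
  have x10 : 0 < 1 + x by lra.
  apply: le_trans (ln_ge_frac x10).
  rewrite -(ler_pM2r x10) mulrBl mul1r mulVf ?gt_eqF //; nra.
have linf : ln inf <= 4 * lg (n%:R * W).
  have nW0 : 0 < n%:R * W by rewrite mulr_gt0 // (lt_le_trans ltr01).
  have : ln inf <= ln (2 * 2 * (n%:R * W) * (n%:R * W)).
    rewrite ler_ln ?posrE; [|exact: lt_le_trans inf_ge1|by have := mulr_gt0 nW0 nW0; lra].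
    rewrite /inf.
    have h1 : m%:R + 1 <= 2 * (n%:R * n%:R) :> R by nra.
    have h2 : W <= W * W by nra.
    have h3 : 2 * W * (m%:R + 1) <= 2 * W * (2 * (n%:R * n%:R)) by rewrite ler_wpM2l //; nra.
    apply: le_trans h3 _.
    rewrite [leRHS](_ : _ = 4 * (n%:R * n%:R) * (W * W)); last by ring.
    rewrite [leLHS](_ : _ = 4 * (n%:R * n%:R) * W); last by ring.
    by rewrite ler_wpM2l // !mulr_ge0.
  have pn : 0 < n%:R :> R by exact: lt_le_trans nR.
  rewrite !lnM ?posrE ?mulr_gt0 //.
  have := ln_le_lg (n%:R * W); rewrite lnM ?posrE //.
  have := lg_ge1 (n%:R * W); have := ln2_le1; lra.
have lq0 : 0 < ln (1 + x) by apply: lt_le_trans lq; rewrite divr_gt0.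
have li0 : 0 <= ln inf by rewrite ln_ge0.
have h1 : (drop_bound inf (1 + x))%:R <= ln inf / ln (1 + x) + 1.
  rewrite /drop_bound -natr1 lerD2r.
  by rewrite truncn_le divr_ge0 // ltW.
apply: le_trans h1 _.
set A := lg (n%:R * W) in linf *; set D' := lg D%:R in hL *.
have A1 : 1 <= A by exact: lg_ge1.
have D1 : 1 <= D' by exact: lg_ge1.
have h2 : ln inf / ln (1 + x) <= 4 * A / (x / 2).
  rewrite ler_pdivrMr // mulrAC ler_pdivlMr ?divr_gt0 //.
  have x20 : 0 <= x / 2 by rewrite divr_ge0 // ltW.
  by apply: ler_pM.
have e2 : 4 * A / (x / 2) = 16 * A * (2 * L%:R + 1) / eps.
  by rewrite /x; field; rewrite ?gt_eqF //; nra.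
have h3 : 16 * A * (2 * L%:R + 1) / eps <= 144 * (A * D' / eps).
  rewrite mulrA ler_wpM2r ?invr_ge0 ?(ltW e0) //; nra.
have h4 : 1 <= A * D' / eps by rewrite ler_pdivlMr // mul1r; nra.
by move: h2 h3 h4; rewrite e2; lra.
Qed.

Lemma up_log_lg_mul (k c : nat) (X : R) : (0 < k)%N -> (0 < c)%N -> 1 <= X -> k%:R <= c%:R * X ->
  (up_log 2 (k + 1))%:R <= 1 + 2 * (1 + c%:R) * lg X.
Proof.
move=> k0 c0 X1 kX; have h := @up_log_ln (k + 1) ltac:(lia).
apply: le_trans h _; rewrite lerD2l -mulrA ler_wpM2l //.
have X0 : 0 < X by exact: lt_le_trans X1.
have cR : 0 < c%:R :> R by rewrite ltr0n.
have kR : 1 <= k%:R :> R by rewrite ler1n.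
apply: (@le_trans _ _ (ln (2 * c%:R * X))).
  rewrite ler_ln ?posrE ?ltr0n ?mulr_gt0 //; last by lia.
  rewrite natrD; nra.
rewrite !lnM ?posrE ?mulr_gt0 //.
have := ln_le_lg X; have := lg_ge1 X; have := ln2_le1; have := ln_le_sub1 cR; nra.
Qed.

End Bounds.

(** * From estimates to distances *)

Section Answers.
Context {R : realType} (n : nat) (W eps : R) (G : wgraph R n) (s : 'I_n).
Context (W1 : 1 <= W) (wG : weights_in W G) (heps : 0 < eps < 1).

Lemma sound_wdist v x p : path (adj G) s p -> last s p = v -> walk_weight G s p <= x ->
  (wdist G s v <= x%:E)%E.
Proof.
move=> pp lp wp; apply: le_trans (_ : ((walk_weight G s p)%:E <= _)%E); last by rewrite lee_fin.
by apply: ereal_inf_lbound; exists p.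
Qed.

Lemma tight_wdist v x : (forall p, path (adj G) s p -> last s p = v ->
  x <= (1 + eps) * walk_weight G s p) -> (x%:E <= (1 + eps)%:E * wdist G s v)%E.
Proof.
have /andP[e0 e1] := heps; have e10 : 0 < 1 + eps by lra.
move=> h; rewrite -lee_pdivrMl //.
apply: le_ereal_inf_tmp => _ [p [pp lp] <-].
by rewrite -EFinM lee_fin ler_pdivrMl // h.
Qed.

(* A shortest walk visits no vertex twice, so its weight is less than half of the value
   standing for infinity. *)
Lemma far_wdist v x m E : (nb_edges G <= m)%N -> E <= 1 + eps ->
  (forall p, path (adj G) s p -> last s p = v -> x <= E * walk_weight G s p) ->
  2 * W * (m%:R + 1) <= x -> wdist G s v = +oo%E.
Proof.
have /andP[e0 e1] := heps.
move=> nbm EE h hx; rewrite /wdist; set A := (X in ereal_inf X).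
suff -> : A = classical_sets.set0 by rewrite ereal_inf0.
apply/seteqP; split=> [y [p [pp lp] _]|//]; exfalso.
have [p' [pp' lp' up']] := shorten_walk wG pp; rewrite lp in lp'.
have sz := leq_trans (uniq_path_size pp' up') nbm.
have w0 := walk_weight_ge0 s p' wG.
have w1 := walk_weight_le W1 wG pp'.
have : (size p')%:R <= m%:R :> R by rewrite ler_nat.
have hh := h p' pp' lp'.
have h2 : E * walk_weight G s p' <= 2 * walk_weight G s p'.
  by rewrite ler_wpM2r //; lra.
have W0 : 0 < W by exact: lt_le_trans W1.
move=> sm; have : (size p')%:R * W <= m%:R * W by rewrite ler_wpM2r // ltW.
move: hh h2 w1 hx; lra.
Qed.

End Answers.

(** * Summing the costs of vertices over the edges *)

Section Assembly.
Context {R : realType} (n : nat).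
Implicit Types (El : seq ('I_n * 'I_n)).

Lemma sum_ins El : (\sum_v size (ins El v) = size El)%N.
Proof.
elim: El => [|e El IH]; first by rewrite big1.
rewrite (eq_bigr (fun v => (e.2 == v) + size (ins El v))%N); last first.
  by move=> v _; rewrite /ins /=; case: ifP.
rewrite big_split /= IH (bigD1 e.2) //= eqxx big1 // => v.
by rewrite eq_sym => /negbTE ->.
Qed.

Lemma sum_outs El : (\sum_v size (outs El v) = size El)%N.
Proof.
elim: El => [|e El IH]; first by rewrite big1.
rewrite (eq_bigr (fun v => (e.1 == v) + size (outs El v))%N); last first.
  by move=> v _; rewrite /outs /=; case: ifP.
rewrite big_split /= IH (bigD1 e.1) //= eqxx big1 // => v.
by rewrite eq_sym => /negbTE ->.
Qed.

(** A vertex whose values differ at 0 and [H] has an in-edge, to which the part of its cost that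
    does not depend on degrees is charged. *)
Lemma sum_vcost El H l (inf : R) (s : 'I_n) : (0 < H)%N ->
  (\sum_(v | dist0 inf s El 0 v != dist0 inf s El H v) vcost l El v <= size El * (10 * l + 83))%N.
Proof.
move=> H0.
apply: (@leq_trans (\sum_v (size (ins El v) * (5 * l + 74) + size (outs El v) * (5 * l + 9)))).
  rewrite big_mkcond /=; apply: leq_sum => v _; case: ifP => // ne.
  have : (0 < size (ins El v))%N.
    rewrite lt0n size_eq0; apply: contraTneq ne => iv; rewrite negbK /dist0 iv eqxx.
    by case: ifP => // _; case: ifP; rewrite ?eqxx //; case: ifP.
  rewrite /vcost /dij_cost /settle_cost /init_cost.
  move: (size _) (size _) => a b a0.
  have : (5 * l <= b * (5 * l))%N by rewrite leq_pmull.
  rewrite !mulnDr; move: (b * (5 * l))%N => c.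
  by lia.
by rewrite big_split /= -!big_distrl /= sum_ins sum_outs -mulnDr leq_mul2l; apply/orP; right; lia.
Qed.

Lemma size_edges El (G : wgraph R n) : uniq El -> (forall u v, ((u, v) \in El) = adj G u v) ->
  size El = nb_edges G.
Proof.
move=> uE mE; rewrite -(card_uniqP uE) /nb_edges cardsE.
by apply: eq_card => -[u v]; rewrite mE.
Qed.

Lemma nb_edges_mono (G G' : wgraph R n) : dominates G' G -> (nb_edges G <= nb_edges G')%N.
Proof.
move=> d; apply/subset_leq_card/fintype.subsetP => -[u v]; rewrite !inE /adj /=.
by case e: (G u v) => [w|] // _; have [w' ->] := d _ _ _ e.
Qed.

End Assembly.

(** * Correctness and cost of the preprocessing *)

Section Preprocess.
Context {R : realType} (B n D : nat) (W eps : R) (G : wgraph R n) (s : 'I_n).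
Context (us es : seq (wedge R n)).
Context (heps : 0 < eps < 1) (W1 : 1 <= W) (wG : weights_in W G) (iG : incremental_seq W G us).
Context (hes : edge_list G es) (sus : size us = D).

Let m := nb_edges (version G us D).
Let L := up_log 2 (D + 2).
Let H := (2 ^ L)%N.
Let l := up_log 2 n.
Let q : R := 1 + eps / (2 * (2 * L%:R + 1)).
Let inf : R := 2 * W * (m%:R + 1).
Let K := drop_bound inf q.

Context (hB : (4 * (H + 1) * (n + 1) * (n + 1) < B)%N) (hD : (2 * (D + 2) < B)%N).

Definition good_table (T : nat -> 'I_n -> R) :=
  [/\ forall u, T 0%N u = if u == s then 0 else inf,
      forall t, (t <= H)%N -> T t s = 0,
      forall v, (size (drops T H v) <= K)%N &
      forall t v, (0 < t < H)%N -> sound inf G us s t v (T t v) /\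
        tight G us s (q ^+ (2 * L + 1)) t v (T t v)].

Lemma preprocess_run : run B preprocess (input W eps s es us)
  (L * (K * (m * (20 * l + 223))) + 161 * D + 150)
  (fun st' => exists2 T, good_table T & query_mem H inf s T st').
Proof.
have /andP[e0 e1] := heps.
have q1 : 1 < q.
  by rewrite /q ltrDl divr_gt0 //; have L0 := ler0n R L; lra.
have infW : W <= inf.
  have W0 : 0 <= W by exact: le_trans W1.
  by rewrite /inf; have := mulr_ge0 W0 (ler0n R m); lra.
have inf_ge1 : 1 <= inf by exact: le_trans infW.
have infK : inf < q ^+ K by exact: drop_bound_gt.
have WK : W < q ^+ K by exact: le_lt_trans infK.
have DH : (D + 2 <= H)%N by exact: up_logP.
have H1 : (1 < H)%N by move: DH; clear; lia.
pose ek := events_out q es us.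
have [i1 i2 i3] := ev_es_inv q1 WK wG hes (leqnn _); rewrite take_size (part_full hes) in i1 i2 i3.
have [/= j1 j2 j3 j4] := ev_us_inv W1 q1 WK wG iG i1 i2 (leqnn _).
rewrite take_size -/(events_out q es us) -/ek sus in j1 j2 j3 j4.
have [k1 k2 k3 k4 k5 k6 k7 k8] := j1.
have sm : size ek.1 = m by apply: size_edges.
have skl : (size ek.2 <= m * K.+1)%N by rewrite -sm; exact: size_kept j1.
have vD t : version G us (minn t.-1 D) = vg G us t.
  rewrite /vg; case: leqP => h //.
  by rewrite -sus version_size // sus ltnW.
have mE t u v : (0 < t)%N -> adj (vg G us t) u v -> (u, v) \in ek.1.
  move=> t0; rewrite k2 -vD /adj; case e: (version _ _ _ u v) => [w|] // _.
  have [w' -> //] := version_dominates iG (geq_minr t.-1 D) e.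
have tk t : (0 < t < H)%N -> thins q [seq e <- ek.2 | (e.1.1 <= t)%N] (vg G us t).
  by case/andP=> t0 _; rewrite -vD; exact: j4.
have zk e : e \in ek.2 -> e.2 = 0 \/ 1 <= e.2.
  by move/allP: j2 => h /h /andP[_ /orP[/eqP|]]; [left|right].
have pk e : e \in ek.2 -> (0 < e.1.1)%N.
  by move/allP: j2 => h /h /andP[/andP[]].
have hl : (n <= 2 ^ l)%N by exact: up_logP.
have esm : (size es <= m)%N.
  apply: leq_trans (edge_list_size hes) _; apply: nb_edges_mono.
  by have := version_dominates iG (leq0n D); rewrite /version take0.
have n0 : (0 < n)%N by apply: leq_ltn_trans (ltn_ord s).
have K0 : (0 < K)%N by [].
have L0 : (0 < L)%N by rewrite up_log_gt0 addn2.
have HL : (L < H)%N by exact: ltn_expl.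
have H2 : (H <= 2 * (D + 1))%N.
  have : (1 < D + 2)%N by rewrite addn2.
  move/(up_log_gtn (isT : (1 < 2)%N)); rewrite -/L /H; case: (L) L0 => // k _ /=.
  by rewrite expnS; clear; lia.
have vc := @sum_vcost R n ek.1 H l inf s (ltnW H1); rewrite sm in vc.
set VC := (\sum_(_ | _) _)%N in vc.
(* As L < H <= 2 (D + 1), the terms in [H] and [L] alone add up to at most 128 (D + 1); with 33
   steps per update this makes 161. Apart from constants, the rest is bounded by multiples of
   [L * (K * m)] and [L * (K * VC)]. *)
have tot : ((4 * L + 7) + ((size es * 32 + size us * 33 + 5) + ((m * 4 + 6) +
   ((L * (m * 5 + 3 * size ek.2 + K * VC + 12) + 42 * H).+1 + (K * VC + H * 6 + 2)))) <=
   L * (K * (m * (20 * l + 223))) + 161 * D + 150)%N.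
  have x1 : (K * VC <= K * (m * (10 * l + 83)))%N by rewrite leq_mul2l vc orbT.
  have x2 : (m <= K * m)%N by rewrite leq_pmull.
  have x3 : (K * m <= L * (K * m))%N by rewrite leq_pmull.
  have x4 : (K * VC <= L * (K * VC))%N by rewrite leq_pmull.
  have x5 : (L * (K * VC) <= L * (K * (m * (10 * l + 83))))%N by rewrite leq_mul2l x1 orbT.
  have x6 : (L * m <= L * (K * m))%N by rewrite leq_mul2l x2 orbT.
  have x7 : (L * size ek.2 <= L * (K * m) + L * m)%N.
    by rewrite -mulnDr leq_mul2l (leq_trans skl) ?orbT // mulnS mulnC addnC.
  have x8 : (L * (K * (m * (20 * l + 223))) =
     2 * (L * (K * (m * (10 * l + 83)))) + 57 * (L * (K * m)))%N.
    by move: (L) (K) (m) (l); clear; nia.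
  have y1 : (L * (m * 5 + 3 * size ek.2 + K * VC + 12) =
      5 * (L * m) + 3 * (L * size ek.2) + L * (K * VC) + 12 * L)%N.
    by move: (size ek.2) (K * VC)%N => a b; clear; nia.
  rewrite sus x8 y1; move: x2 x3 x4 x5 x6 x7 esm HL H2; clear.
  move: (L * (K * (m * (10 * l + 83))))%N (L * (K * VC))%N (K * VC)%N (L * (K * m))%N (K * m)%N.
  move: (L * m)%N (L * size ek.2)%N (size es) (H) (L) (m); clear; lia.
apply: run_le tot (fun _ h => h).
rewrite /preprocess; xs.
apply: run_then (setup_run (D := D) (k := size es) (s := s) (n := n) (W := W) (eps := eps)
   _ _ _ _ _ _ hD) _ => //.
move=> st1 [fr1 [n1 es1 h1 q1' in1]].
have em0 : ev_mem W q s ([::], [::]) st1.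
  split=> //=; rewrite ?in1 ?add0r ?mulr1 ?(frI fr1) ?(@frR _ _ _ _ fr1 yW) //.
  - by split=> // *; rewrite (frIA fr1) //= ?nth_nil.
  - by move=> u v; rewrite (frIA fr1) //= nth_nil.
  - exists [::]; split=> //; last by rewrite (frI fr1).
    by move=> v; rewrite /= andbF.
have HDs : (size us + 1 < H)%N by rewrite sus; move: DH; clear; lia.
xs; apply: run_then (events_run hB W1 q1 WK wG hes iG HDs es1 _ _ _ em0) _.
- by rewrite (frI fr1).
- move=> i e hi; rewrite !(frIA fr1) // (frRA fr1) //=.
  by rewrite !(nth_map e).
- move=> i e hi; rewrite !(frIA fr1) // (frRA fr1) //=.
  by rewrite !(nth_map e).
move=> st2 [fr2 em2]; rewrite -/ek in em2.
have z8 i : rarr st2 bD i = 0 by rewrite (frRA fr2) // (frRA fr1) //= nth_nil.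
have z6 i : rarr st2 bKey i = 0 by rewrite (frRA fr2) // (frRA fr1) //= nth_nil.
have h2 : ireg st2 xH = H by rewrite (frI fr2).
have einf : inf = 2 * W * ((size ek.1)%:R + 1) by rewrite sm.
have em2' : ev_mem W q s (ek.1, ek.2) st2 by rewrite -surjective_pairing.
rewrite -sm; xs.
apply: run_then (init_dist_run (big := inf + 1) W1 wG iG hB H1 q1 infW k1 mE em2' h2 einf erefl z8 z6) _.
move=> st3 [fr3 li3].
have inf_big : inf < inf + 1 by rewrite ltrDl.
have mE' t u v : (0 < t < H)%N -> adj (vg G us t) u v -> (u, v) \in ek.1.
  by case/andP=> t0 _; exact: mE.
have T0K v : dist0 inf s ek.1 0 v < q ^+ K.
  by rewrite /dist0 /=; case: ifP => // _; apply: le_lt_trans infK; apply: le_trans inf_ge1.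
xs; apply: run_le (run_frame (levels_run (lgn := l) W1 wG iG hB hl q1 infW inf_big k1 mE' k5 tk zk pk
   li3 erefl T0K)) _ _; first by rewrite sm /level_cost sm.
move=> st4 [fr4 [T [li4 T0 TH]]].
have z18 i : iarr st4 aFC i = 0%N.
  by rewrite (frIA fr4) // (frIA fr3) // (frIA fr2) // (frIA fr1) //= nth_nil.
have [bs4 _ _ _ pt dr _] := li4.
apply: (@run_le _ _ _ _ (\sum_(a < H) (drop_cost l ek.1 1 T a + 4 + 2) + 2)); last by move=> ? h; exact: h.
  apply: run_then (record_run l hB H1 li4 z18) _ => st5 [fr5 lm].
  exists T; last first.
    by split=> //; rewrite ?(frI fr5) ?(frR fr5) //; case: bs4.
  split.
  - by move=> u; rewrite T0.
  - by move=> t tH; have [_ _ _ ->] := pt t (dvd1n _) tH s.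
  - move=> v.
    have -> : size (drops T H v) = (\sum_(i < H) (T i v != T i.+1 v))%N.
      rewrite size_filter -sum1_count big_mkcond /= -{1}[H]subn0 -/(index_iota 0 H) big_mkord.
      by apply: eq_bigr => i _; case: ifP.
    apply: (count_drops q1 (f := fun i => T i v)); first by rewrite T0.
    + by move=> i iH; have [_ _ ? _] := pt i (dvd1n _) iH v.
    + by move=> i iH; have := dr i (dvd1n _) iH v; rewrite addn1.
  - move=> t v /andP[t0 tH]; have [x1 x2 _ _] := pt t (dvd1n _) (ltnW tH) v.
    by split; [exact: x1|exact: x2].
rewrite !big_split /= !sum_nat_const card_ord.
have T0K' v : T 0%N v < q ^+ K by rewrite T0.
have dt := drop_total l ek.1 q1 pt dr T0K' (esym (muln1 H)) (isT : (0 < 1)%N).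
have dt1 : (\sum_(i < H) drop_cost l ek.1 1 T i <= K * VC)%N.
  apply: leq_trans (leq_trans dt _).
    by apply: leq_sum => i _; rewrite muln1.
  by rewrite T0 TH.
move: dt1; move: (H) (\sum_(_ < _) _)%N (K * VC)%N; clear; lia.
Qed.

End Preprocess.

(** * Persistence under queries, constants, and the theorem *)

Section Final.
Context {R : realType}.

Lemma query_mem_frame n H (inf : R) (s : 'I_n) T c st st' : frame c st st' ->
  [&& xS \notin wir c, xH \notin wir c, yInf \notin wrr c, aFC \notin wia c, aFT \notin wia c &
      bFV \notin wra c] ->
  query_mem H inf s T st -> query_mem H inf s T st'.
Proof.
move=> fr /and5P[h1 h2 h3 h4 /andP[h5 h6]] [q1 q2 q3 q4].
split; rewrite ?(frI fr) ?(frR fr) // => v; have [l1 l2] := q4 v.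
by split=> [|k hk]; rewrite ?(frIA fr) ?(frRA fr) //; exact: l2.
Qed.

(** [query] writes no array and none of the registers that [query_mem] reads, so the tables survive
    any sequence of queries. *)
Lemma after_queries_mem B n H D (inf : R) (s : 'I_n) T st st' :
  (n <= B)%N -> (D < B)%N -> wsafe B st -> query_mem H inf s T st ->
  after_queries B query n D st st' -> wsafe B st' /\ query_mem H inf s T st'.
Proof.
move=> nB DB w0 q0; elim=> [//|st1 st2 t v j _ [w1 q1] vn jD ex].
have wa : wsafe B (ask st1 v j).
  by case: w1 => a b; split=> //= x; case: ifP => _; [lia|case: ifP => _ //; lia].
split; first exact: exec_wsafe ex wa.
have qa : query_mem H inf s T (ask st1 v j) by exact: q1.
exact: query_mem_frame (exec_frame ex) isT qa.
Qed.

Lemma input_wsafe B n W eps (s : 'I_n) (es us : seq (wedge R n)) :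
  (n < B)%N -> (size es < B)%N -> (size us < B)%N -> wsafe B (input W eps s es us).
Proof.
move=> nB esB usB; have sB : (s < B)%N by exact: ltn_trans (ltn_ord s) nB.
have B0 : (0 < B)%N by exact: leq_ltn_trans nB.
split=> [|a i] /=.
  by case=> [|[|[|[|x]]]] //=; rewrite nth_nil.
have h (f : wedge R n -> 'I_n) (l : seq (wedge R n)) :
    (nth 0%N [seq nat_of_ord (f e) | e <- l] i < B)%N.
  have [lt|ge] := ltnP i (size l).
    by rewrite (nth_map (s, s, 0)) //; exact: ltn_trans (ltn_ord _) nB.
  by rewrite nth_default // size_map.
by case: a => [|[|[|[|a]]]] //=; rewrite ?nth_nil //; exact: h.
Qed.

(** The constant collects 4 from the number of levels, 145 from [drop_bound_le], and 283 from [20 l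
    + 223 <= 20 (1 + 2 ln n) + 223 <= 283 lg n]. *)
Lemma time_bound (L K m l D n : nat) (W eps : R) : 0 < eps -> (0 < n)%N ->
  L%:R <= 4 * lg (D%:R : R) -> K%:R <= 145 * (lg (n%:R * W) * lg (D%:R : R) / eps) ->
  l%:R <= 1 + 2 * ln (n%:R : R) ->
  (L * (K * (m * (20 * l + 223))) + 161 * D + 150)%:R <=
    (4 * 145 * 283)%:R * (m%:R * lg n%:R * lg (n%:R * W) * lg D%:R ^+ 2 / eps + D%:R + 1) :> R.
Proof.
move=> e0 n0 hL hK hl.
rewrite (natrD _ (L * (K * (m * (20 * l + 223))) + 161 * D) 150).
rewrite (natrD _ (L * (K * (m * (20 * l + 223)))) (161 * D)) (natrM _ 161 D).
rewrite (natrM _ L) (natrM _ K) (natrM _ m) (natrD _ (20 * l) 223) (natrM _ 20 l).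
rewrite (natrM _ (4 * 145) 283) (natrM _ 4 145).
set a := lg D%:R in hL hK *; set b := lg (n%:R * W) in hK *; set d := lg n%:R.
have a1 : 1 <= a by exact: lg_ge1.
have d1 : 1 <= d by exact: lg_ge1.
have hd : 20 * l%:R + 223 <= 283 * d :> R by have := ln_le_lg (n%:R : R); rewrite -/d; lra.
have D0 : 0 <= D%:R :> R by [].
have p0 : 0 <= 20 * l%:R + 223 :> R by have := ler0n R l; lra.
have h1 : K%:R * (m%:R * (20 * l%:R + 223)) <= 145 * (b * a / eps) * (m%:R * (283 * d)) :> R.
  apply: ler_pM; [exact: ler0n|exact: mulr_ge0|exact: hK|].
  by apply: ler_wpM2l.
have h2 : L%:R * (K%:R * (m%:R * (20 * l%:R + 223))) <=
    4 * a * (145 * (b * a / eps) * (m%:R * (283 * d))).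
  apply: ler_pM; [exact: ler0n| |exact: hL|exact: h1].
  by apply: mulr_ge0; [exact: ler0n|exact: mulr_ge0].
have -> : 4 * 145 * 283 * (m%:R * d * b * a ^+ 2 / eps + D%:R + 1) =
    4 * a * (145 * (b * a / eps) * (m%:R * (283 * d))) + 4 * 145 * 283 * (D%:R + 1).
  by ring.
by rewrite -addrA lerD //; lra.
Qed.

(** The denominator of [q] makes 2 k x equal to [eps] in [expr_le_linear] for k = 2 L + 1, which
    counts two factors per level and one for the ignored updates. *)
Lemma factor_bound (L : nat) (eps : R) : 0 < eps < 1 ->
  (1 + eps / (2 * (2 * L%:R + 1))) ^+ (2 * L + 1) <= 1 + eps.
Proof.
move=> /andP[e0 e1]; have L0 : 0 <= L%:R :> R by [].
have d0 : 0 < 2 * (2 * L%:R + 1) :> R by lra.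
have e : 2 * (2 * L + 1)%:R * (eps / (2 * (2 * L%:R + 1))) = eps.
  by rewrite natrD natrM; field; rewrite gt_eqF //; lra.
have x0 : 0 <= eps / (2 * (2 * L%:R + 1)) by rewrite divr_ge0 // ltW.
have := @expr_le_linear _ _ (2 * L + 1) x0; rewrite e; apply.
exact: ltW.
Qed.

End Final.

Theorem theorem3 (R : realType) :
  exists (pre qry : cmd) (C c : nat),
  forall (n : nat) (W eps : R) (G : wgraph R n) (s : 'I_n)
         (Delta : nat) (us : Delta.-tuple (wedge R n)) (es : seq (wedge R n)),
    0 < eps < 1 -> 1 <= W -> weights_in W G -> incremental_seq W G us ->
    edge_list G es ->
    let m := nb_edges (version G us Delta) in
    let B := ((n + m + Delta + 2) ^ c)%N in
    exists (t : nat) (st : state R),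
      [/\ exec B pre (input W eps s es us) t st,
          t%:R <= C%:R * (m%:R * lg n%:R * lg (n%:R * W) * lg Delta%:R ^+ 2 / eps
                          + Delta%:R + 1)
        & forall st1 : state R, after_queries B qry n Delta st st1 ->
          forall (v : 'I_n) (j : nat), (j <= Delta)%N ->
          exists (t' : nat) (st2 : state R),
            [/\ exec B qry (ask st1 v j) t' st2,
                t'%:R <= C%:R * lg (lg (n%:R * W) * lg Delta%:R / eps)
              & (wdist (version G us j) s v <= answer st2
                   <= (1 + eps)%:E * wdist (version G us j) s v)%E]].
Proof.
exists preprocess, query, (4 * 145 * 283)%N, 5%N.
move=> n W eps G s Delta us es heps W1 wG iG hes m B.
have /andP[e0 e1] := heps.
set D := Delta; have sus : size us = D by exact: size_tuple.
have n0 : (0 < n)%N by exact: leq_ltn_trans (ltn_ord s).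
pose L := up_log 2 (D + 2); pose H := (2 ^ L)%N.
have DH : (D + 2 <= H)%N by exact: up_logP.
have H2 : (H <= 2 * (D + 1))%N.
  have : (1 < D + 2)%N by rewrite addn2.
  move/(up_log_gtn (isT : (1 < 2)%N)); rewrite /H -/L.
  have : (0 < L)%N by rewrite up_log_gt0 addn2.
  by case: (L) => // k _ /=; rewrite expnS; clear; lia.
pose N := (n + m + D + 2)%N.
have BE : B = (N ^ 5)%N by [].
have N3 : (3 <= N)%N by rewrite /N; move: n0; clear; lia.
(* The origin of the exponent 5: the words in use need [4 (H + 1) (n + 1) ^ 2], which is at most
   [8 N ^ 3] as [H + 1 <= 2 N], and N >= 3 because the source makes [n] positive. *)
have big : (8 * (N * N * N) < B)%N.
  rewrite BE !expnS expn0; have : (9 <= N * N)%N by exact: (leq_mul N3 N3).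
  move: N3; rewrite !muln1; move: (N) => x; clear; nia.
have hB : (4 * (H + 1) * (n + 1) * (n + 1) < B)%N.
  apply: leq_ltn_trans big.
  have h1 : (H + 1 <= 2 * N)%N by move: H2 n0; rewrite /N; clear; lia.
  have h2 : (n + 1 <= N)%N by rewrite /N; clear; lia.
  have := leq_mul (leq_mul (leq_mul (leqnn 4) h1) h2) h2; rewrite -!mulnA; clear; lia.
have NB : (N * 8 <= B)%N.
  apply: leq_trans (ltnW big); rewrite mulnC leq_mul2l -mulnA leq_pmulr //.
  by rewrite muln_gt0; move: N3; clear; lia.
have hD : (2 * (D + 2) < B)%N by move: NB N3; rewrite /N; clear; lia.
have mn : (m <= n * n)%N by exact: nb_edges_le.
have esm : (size es <= m)%N.
  apply: leq_trans (edge_list_size hes) _; apply: nb_edges_mono.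
  by have := version_dominates iG (leq0n D); rewrite /version take0.
have w0 : wsafe B (input W eps s es us).
  by apply: input_wsafe; rewrite ?sus; move: NB esm N3 n0; rewrite /N; clear; lia.
have [t [st [ex tT w1 [T [T0 Ts Tsz Tst] qm]]]] :=
  preprocess_run (s := s) heps W1 wG iG hes sus hB hD w0.
have hL := up_log_lg (R := R) D.
have hK := drop_bound_le n0 mn W1 heps hL.
have hl := up_log_ln (R := R) n0.
exists t, st; split=> //.
  by apply: le_trans (time_bound m e0 n0 hL hK hl); rewrite ler_nat.
move=> st1 aq v j jD.
have nB : (n <= B)%N by move: NB; rewrite /N; clear; lia.
have DB : (D < B)%N by move: hD; clear; lia.
have [w2 q2] := after_queries_mem nB DB w1 qm aq.
have jH : (j.+1 < H)%N by move: DH jD; clear; lia.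
set inf := 2 * W * _ in T0 Tsz Tst qm q2 hK *.
set q := 1 + _ in Tsz Tst hK.
set K := drop_bound inf q in Tsz hK.
set X := lg (n%:R * W) * _ / eps in hK *.
pose k := up_log 2 (K + 1).
have sk : (size (drops T H v) < 2 ^ k)%N.
  by apply: leq_ltn_trans (Tsz v) _; rewrite -addn1; exact: up_logP.
have infW : W <= inf.
  have W0 : 0 <= W by exact: le_trans W1.
  by rewrite /inf; have := mulr_ge0 W0 (ler0n R m); lra.
have H1 : (1 < H)%N by move: DH; clear; lia.
have q1 : 1 < q.
  by rewrite /q ltrDl divr_gt0 //; have L0 := ler0n R L; lra.
have wa : wsafe B (ask st1 v j).
  case: w2 => x y; split=> //= z; case: ifP => _; first by move: hD jD; clear; lia.
  by case: ifP => _ //; exact: leq_trans (ltn_ord v) nB.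
have Tj := Ts _ (ltnW jH).
(* At time 0 the table [dist0] is the same for every edge list, so the empty one serves. *)
have [t' [st2 [ex2 t2 w3 ans]]] := query_run (v := v) (j := j) (El := [::]) W1 hB H1 q1 infW isT
  (st := ask st1 v j) q2 erefl erefl jH T0 Tj sk wa.
have X1 : 1 <= X.
  have a1 := lg_ge1 (n%:R * W); have b1 := lg_ge1 (D%:R : R).
  by rewrite /X ler_pdivlMr // mul1r; nra.
exists t', st2; split=> //.
  have K0 : (0 < K)%N by [].
  have hk := up_log_lg_mul K0 (isT : (0 < 145)%N) X1 hK.
  have lX := lg_ge1 X.
  have t2' : t'%:R <= 5 * k%:R + 10 :> R.
    by rewrite -(natrM _ 5) -natrD ler_nat.
  apply: le_trans t2' _; rewrite (natrM _ (4 * 145) 283) (natrM _ 4 145).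
  by move: hk; rewrite -/k; lra.
have [snd tgt] : sound inf G us s j.+1 v (T j.+1 v) /\
    tight G us s (q ^+ (2 * L + 1)) j.+1 v (T j.+1 v) by apply: Tst.
have qE : q ^+ (2 * L + 1) <= 1 + eps by exact: factor_bound.
rewrite /sound /tight /vg /= in snd tgt.
have wj : weights_in W (version G us j) by exact: version_weights.
have nbj : (nb_edges (version G us j) <= m)%N.
  by apply: nb_edges_mono; exact: version_dominates iG jD.
rewrite /answer; case: (leP inf (T j.+1 v)) ans => [far ->|near [-> ->]] /=.
  rewrite (far_wdist W1 wj heps nbj qE tgt far).
  by rewrite gt0_muley ?lexx // lte_fin; lra.
apply/andP; split.
  case: snd => [h|[p [pp lp wp]]]; first by move: near; rewrite ltNge h.
  exact: sound_wdist pp lp wp.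
apply: (tight_wdist heps) => p pp lp; apply: le_trans (tgt p pp lp) _.
by rewrite ler_wpM2r // (walk_weight_ge0 _ _ wj).
Qed.
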